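(* For each $\ell\ge 0$ let $V_\ell=V_{(\ell,0)}$ be the simple $(\ell+1)$-dimensional $U_q(gl_2(\mathbb{C}))$-module, and let $\delta_\ell=0$ if $\ell$ is odd and $\delta_\ell=1$ if $\ell$ is even. Then $$\dim \Lambda_\sigma^3 V_\ell =\delta_\ell\cdot \binom{\frac{\ell}{2}+1}{2},\qquad \dim S^3_\sigma V_\ell=(\ell+1)^2 +\delta_\ell\cdot \binom{\frac{\ell}{2}+1}{2}.$$ In particular, $V_\ell$ is flat if and only if $\ell\in \{0,1,2\}$.
   Context: $U_q(gl_2(\mathbb{C}))$ is the $\mathbb{C}(q)$-algebra generated by $E,F,K_\lambda$ ($\lambda\in\mathbb{Z}^2$) with $K_\lambda K_\mu=K_{\lambda+\mu}$, $K_0=1$, $K_\lambda E=q^{(\alpha|\lambda)}EK_\lambda$, $K_\lambda F=q^{-(\alpha|\lambda)}FK_\lambda$, $EF-FE=\frac{K_\alpha-K_{-\alpha}}{q-q^{-1}}$, where $\alpha=(1,-1)$ and $(\cdot|\cdot)$ is the standard inner product on $\mathbb{Z}^2$; coproduct $\Delta(E)=E\otimes1+K_\alpha\otimes E$, $\Delta(F)=F\otimes K_{-\alpha}+1\otimes F$, $\Delta(K_\lambda)=K_\lambda\otimes K_\lambda$. $\mathcal{O}_f$ is the category of finite-dimensional modules $V=\bigoplus_{\mu\in\mathbb{Z}^2}V(\mu)$ with $K_\lambda$ acting on $V(\mu)$ by $q^{(\lambda|\mu)}$. Simple objects are $V_{(\lambda_1,\lambda_2)}$, $\lambda_1\ge\lambda_2$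 integers, of dimension $\lambda_1-\lambda_2+1$. The braiding is $\mathcal{R}_{U,V}=\tau\circ R:U\otimes V\to V\otimes U$, $\tau$ the permutation of factors, $R=R_0R_1$ the universal $R$-matrix ($R\Delta=\Delta^{op}R$), with $R_0(u\otimes v)=q^{(\lambda|\mu)}u\otimes v$ on weight vectors of weights $\lambda,\mu$ and $R_1\in1\otimes1+\widehat{\bigoplus}_{k\ge1}\mathbb{C}(q)F^k\otimes E^k$. For $V$ in $\mathcal{O}_f$, $\mathcal{R}_{V,V}$ is diagonalizable with eigenvalues $\pm q^k$, $k\in\mathbb{Z}$; $S^2_\sigma V$ (resp. $\Lambda^2_\sigma V$) is the span in $V\otimes V$ of eigenvectors with eigenvalues of the form $+q^k$ (resp. $-q^k$). For $n\ge2$, $S^n_\sigma V=\bigcap_{i=1}^{n-1}V^{\otimes(i-1)}\otimes S^2_\sigma V\otimes V^{\otimes(n-1-i)}$ and $\Lambda^n_\sigma V=\bigcap_{i=1}^{n-1}V^{\otimes(i-1)}\otimes \Lambda^2_\sigma V\otimes V^{\otimes(n-1-i)}$ inside $V^{\otimes n}$; $S^0_\sigma V=\mathbb{C}(q)$, $S^1_\sigma V=V$. $V$ is called flat if $\dim S^n_\sigma V=\binom{\dim V+n-1}{n}$ for all $n\ge0$. *)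

(* Defs.v *)
From mathcomp Require Import all_boot all_order all_algebra.
From mathcomp Require Import boolp classical_sets reals.
From mathcomp Require Import fraction complex mxtens.

Set Implicit Arguments.
Unset Strict Implicit.
Unset Printing Implicit Defensive.

Import GRing.Theory.
Local Open Scope ring_scope.

Notation Cq R := {fraction {poly R[i]}}.

Definition qvar (R : realType) : Cq R := tofrac 'X.

Section Span.
Variables (K : fieldType) (vT : vectType K).

Lemma vspan_ex (A : set vT) :
  exists W : {vspace vT},
    forall U : {vspace vT}, (W <= U)%VS <-> (forall v, A v -> v \in U).
Proof.
pose P n := `[< exists s : seq vT,
  (forall v, v \in s -> A v) /\ \dim (<<s>>%VS : {vspace vT}) = n >].
have P0 : exists n, P n by exists (\dim (<<[::]>>%VS : {vspace vT})); apply/asboolP; exists [::].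
have Pb n : P n -> (n <= \dim (fullv : {vspace vT}))%N.
  by move=> /asboolP[s [_ <-]]; exact/dimvS/subvf.
case: (ex_maxnP P0 Pb) => n /asboolP[s [sA sn]] nmax.
exists <<s>>%VS => U; split=> [/subvP sU v Av|AU].
  apply: sU; have /nmax : P (\dim (<<v :: s>>%VS : {vspace vT})).
    apply/asboolP; exists (v :: s); split=> // w.
    by rewrite inE => /orP[/eqP->|/sA].
  rewrite -sn => le_dim.
  have sub : (<<s>> <= <<v :: s>>)%VS by rewrite span_cons addvSr.
  have /eqP -> : (<<s>> == <<v :: s>>)%VS by rewrite eqEdim sub le_dim.
  by rewrite memv_span // mem_head.
by apply/span_subvP => v /sA /AU.
Qed.

(* The linear span of an arbitrary, possibly infinite, set of vectors. *)
Definition vspan (A : set vT) : {vspace vT} := projT1 (cid (vspan_ex A)).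

Lemma vspanP (A : set vT) (U : {vspace vT}) :
  (vspan A <= U)%VS <-> (forall v, A v -> v \in U).
Proof. exact: (projT2 (cid (vspan_ex A)) U). Qed.

End Span.

Notation weight := (int * int)%type.

Definition wprod (la mu : weight) : int := la.1 * mu.1 + la.2 * mu.2.

Definition alpha : weight := (1, -1).

Section Uqgl2.
Variables (K : fieldType) (q : K).

(* A finite-dimensional module over U_q(gl_2), given on the space of column
   vectors of length [udim] by operators acting by left multiplication; since
   the algebra is presented by generators and relations, a module structure
   amounts to operators satisfying the relations. *)
Record uqmod := UqMod {
  udim : nat;
  actE : 'M[K]_udim;
  actF : 'M[K]_udim;
  actK : weight -> 'M[K]_udim;
  actK_add : forall la mu, actK la *m actK mu = actK (la + mu);
  actK_0 : actK 0 = 1%:M;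
  actK_E : forall la,
    actK la *m actE = q ^ wprod alpha la *: (actE *m actK la);
  actK_F : forall la,
    actK la *m actF = q ^ (- wprod alpha la) *: (actF *m actK la);
  actEF : actE *m actF - actF *m actE
    = (q - q^-1)^-1 *: (actK alpha - actK (- alpha))
}.

Definition wtspace (V : uqmod) (mu : weight) : {vspace 'cV[K]_(udim V)} :=
  vspan [set v : 'cV[K]_(udim V) |
    forall la, actK V la *m v = q ^ wprod la mu *: v].

Lemma mem_wtspace (V : uqmod) mu (v : 'cV[K]_(udim V)) :
  v \in wtspace V mu <-> forall la, actK V la *m v = q ^ wprod la mu *: v.
Proof.
split=> [vW la|vP].
  pose f := linfun (mulmx (actK V la) : 'cV[K]_(udim V) -> 'cV[K]_(udim V)).
  pose U := lker (f - (q ^ wprod la mu) *: \1%VF).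
  have memU (w : 'cV[K]_(udim V)) :
      (w \in U) = (actK V la *m w == q ^ wprod la mu *: w).
    rewrite memv_ker add_lfunE opp_lfunE scale_lfunE id_lfunE lfunE /=.
    by rewrite subr_eq0.
  apply/eqP; rewrite -memU; move: v vW; apply/subvP.
  by apply/vspanP => w /= wP; rewrite memU wP.
by move/vspanP: (subvv (wtspace V mu)); apply.
Qed.

(* V is the direct sum of its weight spaces; only finitely many of them can be
   nonzero, so a finite list of pairwise distinct weights suffices. *)
Definition in_Of (V : uqmod) : Prop :=
  exists s : seq weight,
    [/\ uniq s,
        directv (\sum_(mu <- s) wtspace V mu)%VS
      & (\sum_(mu <- s) wtspace V mu)%VS = fullv].

Definition submodule (V : uqmod) (U : {vspace 'cV[K]_(udim V)}) : Prop :=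
  forall v, v \in U ->
    [/\ actE V *m v \in U, actF V *m v \in U
      & forall la, actK V la *m v \in U].

Definition simple_mod (V : uqmod) : Prop :=
  (0 < udim V)%N /\
  forall U : {vspace 'cV[K]_(udim V)},
    submodule U -> U = 0%VS \/ U = fullv.

(* V is (isomorphic to) the simple object V_la of O_f, i.e. the one having la
   as highest weight. *)
Definition is_simple_obj (la : weight) (V : uqmod) : Prop :=
  [/\ in_Of V, simple_mod V
    & exists v : 'cV[K]_(udim V),
        [/\ v != 0, v \in wtspace V la & actE V *m v = 0]].

(* The tensor product U (x) V is the space of column vectors of length
   [udim U * udim V], with u (x) v encoded by [u *t v]. *)

Section Coproduct.
Variables U V : uqmod.

Definition DeltaE : 'M[K]_(udim U * udim V) :=
  actE U *t 1%:M + actK U alpha *t actE V.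
Definition DeltaF : 'M[K]_(udim U * udim V) :=
  actF U *t actK V (- alpha) + 1%:M *t actF V.
Definition DeltaK (la : weight) : 'M[K]_(udim U * udim V) :=
  actK U la *t actK V la.

Definition DeltaopE : 'M[K]_(udim U * udim V) :=
  1%:M *t actE V + actE U *t actK V alpha.
Definition DeltaopF : 'M[K]_(udim U * udim V) :=
  actK U (- alpha) *t actF V + actF U *t 1%:M.
Definition DeltaopK (la : weight) : 'M[K]_(udim U * udim V) :=
  actK U la *t actK V la.

End Coproduct.

Definition is_R0 (U V : uqmod) (R0 : 'M[K]_(udim U * udim V)) : Prop :=
  forall la mu (u : 'cV[K]_(udim U)) (v : 'cV[K]_(udim V)),
    u \in wtspace U la -> v \in wtspace V mu ->
    R0 *m (u *t v) = q ^ wprod la mu *: (u *t v).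

(* The action of \sum_k c_k F^k (x) E^k. The operator E is nilpotent on any
   object of O_f, so E^k = 0 for k > udim V and the sum may be truncated. *)
Definition R1_act (c : nat -> K) (U V : uqmod) : 'M[K]_(udim U * udim V) :=
  \sum_(k < (udim V).+1) c k *: (actF U ^+ k *t actE V ^+ k).

(* A family of operators is the action of the universal R-matrix R = R0 R1.
   The coefficients c do not depend on the modules, and are determined by
   c 0 = 1 and the intertwining relation R Delta = Delta^op R, which is only
   required on algebra generators. The values of [R U V] are irrelevant for
   modules outside O_f. *)
Definition universal_R
    (R : forall U V : uqmod, 'M[K]_(udim U * udim V)) : Prop :=
  exists c : nat -> K, c 0%N = 1 /\
  forall U V : uqmod, in_Of U -> in_Of V ->
    (exists R0 : 'M[K]_(udim U * udim V),
       is_R0 R0 /\ R U V = R0 *m R1_act c U V) /\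
    [/\ R U V *m DeltaE U V = DeltaopE U V *m R U V,
        R U V *m DeltaF U V = DeltaopF U V *m R U V
      & forall la, R U V *m DeltaK U V la = DeltaopK U V la *m R U V].

(* The permutation of tensor factors tau, see [tauE]. *)
Definition tau (m n : nat) : 'M[K]_(n * m, m * n) :=
  \matrix_(i, j) (((mxtens_unindex i).1 == (mxtens_unindex j).2)
               && ((mxtens_unindex i).2 == (mxtens_unindex j).1))%:R.

Lemma tauE m n (u : 'cV[K]_m) (v : 'cV[K]_n) : tau m n *m (u *t v) = v *t u.
Proof.
apply/matrixP => i j; rewrite !mxE.
pose k0 := mxtens_index ((mxtens_unindex i).2, (mxtens_unindex i).1).
rewrite (bigD1 k0) //=.
rewrite big1 ?addr0 => [|k kN].
  rewrite !mxE /k0 !mxtens_indexK /= !eqxx mul1r.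
  by rewrite mulrC; congr (v _ _ * u _ _); rewrite !ord1.
rewrite !mxE; case: andP => [[/eqP e1 /eqP e2]|_]; last by rewrite mul0r.
by move: kN; rewrite /k0 e1 e2 -surjective_pairing mxtens_unindexK eqxx.
Qed.

Section Powers.
Variable R : forall U V : uqmod, 'M[K]_(udim U * udim V).

Definition braiding (U V : uqmod) : 'M[K]_(udim V * udim U, udim U * udim V) :=
  tau (udim U) (udim V) *m R U V.

Definition S2 (V : uqmod) : {vspace 'cV[K]_(udim V * udim V)} :=
  vspan [set v : 'cV[K]_(udim V * udim V) |
    exists k : int, braiding V V *m v = q ^ k *: v].

Definition L2 (V : uqmod) : {vspace 'cV[K]_(udim V * udim V)} :=
  vspan [set v : 'cV[K]_(udim V * udim V) |
    exists k : int, braiding V V *m v = (- q ^ k) *: v].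

End Powers.

Lemma tpow_dim (d n : nat) (i : 'I_n.-1) :
  (d ^ i * (d * d) * d ^ (n - 2 - i) = d ^ n)%N.
Proof.
case: n i => [|[|n]] [i Hi] //=.
by rewrite mulnn -!expnD !subSS subn0 addn2 !addSn subnKC.
Qed.

(* V^(i) (x) W (x) V^(n-2-i) inside V^(n), for dim V = d; since i counts from
   0, W sits in positions i+1 and i+2. *)
Definition tpow_at (d n : nat) (W : {vspace 'cV[K]_(d * d)}) (i : 'I_n.-1) :
    {vspace 'cV[K]_(d ^ n)} :=
  vspan [set x : 'cV[K]_(d ^ n) |
    exists (a : 'cV[K]_(d ^ i)) (w : 'cV[K]_(d * d))
           (b : 'cV[K]_(d ^ (n - 2 - i))),
      w \in W /\ x = castmx (tpow_dim d i, erefl) (a *t w *t b)].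

(* For n = 0, 1 the intersection is empty and equals the whole space, of
   dimension 1 and d respectively. *)
Definition Ssigma (R : forall U V : uqmod, 'M[K]_(udim U * udim V))
    (n : nat) (V : uqmod) : {vspace 'cV[K]_(udim V ^ n)} :=
  (\bigcap_(i < n.-1) tpow_at (S2 R V) i)%VS.

Definition Lsigma (R : forall U V : uqmod, 'M[K]_(udim U * udim V))
    (n : nat) (V : uqmod) : {vspace 'cV[K]_(udim V ^ n)} :=
  (\bigcap_(i < n.-1) tpow_at (L2 R V) i)%VS.

Definition flat (R : forall U V : uqmod, 'M[K]_(udim U * udim V))
    (V : uqmod) : Prop :=
  forall n : nat, \dim (Ssigma R n V) = 'C(udim V + n - 1, n).

End Uqgl2.

Definition delta (l : nat) : nat := if odd l then 0 else 1.

(* Main.v *)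
From HB Require Import structures.
Require Import Defs.
From mathcomp Require Import all_boot all_order all_algebra.
From mathcomp Require Import classical_sets.
From mathcomp Require Import fraction reals complex mxtens.
From mathcomp Require Import ring zify.

(* The braiding of V (x) V is a module endomorphism, and R - R_0 raises the
   weight of one factor and lowers that of the other. Hence the highest weight
   vector of weight 2l - 2j is an eigenvector of eigenvalue (-1)^j times a
   power of q, and so is the dual functional eta_j, which vanishes on the image
   of F: eta_j kills the alternating tensors for j even and the symmetric ones
   for j odd.

   In the cube, a highest weight vector of a given weight becomes, in suitable
   coordinates, an array obeying a q-Pascal recursion, and is determined by one
   edge y_0, ..., y_m of it. Rescale the y_i so that they are integral at q = 0
   with residues c_i, not all zero. The functionals eta_j in the first two
   factors then give c_0 + ... + c_j = 0, and those in the last two give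
   c_i = 0, for j and i of prescribed parities; this forces all c_i to vanish
   whenever the equations suffice to do so over the residue field. So the space
   of highest weight vectors in the symmetric or alternating cube has dimension
   at most 1, and counting equations shows when it is 1. Beyond the middle
   weight, the same recursion holds for components of F^s x. Summing the
   dimensions of the simple constituents gives both formulas.

   For l <= 2 the symmetric square is cut out by the functionals eta_1 E^k,
   i.e. by straightening relations dual to a quadratic algebra with a basis of
   sorted monomials, so that V_l is flat; for l >= 3 the symmetric cube is too
   small. *)

(** For generic q the equations cutting out the cube have no visible closed solution. At q = 0 they
    become triangular: each eta_j keeps a single term, and the recursion degenerates to shifts and
    partial sums. Residues alone only bound the solution space from above. Existence comes from
    linear algebra: where multiplicity 1 is expected, the space of all highest weight vectors has
    dimension one more than the number of functionals of the wrong parity. A nonzero common zero x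
    is split into its symmetric and alternating components for one pair of factors; the component of
    the wrong sign is then killed by a whole family of functionals, and the residue argument shows
    that it is 0. So x has the right sign in both pairs. In degree m > l the triples of sum m no
    longer all fit in the cube, and the recursion does not close up. Fixing the first index at its
    maximal value l, and letting the power s of F stand in for the lost index, restores a full
    triangle of size at most l. The coefficients of R_1 are never computed: the eigenvalues are read
    off at corner entries, where R acts as R_0. *)

Set Implicit Arguments.
Unset Strict Implicit.
Unset Printing Implicit Defensive.

Import GRing.Theory.
Local Open Scope ring_scope.

(** * Residues at q = 0 *)

(* [res x c] says that x lies in a valuation ring of K with residue field F,
   whose maximal ideal contains q, and that c is the residue of x. *)
Record residue (K F : fieldType) (q : K) (res : K -> F -> Prop) : Prop :=
  Residue {
    res1 : res 1 1;
    resD : forall x y a b, res x a -> res y b -> res (x + y) (a + b);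
    resM : forall x y a b, res x a -> res y b -> res (x * y) (a * b);
    resN : forall x a, res x a -> res (- x) (- a);
    resV : forall x a, a != 0 -> res x a -> res x^-1 a^-1;
    res_inj : forall x a b, res x a -> res x b -> a = b;
    res_total : forall x, (exists a, res x a) \/ (exists a, res x^-1 a);
    resq : res q 0;
    resq_neq0 : q != 0;
    res_two : (1 + 1 : F) != 0
  }.

Lemma fraction_eq_div (A : idomainType) (x : {fraction A}) :
  exists p r : A, r != 0 /\ x * tofrac r = tofrac p.
Proof.
elim/quotW: x => f; exists (\n_f), (\d_f); split; first exact: denom_ratioP.
apply/eqP; rewrite !piE FracField.equivfE /FracField.mulf.
by rewrite !numden_Ratio ?(mulr1, oner_neq0, denom_ratioP) // mulrC.
Qed.

Section FractionResidue.
Variable F : fieldType.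
Local Notation K := {fraction {poly F}}.

(** The residue map of the local ring of [F[X]] at 0, as a relation: evaluation at 0 of a fraction
    that has a denominator not vanishing there. *)
Definition frac_res (x : K) (c : F) : Prop :=
  exists p r : {poly F},
    [/\ r.[0] != 0, x * tofrac r = tofrac p & p.[0] = c * r.[0]].

Lemma poly_horner0_neq0 (r : {poly F}) : r.[0] != 0 -> r != 0.
Proof. by apply: contraNneq => ->; rewrite horner0. Qed.

Lemma frac_resD (x y : K) a b :
  frac_res x a -> frac_res y b -> frac_res (x + y) (a + b).
Proof.
move=> [p [r [r0 xE pE]]] [p' [r' [r0' yE pE']]].
exists (p * r' + p' * r), (r * r'); split.
- by rewrite hornerM mulf_neq0.
- by rewrite tofracD !tofracM -xE -yE; ring.
- by rewrite hornerD !hornerM pE pE'; ring.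
Qed.

Lemma frac_resM (x y : K) a b :
  frac_res x a -> frac_res y b -> frac_res (x * y) (a * b).
Proof.
move=> [p [r [r0 xE pE]]] [p' [r' [r0' yE pE']]].
exists (p * p'), (r * r'); split.
- by rewrite hornerM mulf_neq0.
- by rewrite !tofracM -xE -yE; ring.
- by rewrite !hornerM pE pE'; ring.
Qed.

Lemma frac_resN (x : K) a : frac_res x a -> frac_res (- x) (- a).
Proof.
move=> [p [r [r0 xE pE]]]; exists (- p), r; split=> //.
  by rewrite mulNr xE tofracN.
by rewrite hornerN pE mulNr.
Qed.

Lemma frac_resV (x : K) a : a != 0 -> frac_res x a -> frac_res x^-1 a^-1.
Proof.
move=> a0 [p [r [r0 xE pE]]]; have p0 : p.[0] != 0 by rewrite pE mulf_neq0.
exists r, p; split=> //; last by rewrite pE mulKf.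
rewrite -xE mulrA mulVf ?mul1r //; apply: contraNneq (poly_horner0_neq0 p0).
by move=> x0; rewrite -tofrac_eq0 -xE x0 mul0r.
Qed.

Lemma frac_res_inj (x : K) a b : frac_res x a -> frac_res x b -> a = b.
Proof.
move=> [p [r [r0 xE pE]]] [p' [r' [r0' xE' pE']]].
have /(congr1 (fun p => p.[0])) : p * r' = p' * r.
  by apply/eqP; rewrite -tofrac_eq !tofracM -xE -xE'; apply/eqP; ring.
rewrite !hornerM pE pE' -!mulrA [r'.[0] * _]mulrC.
exact/mulIf/mulf_neq0.
Qed.

Lemma poly_X_factor (p : {poly F}) :
  p != 0 -> exists n (p' : {poly F}), p = 'X^n * p' /\ p'.[0] != 0.
Proof.
move=> p0; have [m [p' rp' pE]] := multiplicity_XsubC p 0.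
by exists m, p'; rewrite {1}pE subr0 mulrC; split=> //; rewrite p0 rootE in rp'.
Qed.

(** Once the powers of ['X] are split off numerator and denominator, the larger exponent decides
    whether [x] or its inverse is regular at 0. *)
Lemma frac_res_total (x : K) :
  (exists a, frac_res x a) \/ (exists a, frac_res x^-1 a).
Proof.
have [p [r [r0 xE]]] := fraction_eq_div x.
have [->|x0] := eqVneq x 0.
  left; exists 0, 0, 1; rewrite mul0r tofrac0 !hornerE; split=> //.
  exact: oner_neq0.
have p0 : p != 0 by rewrite -tofrac_eq0 -xE mulf_neq0 // tofrac_eq0.
have [n [p' [pE p'0]]] := poly_X_factor p0.
have [m [r' [rE r'0]]] := poly_X_factor r0.
have X0 k : tofrac ('X^k : {poly F}) != 0 by rewrite tofrac_eq0 -size_poly_eq0 size_polyXn.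
case/orP: (leq_total m n) => [lemn|lenm].
  left; exists (('X^(n - m) * p').[0] / r'.[0]), ('X^(n - m) * p'), r'.
  split=> //; last by rewrite mulfVK.
  have eX : 'X^m * ('X^(n - m) * p') = p by rewrite mulrA -exprD subnKC.
  by apply: (mulfI (X0 m)); rewrite -tofracM eX -xE rE tofracM; ring.
right; exists (('X^(m - n) * r').[0] / p'.[0]), ('X^(m - n) * r'), p'.
split=> //; last by rewrite mulfVK.
apply: (mulfI x0); rewrite mulrA divff // mul1r.
have eX : 'X^n * ('X^(m - n) * r') = r by rewrite mulrA -exprD subnKC.
by apply: (mulfI (X0 n)); rewrite -tofracM -pE -xE -eX tofracM; ring.
Qed.

Lemma frac_residue : (1 + 1 : F) != 0 -> residue (tofrac 'X) frac_res.
Proof.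
move=> two; split=> //.
- by exists 1, 1; rewrite mulr1 mul1r; split; rewrite // hornerC oner_neq0.
- exact: frac_resD.
- exact: frac_resM.
- exact: frac_resN.
- exact: frac_resV.
- exact: frac_res_inj.
- exact: frac_res_total.
- by exists 'X, 1; rewrite tofrac1 mulr1 !hornerE; split; rewrite // oner_neq0.
- by rewrite tofrac_eq0 polyX_eq0.
Qed.

End FractionResidue.

Section ResidueTheory.
Variables (K F : fieldType) (q : K) (res : K -> F -> Prop).
Hypothesis rP : residue q res.

Lemma res0 : res 0 0.
Proof. rewrite -(subrr (1 : K)) -(subrr (1 : F)); apply: (resD rP).
  exact: res1 rP.
by apply: (resN rP); exact: res1 rP. Qed.

Lemma res_sum (I : Type) (r : seq I) (P : pred I) (f : I -> K) (g : I -> F) :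
  (forall i, P i -> res (f i) (g i)) ->
  res (\sum_(i <- r | P i) f i) (\sum_(i <- r | P i) g i).
Proof.
by move=> fg; apply: (big_ind2 res) => //; [exact: res0|by move=> *; apply: (resD rP)].
Qed.

Lemma res_prod1 (I : Type) (r : seq I) (P : pred I) (f : I -> K) :
  (forall i, P i -> res (f i) 1) -> res (\prod_(i <- r | P i) f i) 1.
Proof.
move=> f1; apply: (big_ind (fun x => res x 1)) => //; first exact: res1 rP.
by move=> x y x1 y1; rewrite -[1]mulr1; apply: (resM rP).
Qed.

Lemma resX x n : res x 0 -> res (x ^+ n) (n == 0%N)%:R.
Proof.
case: n => [|n] x0; first by rewrite expr0; exact: res1 rP.
rewrite /=; elim: n => [|n IH] //; rewrite exprS -[X in res _ X](mul0r 0).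
exact: (resM rP).
Qed.

Lemma res_eq0 x a : res x a -> a != 0 -> x != 0.
Proof.
by move=> xa; apply: contraNneq => x0; apply/eqP; apply: (res_inj rP xa); rewrite x0; exact: res0.
Qed.

Lemma q_unit : q != 0. Proof. exact: resq_neq0 rP. Qed.

Lemma resqX n : res (q ^+ n) (n == 0%N)%:R.
Proof. exact/resX/(resq rP). Qed.

Lemma resqz (e : int) : 0 <= e -> res (q ^ e) (e == 0)%:R.
Proof. by case: e => // n _; exact: resqX. Qed.

(** Residues show that [q] is not a root of unity: the left side has residue 0, the right side 1. *)
Lemma qX_neq1 n : (0 < n)%N -> q ^+ n != 1.
Proof.
move=> n0; apply/eqP => qn1; have := resqX n; rewrite qn1 eqn0Ngt n0 /=.
by move/(res_inj rP (res1 rP)) => /eqP; rewrite oner_eq0.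
Qed.

Lemma qz_inj (e e' : int) : q ^ e = q ^ e' -> e = e'.
Proof.
wlog lee : e e' / e <= e' => [hw|eq_q].
  by have [/hw//|/hw h /esym/h] := orP (Order.TotalTheory.le_total e e').
have : q ^ (e' - e) = 1 by rewrite expfzDr ?q_unit // -eq_q -expfzDr ?q_unit ?subrr.
have : 0 <= e' - e by lia.
case En : (e' - e) => [n|//] _ /eqP; case: n En => [|n] En.
  by move=> _; lia.
by rewrite -exprnP => /eqP qn; have := qX_neq1 (ltn0Sn n); rewrite qn eqxx.
Qed.

(** A power of [q] with nonnegative exponent has residue 0 or 1, never -1; for the value 1 this is
    [res_two]. So the two signs of eigenvalues of the braiding cannot be confused. *)
Lemma qz_neqN (e e' : int) : q ^ e != - q ^ e'.
Proof.
wlog lee : e e' / e <= e' => [hw|].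
  have [/hw//|/hw h] := orP (Order.TotalTheory.le_total e e').
  by rewrite -eqr_oppLR eq_sym; apply: h.
apply/eqP => eq_q; have : q ^ (e' - e) = -1.
  rewrite expfzDr ?q_unit // -[q ^ e']opprK -eq_q mulNr -expfzDr ?q_unit //.
  by rewrite subrr.
have de : 0 <= e' - e by lia.
have := resqz de => /[swap] ->.
move/(res_inj rP (resN rP (res1 rP))) => /eqP.
case: (e' - e == 0); last by rewrite oppr_eq0 oner_eq0.
by rewrite -subr_eq0 -opprD oppr_eq0 (negPf (res_two rP)).
Qed.

(* A nonzero family can be rescaled to be integral with some nonzero residue. *)
Lemma res_normalize (n : nat) (y : nat -> K) :
  (exists2 i, (i < n)%N & y i != 0) ->
  exists u : K, u != 0 /\ exists c : nat -> F,
    (forall i, (i < n)%N -> res (u * y i) (c i)) /\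
    (exists2 i, (i < n)%N & c i != 0).
Proof.
elim: n => [[]//|n IHn] ex.
have [exn|nex] := boolP [exists i : 'I_n, y i != 0]; last first.
  have y0 i : (i < n)%N -> y i = 0.
    move=> lin; apply/eqP; apply: contraNT nex => yi.
    by apply/existsP; exists (Ordinal lin).
  have yn : y n != 0.
    case: ex => i; rewrite ltnS leq_eqVlt => /orP[/eqP->//|/y0->].
    by rewrite eqxx.
  exists (y n)^-1; split; first by rewrite invr_eq0.
  exists (fun i => (i == n)%:R); split; last by exists n; rewrite ?eqxx ?oner_eq0.
  move=> i; rewrite ltnS leq_eqVlt => /orP[/eqP->|lin].
    by rewrite mulVf // eqxx; exact: res1 rP.
  by rewrite (y0 i lin) mulr0 ltn_eqF //; exact: res0.
have [|u [u0 [c [uc [i0 li0 ci0]]]]] := IHn.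
  by move/existsP: exn => [i yi]; exists i.
have [[a ya]|[a ya]] := res_total rP (u * y n).
  exists u; split=> //; exists (fun i => if i == n then a else c i); split.
    move=> i; rewrite ltnS leq_eqVlt => /orP[/eqP->|lin]; rewrite ?eqxx //.
    by rewrite ltn_eqF //; exact: uc.
  by exists i0; rewrite ?ltn_eqF // ltnW.
have [yn0|yn0] := eqVneq (u * y n) 0.
  exists u; split=> //; exists (fun i => if i == n then 0 else c i); split.
    move=> i; rewrite ltnS leq_eqVlt => /orP[/eqP->|lin]; rewrite ?eqxx ?yn0.
      exact: res0.
    by rewrite ltn_eqF //; exact: uc.
  by exists i0; rewrite ?ltn_eqF // ltnW.
(* The last entry is not integral but its inverse is: dividing by it keeps the other entries
   integral and gives the last one residue 1. *)
exists ((u * y n)^-1 * u); split; first by rewrite mulf_neq0 ?invr_eq0.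
exists (fun i => if i == n then 1 else a * c i); split; last first.
  by exists n => //; rewrite eqxx oner_eq0.
move=> i; rewrite ltnS leq_eqVlt => /orP[/eqP->|lin].
  by rewrite eqxx -mulrA mulVf //; exact: res1 rP.
by rewrite ltn_eqF // -mulrA; exact: (resM rP ya (uc _ lin)).
Qed.

End ResidueTheory.

(** * Graded representations of sl_2 *)

(* A graded space with raising and lowering operators obeying the commutation
   relation of (quantum) sl_2; the weight of T m is L - 2 m. *)
Record sl2_graded (K : fieldType) (vT : vectType K) (E F : 'End(vT))
    (T : nat -> {vspace vT}) (L : nat) (br : nat -> K) : Prop := Sl2Graded {
  sl2E0 : forall u, u \in T 0%N -> E u = 0;
  sl2E : forall m u, u \in T m.+1 -> E u \in T m;
  sl2F : forall m u, u \in T m -> F u \in T m.+1;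
  sl2T0 : forall m, (L < m)%N -> T m = 0%VS;
  sl2EF : forall m u, u \in T m -> E (F u) = F (E u) + br m *: u;
  sl2_br : forall m, (m <= L)%N -> br (L - m)%N = - br m;
  sl2_brN : forall m k, (m + k <= L)%N -> (2 * m + k != L)%N ->
    \sum_(i < k.+1) br (m + i)%N != 0
}.

Lemma iter_lfunZ (K : fieldType) (vT : vectType K) (f : 'End(vT)) k a u :
  iter k f (a *: u) = a *: iter k f u.
Proof. by elim: k => //= k ->; rewrite linearZ. Qed.

Section Sl2.
Variables (K : fieldType) (vT : vectType K) (E F : 'End(vT)).
Variables (T : nat -> {vspace vT}) (L : nat) (br : nat -> K).
Hypothesis sl2 : sl2_graded E F T L br.

Let c m k := \sum_(i < k.+1) br (m + i)%N.

Lemma iterF_T m k u : u \in T m -> iter k F u \in T (m + k)%N.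
Proof.
by move=> uT; elim: k => [|k IH]; rewrite ?addn0 //= addnS; exact: sl2F sl2 _ _ IH.
Qed.

Lemma sl2_EFk m k u : u \in T m -> E u = 0 ->
  E (iter k.+1 F u) = c m k *: iter k F u.
Proof.
move=> uT Eu; elim: k => [|k IH].
  by rewrite /= (sl2EF sl2 uT) Eu linear0 add0r /c big_ord1 addn0.
rewrite iterS (sl2EF sl2 (iterF_T k.+1 uT)) IH linearZ /= -scalerDl.
by rewrite /c [in RHS]big_ord_recr.
Qed.

Lemma sl2_EjFk m k j u : u \in T m -> E u = 0 ->
  iter j E (iter (k + j) F u) = (\prod_(i < j) c m (k + i)) *: iter k F u.
Proof.
move=> uT Eu; elim: j => [|j IH]; first by rewrite big_ord0 scale1r addn0.
rewrite iterSr addnS (sl2_EFk _ uT Eu).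
by rewrite iter_lfunZ IH scalerA big_ord_recr /= mulrC.
Qed.

(** Some power of [F] kills [u] for lack of degrees; applying [E] repeatedly descends from there to
    [u], as the scalars of [sl2_EFk] do not vanish in negative weight. *)
Lemma sl2_hw_neg m u : (L < 2 * m)%N -> u \in T m -> E u = 0 -> u = 0.
Proof.
move=> Lm uT Eu.
have [lmL|] := leqP m L; last first.
  by move/(sl2T0 sl2) => T0; move: uT; rewrite T0 memv0 => /eqP.
suff : forall k, (k <= L.+1 - m)%N -> iter (L.+1 - m - k) F u = 0.
  by move=> /(_ _ (leqnn _)); rewrite subnn.
elim=> [|k IH] lek.
  have := iterF_T (L.+1 - m) uT; rewrite subn0 (sl2T0 sl2); last by lia.
  by rewrite memv0 => /eqP.
have /eqP := sl2_EFk (L.+1 - m - k.+1) uT Eu.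
rewrite -subSn // subSS IH ?(ltnW lek) // linear0 eq_sym scaler_eq0.
by rewrite (negPf (sl2_brN sl2 _ _)) /=; try lia; move/eqP.
Qed.

Section Submodule.
Variable M : {vspace vT}.
Hypothesis ME : forall u, u \in M -> E u \in M.
Hypothesis MF : forall u, u \in M -> F u \in M.

Definition gr m := (M :&: T m)%VS.
Definition hw m := (gr m :&: lker E)%VS.

Lemma hwP m u : reflect [/\ u \in M, u \in T m & E u = 0] (u \in hw m).
Proof.
by rewrite !memv_cap memv_ker; apply: (iffP andP) => [[/andP[? ?] /eqP]|[-> -> ->]].
Qed.

Lemma iterF_M k u : u \in M -> iter k F u \in M.
Proof. by move=> uM; elim: k => //= k; exact: MF. Qed.

(** This replaces complete reducibility. From the decomposition of [E u] one builds a [v] with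
    [E v = E u] by applying [F] once more and dividing by the scalars [c]; then [u - v] is a highest
    weight vector. *)
Lemma gr_span m u : (2 * m <= L.+1)%N -> u \in gr m ->
  exists h : nat -> vT, (forall k, (k <= m)%N -> h k \in hw (m - k)) /\
    u = \sum_(k < m.+1) iter k F (h k).
Proof.
elim: m u => [|m IH] u mL; rewrite memv_cap => /andP[uM uT].
  exists (fun=> u); split=> [[|k]//_|]; last by rewrite big_ord1.
  by apply/hwP; rewrite (sl2E0 sl2).
have [||h [hw_h Eu]] := IH (E u); first by lia.
  by rewrite memv_cap ME //=; exact: sl2E sl2 _ _ uT.
pose h' k := (c (m - k)%N k)^-1 *: h k.
have h'hw k : (k <= m)%N -> h' k \in hw (m - k) by move=> km; exact/memvZ/hw_h.
have cN k : (k <= m)%N -> c (m - k)%N k != 0 by move=> km; apply: sl2_brN sl2 _ _ _ _; lia.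
pose v := \sum_(k < m.+1) iter k.+1 F (h' k).
have vM : v \in M.
  apply: memv_suml => k _; apply: iterF_M.
  by have /hwP[] := h'hw k (ltn_ord k).
have vT' : v \in T m.+1.
  apply: memv_suml => k _; have /hwP[_ hT _] := h'hw k (ltn_ord k).
  by have := iterF_T k.+1 hT; rewrite addnS subnK // -ltnS.
have Ev : E v = E u.
  rewrite Eu linear_sum; apply: eq_bigr => k _.
  have km : (k <= m)%N by rewrite -ltnS.
  have /hwP[_ hT hE] := h'hw k km; rewrite [LHS](sl2_EFk k hT hE) /h'.
  by rewrite iter_lfunZ scalerA divff ?scale1r // cN.
exists (fun k => if k is k'.+1 then h' k' else u - v); split=> [[_|k km]|].
- by apply/hwP; rewrite subn0 linearB /= Ev subrr !memvB.
- by rewrite subSS h'hw.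
- by rewrite big_ord_recl /= subrK.
Qed.

Lemma gr_surj m u : (2 * m < L)%N -> u \in gr m ->
  exists2 v, v \in gr m.+1 & E v = u.
Proof.
move=> mL ug; have [|h [hw_h ->]] := gr_span _ ug; first by lia.
exists (\sum_(k < m.+1) iter k.+1 F ((c (m - k)%N k)^-1 *: h k)).
  apply: memv_suml => k _; have km : (k <= m)%N by rewrite -ltnS.
  have /hwP[hM hT _] := hw_h k km.
  rewrite memv_cap iterF_M ?memvZ //=.
  have := iterF_T k.+1 (memvZ (c (m - k)%N k)^-1 hT).
  by rewrite addnS subnK.
rewrite linear_sum; apply: eq_bigr => k _; have km : (k <= m)%N by rewrite -ltnS.
have /hwP[_ hT hE] := hw_h k km.
rewrite [LHS](sl2_EFk k (memvZ _ hT)); last by rewrite linearZ /= hE scaler0.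
by rewrite iter_lfunZ scalerA divff ?scale1r //; apply: sl2_brN sl2 _ _ _ _; lia.
Qed.

Lemma dim_gr0 : \dim (gr 0) = \dim (hw 0).
Proof.
congr (\dim _); apply/esym/capv_idPl/subvP => u; rewrite memv_cap memv_ker.
by move=> /andP[_ /(sl2E0 sl2) ->].
Qed.

Lemma dim_grS m : (2 * m < L)%N ->
  \dim (gr m.+1) = (\dim (gr m) + \dim (hw m.+1))%N.
Proof.
move=> mL; rewrite -(limg_ker_dim E (gr m.+1)) addnC; congr (\dim _ + _)%N.
apply/eqP; rewrite eqEsubv; apply/andP; split; apply/subvP => u.
  move=> /memv_imgP[v]; rewrite memv_cap => /andP[vM vT'] ->.
  by rewrite memv_cap ME //=; exact: sl2E sl2 _ _ vT'.
by move/(gr_surj mL) => [v vg <-]; exact: memv_img.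
Qed.

(** The power [E^(L - 2m)] maps degree [L - m] onto degree [m]: by [gr_span] it suffices to reach
    each [F^k h], and [F^(k + L - 2m) h] is sent to a nonzero multiple of it. *)
Lemma dim_gr_le m : (2 * m <= L)%N -> (\dim (gr m) <= \dim (gr (L - m)))%N.
Proof.
move=> mL; pose w := (L - 2 * m)%N.
pose Ew := iter w (fun f => (E \o f)%VF) \1%VF.
have EwE u : Ew u = iter w E u.
  by rewrite /Ew; elim: (w) => [|i IH] /=; rewrite ?id_lfunE // comp_lfunE IH.
rewrite -[leqRHS](limg_ker_dim Ew); apply: leq_trans (leq_addl _ _).
apply: dimvS; apply/subvP => u ug.
have [|h [hw_h ->]] := gr_span _ ug; first by lia.
apply: memv_suml => k _; have km : (k <= m)%N by rewrite -ltnS.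
have /hwP[hM hT hE] := hw_h k km.
have cN : \prod_(i < w) c (m - k) (k + i) != 0.
  apply/prodf_neq0 => i _; have := ltn_ord i; rewrite {2}/w => ltiw.
  by apply: sl2_brN sl2 _ _ _ _; lia.
have -> : iter k F (h k) = Ew ((\prod_(i < w) c (m - k) (k + i))^-1 *: iter (k + w) F (h k)).
  by rewrite linearZ /= EwE (sl2_EjFk k w hT hE) scalerA mulVf ?scale1r.
apply/memv_img/memvZ; rewrite memv_cap iterF_M //=.
by have := iterF_T (k + w) hT; rewrite (_ : m - k + (k + w) = L - m)%N // /w; lia.
Qed.

End Submodule.
End Sl2.

Lemma sum_ord_between n a b :
  (\sum_(m < n | (a <= m) && (m <= b)) 1 = minn n b.+1 - a)%N.
Proof.
elim: n => [|n IH]; first by rewrite big_ord0; lia.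
by rewrite big_mkcond big_ord_recr -big_mkcond IH /=; case: ifP; lia.
Qed.

Section Sl2Dim.
Variables (K : fieldType) (vT : vectType K) (E F : 'End(vT)).
Variables (T : nat -> {vspace vT}) (L : nat) (br : nat -> K).
Hypothesis sl2 : sl2_graded E F T L br.
Variable M : {vspace vT}.
Hypothesis ME : forall u, u \in M -> E u \in M.
Hypothesis MF : forall u, u \in M -> F u \in M.

Let T' m := if (m <= L)%N then T (L - m)%N else 0%VS.

(* Exchanging E and F reverses the grading. *)
Lemma sl2_swap : sl2_graded F E T' L (fun m => - br (L - m)%N).
Proof.
split.
- move=> u; rewrite /T' subn0 leq0n => /(sl2F sl2).
  by rewrite (sl2T0 sl2) // memv0 => /eqP.
- move=> m u; rewrite /T'; case: ifP => [lm|_]; last by rewrite memv0 => /eqP ->; rewrite linear0 mem0v.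
  by rewrite (ltnW lm) => /(sl2F sl2); rewrite -subSn // subSS.
- move=> m u; rewrite /T'; case: ifP => [lm|_]; last by rewrite memv0 => /eqP ->; rewrite linear0 mem0v.
  move=> uT; case: ifP => [lm'|lm'].
    by apply: (sl2E sl2); rewrite -subSn // subSS.
  have mL : m = L by apply/eqP; rewrite eqn_leq lm leqNgt lm'.
  by rewrite (sl2E0 sl2) ?mem0v //; rewrite mL subnn in uT.
- by move=> m Lm; rewrite /T' leqNgt Lm.
- move=> m u; rewrite /T'; case: ifP => [lm uT|_]; last first.
    by rewrite memv0 => /eqP ->; rewrite !linear0 addr0.
  by rewrite (sl2EF sl2 uT) scaleNr addrK.
- by move=> m mL; rewrite (sl2_br sl2) ?leq_subr // opprK.
- move=> m k mk Lk; rewrite sumrN oppr_eq0.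
  rewrite (reindex_inj rev_ord_inj) /=.
  have : \sum_(i < k.+1) br (L - m - k + i)%N != 0 by apply: (sl2_brN sl2); lia.
  apply: contra_neq => e; rewrite -[RHS]e; apply: eq_bigr => i _; congr br.
  by have := ltn_ord i; lia.
Qed.

Lemma dim_gr_sym m : (m <= L)%N -> \dim (gr T M m) = \dim (gr T M (L - m)).
Proof.
wlog mL : m / (2 * m <= L)%N => [hw|lem].
  have [/hw//|Lm lem] := leqP (2 * m) L.
  by rewrite [in RHS]hw ?subKn //; lia.
apply/eqP; rewrite eqn_leq (dim_gr_le sl2 ME MF) //=.
have := dim_gr_le sl2_swap MF ME mL.
by rewrite /gr /T' lem leq_subr subKn.
Qed.

Lemma dim_gr_sum m : (2 * m <= L.+1)%N ->
  \dim (gr T M m) = (\sum_(i < m.+1) \dim (hw E T M i))%N.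
Proof.
elim: m => [|m IH] mL; first by rewrite big_ord1 (dim_gr0 sl2).
rewrite (dim_grS sl2 ME MF); last by lia.
by rewrite IH ?big_ord_recr //; lia.
Qed.

Hypothesis MT : (\sum_(m < L.+1) gr T M m)%VS = M.
Hypothesis T_direct : directv (\sum_(m < L.+1) T m).

(** A highest weight vector of degree [i] accounts for one dimension in each degree from [i] to
    [L - i]; the two summations are exchanged. *)
Lemma dim_graded : \dim M = (\sum_(i < (L./2).+1) \dim (hw E T M i) * (L - 2 * i).+1)%N.
Proof.
have dirM : directv (\sum_(m < L.+1) gr T M m).
  apply/directv_sum_independent => u uM u0 i _.
  move/directv_sum_independent: T_direct; apply=> // j _.
  by have := uM j isT; rewrite memv_cap => /andP[].
rewrite -[in LHS]MT (directvP dirM) /=.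
transitivity (\sum_(m < L.+1) \sum_(i < (L./2).+1 | (i <= m) && (i <= L - m)) \dim (hw E T M i))%N.
  apply: eq_bigr => m _; have mL : (m <= L)%N by rewrite -ltnS.
  have aux n : (2 * n <= L)%N ->
     \dim (gr T M n) = (\sum_(i < (L./2).+1 | (i <= n) && (i <= L - n)) \dim (hw E T M i))%N.
    move=> nL; rewrite dim_gr_sum; last by lia.
    rewrite (big_ord_widen_cond (L./2).+1 xpredT (fun i => \dim (hw E T M i))); last by lia.
    by apply: eq_bigl => i; lia.
  have [/aux//|Lm] := leqP (2 * m) L.
  rewrite dim_gr_sym // aux; last by lia.
  by apply: eq_bigl => i; lia.
rewrite (exchange_big_dep xpredT) //=; apply: eq_bigr => i _.
rewrite sum_nat_const mulnC; congr (_ * _)%N.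
rewrite -sum1_card (eq_bigl (fun m : 'I_L.+1 => (i <= m) && (m <= L - i))%N).
  by rewrite sum_ord_between; have := ltn_ord i; lia.
by move=> m; have := ltn_ord m; have := ltn_ord i; lia.
Qed.

End Sl2Dim.

(** * Weighted modules and tensor products *)

Section TensorBilinear.
Variables (K : comPzRingType) (m n p r : nat).
Implicit Types (A : 'M[K]_(m, n)) (B : 'M[K]_(p, r)).

Lemma tensDl A A' B : (A + A') *t B = A *t B + A' *t B.
Proof. by apply/matrixP => i j; rewrite !mxE mulrDl. Qed.

Lemma tensDr A B B' : A *t (B + B') = A *t B + A *t B'.
Proof. by apply/matrixP => i j; rewrite !mxE mulrDr. Qed.

Lemma tensZl a A B : (a *: A) *t B = a *: (A *t B).
Proof. by apply/matrixP => i j; rewrite !mxE mulrA. Qed.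

Lemma tensZr a A B : A *t (a *: B) = a *: (A *t B).
Proof. by apply/matrixP => i j; rewrite !mxE mulrCA. Qed.

Lemma tensNl A B : (- A) *t B = - (A *t B).
Proof. by apply/matrixP => i j; rewrite !mxE mulNr. Qed.

Lemma tensNr A B : A *t (- B) = - (A *t B).
Proof. by apply/matrixP => i j; rewrite !mxE mulrN. Qed.

End TensorBilinear.

Lemma mxtens_unindex_eq m n (i j : 'I_(m * n)) :
  (i == j) = ((mxtens_unindex i).1 == (mxtens_unindex j).1)
          && ((mxtens_unindex i).2 == (mxtens_unindex j).2).
Proof.
by rewrite -(can_eq (@mxtens_unindexK m n)) -pair_eqE.
Qed.

Lemma tens11 (K : comPzRingType) m n :
  (1%:M : 'M[K]_m) *t (1%:M : 'M[K]_n) = 1%:M.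
Proof.
apply/matrixP => i j; rewrite !mxE mxtens_unindex_eq.
by do 2!case: eqP => _ /=; rewrite ?mulr1n ?mulr0n ?mulr1 ?mul0r ?mulr0.
Qed.

Section TensorModule.
Variables (K : fieldType) (q : K).
Hypothesis q0 : q != 0.

Section Two.
Variables U V : uqmod q.

Lemma DeltaK_add la mu : DeltaK U V la *m DeltaK U V mu = DeltaK U V (la + mu).
Proof. by rewrite /DeltaK tensmx_mul !actK_add. Qed.

Lemma DeltaK_0 : DeltaK U V 0 = 1%:M.
Proof. by rewrite /DeltaK !actK_0 tens11. Qed.

Lemma DeltaK_E la :
  DeltaK U V la *m DeltaE U V = q ^ wprod alpha la *: (DeltaE U V *m DeltaK U V la).
Proof.
rewrite /DeltaK /DeltaE mulmxDr mulmxDl !tensmx_mul scalerDr !actK_E.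
by rewrite tensZl tensZr !actK_add [la + _]addrC mulmx1 mul1mx.
Qed.

Lemma DeltaK_F la :
  DeltaK U V la *m DeltaF U V
  = q ^ (- wprod alpha la) *: (DeltaF U V *m DeltaK U V la).
Proof.
rewrite /DeltaK /DeltaF mulmxDr mulmxDl !tensmx_mul scalerDr !actK_F.
by rewrite tensZl tensZr !actK_add [la + _]addrC mulmx1 mul1mx.
Qed.

Lemma DeltaEF :
  DeltaE U V *m DeltaF U V - DeltaF U V *m DeltaE U V
  = (q - q^-1)^-1 *: (DeltaK U V alpha - DeltaK U V (- alpha)).
Proof.
rewrite /DeltaE /DeltaF !(mulmxDl, mulmxDr) !tensmx_mul !(mulmx1, mul1mx).
(* The mixed terms of the commutator cancel: moving [K] past [F] in one factor and past [E] in the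
   other costs the same power of [q]. *)
have cross : (actK U alpha *m actF U) *t (actE V *m actK V (- alpha))
    = (actF U *m actK U alpha) *t (actK V (- alpha) *m actE V).
  by rewrite actK_F actK_E tensZl tensZr.
rewrite {}cross.
set A := (actE U *m actF U) *t _; set B := actE U *t actF V.
set C := (actF U *m _) *t _; set D := _ *t (actE V *m actF V).
set A' := (actF U *m actE U) *t _; set D' := _ *t (actF V *m actE V).
have -> : (A + B) + (C + D) - ((A' + C) + (B + D')) = (A - A') + (D - D').
  by apply/matrixP => i j; rewrite !mxE; ring.
rewrite /A /A' /D /D' -tensNl -tensDl -tensNr -tensDr !actEF.
rewrite tensZl tensZr -scalerDr tensDl tensDr tensNl tensNr.
by congr (_ *: _); apply/matrixP => i j; rewrite !mxE; ring.
Qed.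

Definition tensU : uqmod q :=
  UqMod DeltaK_add DeltaK_0 DeltaK_E DeltaK_F DeltaEF.

End Two.

(** The standard basis consists of weight vectors, all of total degree [L], so that one number
    [wt i] records the weight. Tensor products inherit this form. *)
Record weighted (M : uqmod q) (wt : 'I_(udim M) -> nat) (L : nat) : Prop :=
  Weighted {
    wt_le : forall i, (wt i <= L)%N;
    wtK : forall la, actK M la
      = diag_mx (\row_i q ^ wprod la (L%:Z - (wt i)%:Z, (wt i)%:Z))
  }.

Lemma tensU_weighted U V wtU wtV LU LV :
  @weighted U wtU LU -> @weighted V wtV LV ->
  @weighted (tensU U V)
    (fun i => wtU (mxtens_unindex i).1 + wtV (mxtens_unindex i).2)%N (LU + LV).
Proof.
move=> [leU KU] [leV KV]; split=> [i|la]; first exact: leq_add.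
rewrite /= /DeltaK KU KV; apply/matrixP => i j; rewrite !mxE mxtens_unindex_eq.
do 2!case: eqP => _ /=; rewrite ?mulr1n ?mulr0n ?mul0r ?mulr0 //.
rewrite -expfzDr //; congr (q ^ _); rewrite /wprod /= !PoszD; ring.
Qed.

End TensorModule.

Section WeightedModule.
Variables (K F : fieldType) (q : K) (res : K -> F -> Prop).
Hypothesis rP : residue q res.
Variables (M : uqmod q) (wt : 'I_(udim M) -> nat) (L : nat).
Hypothesis wM : weighted wt L.
Local Notation vT := 'cV[K]_(udim M).

Let q0 : q != 0 := q_unit rP.

Definition wproj (m : nat) : 'M[K]_(udim M) := diag_mx (\row_i (wt i == m)%:R).

Definition wsp (m : nat) : {vspace vT} := fixedSpace (linfun (mulmx (wproj m) : vT -> vT)).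

Lemma wprojE (m : nat) (x : vT) i j : (wproj m *m x) i j = (wt i == m)%:R * x i j.
Proof. by rewrite mul_diag_mx !mxE. Qed.

Lemma wspP (m : nat) (x : vT) :
  reflect (forall i, wt i != m -> x i 0 = 0) (x \in wsp m).
Proof.
apply: (iffP fixedSpaceP); rewrite lfunE /=.
  by move=> xE i im; rewrite -xE wprojE (negPf im) mul0r.
move=> x0; apply/colP => i; rewrite wprojE.
by case: eqVneq => [_|/x0->]; rewrite ?mul1r ?mulr0.
Qed.

Lemma wproj_wsp (m : nat) (x : vT) : wproj m *m x \in wsp m.
Proof. by apply/wspP => i im; rewrite wprojE (negPf im) mul0r. Qed.

Lemma wproj_id (m m' : nat) (x : vT) : x \in wsp m -> wproj m' *m x = (m == m')%:R *: x.
Proof.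
move/wspP => x0; apply/colP => i; rewrite wprojE !mxE.
have [->|/x0->] := eqVneq (wt i) m; by rewrite ?mulr0.
Qed.

Lemma wproj_sum (x : vT) : x = \sum_(m < L.+1) wproj m *m x.
Proof.
apply/colP => i; rewrite summxE (bigD1 (inord (wt i))) //= wprojE.
rewrite inordK ?ltnS ?(wt_le wM) // eqxx mul1r big1 ?addr0 // => m mi.
rewrite wprojE; case: (wt i =P m) => [e|_]; last by rewrite mul0r.
by rewrite e inord_val eqxx in mi.
Qed.

Lemma wsp_direct : directv (\sum_(m < L.+1) wsp m).
Proof.
apply/directv_sum_independent => u uM u0 i _.
have := congr1 (mulmx (wproj i)) u0; rewrite mulmx0 mulmx_sumr.
rewrite (bigD1 i) //= (wproj_id _ (uM i isT)) eqxx scale1r big1 ?addr0 // => j ji.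
by rewrite (wproj_id _ (uM j isT)) -val_eqE /= in ji *; rewrite (negPf ji) scale0r.
Qed.

Lemma wsp_gt m : (L < m)%N -> wsp m = 0%VS.
Proof.
move=> Lm; apply/eqP; rewrite -subv0; apply/subvP => x /wspP x0.
rewrite memv0; apply/eqP/colP => i; rewrite mxE x0 //.
by rewrite ltn_eqF // (leq_ltn_trans (wt_le wM i)).
Qed.

Lemma actK_wsp la m (x : vT) : x \in wsp m ->
  actK M la *m x = q ^ wprod la (L%:Z - m%:Z, m%:Z) *: x.
Proof.
move/wspP => x0; apply/colP => i; rewrite (wtK wM) mul_diag_mx !mxE.
by have [->//|/x0->] := eqVneq (wt i) m; rewrite !mulr0.
Qed.

(* The operators commuting with the K_la are those preserving the weight. *)
Lemma wt_entry_shift (A : 'M[K]_(udim M)) (e : int) :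
  actK M (0, 1) *m A = q ^ e *: (A *m actK M (0, 1)) ->
  forall i j, (wt i)%:Z != (wt j)%:Z + e -> A i j = 0.
Proof.
move=> KA i j; apply: contraNeq => Aij.
have /matrixP/(_ i j) := KA.
rewrite (wtK wM) mul_diag_mx mul_mx_diag !mxE /wprod /= !mul0r !add0r !mul1r.
rewrite mulrA [LHS]mulrC [q ^ e * _]mulrC -mulrA => /(mulfI Aij).
by rewrite -expfzDr // => /(qz_inj rP) ->; rewrite addrC.
Qed.

Lemma actE_entry i j : wt j != (wt i).+1 -> actE M i j = 0.
Proof. by move=> ij; apply: (wt_entry_shift (actK_E _ _)); rewrite /wprod /=; lia. Qed.

Lemma actF_entry i j : wt i != (wt j).+1 -> actF M i j = 0.
Proof. by move=> ij; apply: (wt_entry_shift (actK_F _ _)); rewrite /wprod /=; lia. Qed.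

(** The symmetric quantum integer [[L - 2m]]. *)
Definition br (m : nat) : K :=
  (q - q^-1)^-1 * (q ^ (L%:Z - m%:Z - m%:Z) - q ^ (m%:Z + m%:Z - L%:Z)).

Lemma qsubV_neq0 : q - q^-1 != 0.
Proof.
rewrite subr_eq0; apply: contra_neq (qX_neq1 rP (ltn0Sn 1)) => qV.
by rewrite expr2 {2}qV divff.
Qed.

(** The right side is the product of quantum integers [[k] [L - 2m - k + 1]], from which
    nonvanishing can be read off. *)
Lemma sum_br m k : \sum_(i < k) br (m + i)%N
  = (q - q^-1)^-1 ^+ 2 * (q ^ k%:Z - q ^ (- k%:Z))
    * (q ^ (L%:Z - m%:Z - m%:Z - k%:Z + 1) - q ^ (m%:Z + m%:Z + k%:Z - L%:Z - 1)).
Proof.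
have qN0 (e : int) : q ^ e != 0 by rewrite expfz_neq0.
have qV := qsubV_neq0.
have q21 : q * q - 1 != 0 by rewrite -expr2 subr_eq0 (qX_neq1 rP).
elim: k => [|k IH]; first by rewrite big_ord0 oppr0 subrr mulr0 mul0r.
rewrite big_ord_recr /= IH /br PoszD (_ : k.+1%:Z = k%:Z + 1); last by rewrite -addn1 PoszD.
rewrite !(opprD, opprK, expfzDr, addrA) // !(expr1z, expfzDr, exprN1, invr_expz) //.
rewrite -!invr_expz.
move: (qN0 L) (qN0 m) (qN0 k); set a := q ^ L%:Z; set b := q ^ m%:Z; set d := q ^ k%:Z => a0 b0 d0.
by field; rewrite q0 a0 d0 b0 q21.
Qed.

Definition opE : 'End(vT) := linfun (mulmx (actE M) : vT -> vT).
Definition opF : 'End(vT) := linfun (mulmx (actF M) : vT -> vT).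

Lemma actE_wsp (m : nat) (x : vT) : x \in wsp m.+1 -> actE M *m x \in wsp m.
Proof.
move/wspP => x0; apply/wspP => i im; rewrite mxE big1 // => j _.
have [jm|/x0->] := eqVneq (wt j) m.+1; last by rewrite mulr0.
by rewrite actE_entry ?mul0r // jm eqSS eq_sym.
Qed.

Lemma actE_wsp0 (x : vT) : x \in wsp 0 -> actE M *m x = 0.
Proof.
move/wspP => x0; apply/colP => i; rewrite !mxE big1 // => j _.
have [j0|/x0->] := eqVneq (wt j) 0%N; last by rewrite mulr0.
by rewrite actE_entry ?mul0r // j0.
Qed.

Lemma actF_wsp (m : nat) (x : vT) : x \in wsp m -> actF M *m x \in wsp m.+1.
Proof.
move/wspP => x0; apply/wspP => i im; rewrite mxE big1 // => j _.
have [jm|/x0->] := eqVneq (wt j) m; last by rewrite mulr0.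
by rewrite actF_entry ?mul0r // jm.
Qed.

Lemma actEF_wsp (m : nat) (x : vT) : x \in wsp m ->
  actE M *m (actF M *m x) = actF M *m (actE M *m x) + br m *: x.
Proof.
move=> xm; apply/eqP; rewrite addrC -subr_eq !mulmxA -mulmxBl actEF -scalemxAl.
rewrite mulmxBl !(actK_wsp _ xm) -scalerBl scalerA /br /wprod /alpha /=.
by apply/eqP; congr (_ * (q ^ _ - q ^ _) *: _); lia.
Qed.

Lemma weighted_sl2 : sl2_graded opE opF wsp L br.
Proof.
split=> [u u0|m u um|m u um|m Lm|m u um|m mL|m k mk Lk].
- by rewrite lfunE /= actE_wsp0.
- by rewrite lfunE /= actE_wsp.
- by rewrite lfunE /= actF_wsp.
- exact: wsp_gt.
- by rewrite !lfunE /= (actEF_wsp um).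
- by rewrite /br -mulrN opprB; congr (_ * (q ^ _ - q ^ _)); lia.
rewrite sum_br !mulf_neq0 ?expf_neq0 ?invr_neq0 ?qsubV_neq0 //.
  by rewrite subr_eq0; apply/eqP => /(qz_inj rP); lia.
by rewrite subr_eq0; apply/eqP => /(qz_inj rP); lia.
Qed.

Section Graded.
Variable N : {vspace vT}.
Hypothesis NE : forall x, x \in N -> actE M *m x \in N.
Hypothesis NF : forall x, x \in N -> actF M *m x \in N.
Hypothesis Ngr : forall m x, x \in N -> wproj m *m x \in N.

Lemma opE_stable x : x \in N -> opE x \in N. Proof. by rewrite lfunE; exact: NE. Qed.
Lemma opF_stable x : x \in N -> opF x \in N. Proof. by rewrite lfunE; exact: NF. Qed.

Lemma graded_sum : (\sum_(m < L.+1) gr wsp N m)%VS = N.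
Proof.
apply/eqP; rewrite eqEsubv; apply/andP; split; apply/subvP => x.
  by move/memv_sumP => [u uN ->]; apply: memv_suml => m _; have := uN m isT; rewrite memv_cap => /andP[].
move=> xN; rewrite (wproj_sum x); apply/memv_sumP; exists (fun m : 'I_L.+1 => wproj m *m x) => // m _.
by rewrite memv_cap Ngr // wproj_wsp.
Qed.

Lemma weighted_dim :
  \dim N = (\sum_(i < (L./2).+1) \dim (hw opE wsp N i) * (L - 2 * i).+1)%N.
Proof. exact: (dim_graded weighted_sl2 opE_stable opF_stable graded_sum wsp_direct). Qed.

(* A nonzero graded E-stable subspace contains a highest weight vector. *)
Lemma weighted_hw_eq0 :
  (forall m, (2 * m <= L)%N -> hw opE wsp N m = 0%VS) -> N = 0%VS.
Proof.
move=> hw0; apply/eqP; rewrite -dimv_eq0 weighted_dim big1 // => i _.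
by rewrite hw0 ?dimv0 ?mul0n //; have := ltn_ord i; lia.
Qed.

(** The dimensions of the graded pieces of [N] and of the whole module are both symmetric under
    [m -> L - m], so fullness in the upper half of the weights forces it in the lower half. *)
Lemma weighted_top_half :
  (forall m, (2 * m <= L)%N -> (wsp m <= N)%VS) -> N = fullv.
Proof.
move=> half.
have full m : (m <= L)%N -> gr wsp N m = wsp m.
  have [/half hm _|Lm mL] := leqP (2 * m) L.
    by apply/eqP; rewrite /gr eqEsubv capvSr subv_cap hm subvv.
  have mL2 : (2 * (L - m) <= L)%N by lia.
  have grl : gr wsp N (L - m) = wsp (L - m).
    by apply/eqP; rewrite /gr eqEsubv capvSr subv_cap half // subvv.
  apply/eqP; rewrite /gr eqEdim capvSr /= -/(gr wsp N m).
  rewrite (dim_gr_sym weighted_sl2 opE_stable opF_stable mL) grl.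
  have fE x : x \in (fullv : {vspace vT}) -> opE x \in (fullv : {vspace vT}) by rewrite !memvf.
  have fF x : x \in (fullv : {vspace vT}) -> opF x \in (fullv : {vspace vT}) by rewrite !memvf.
  have := dim_gr_sym weighted_sl2 fE fF mL.
  by rewrite /gr !capfv => ->.
apply/eqP; rewrite eqEsubv subvf; apply/subvP => x _; rewrite (wproj_sum x).
apply: memv_suml => m _; have := wproj_wsp m x.
by rewrite -full -1?ltnS // memv_cap => /andP[].
Qed.

End Graded.
End WeightedModule.

(** * The simple module in coordinates *)

Section Extension.
Variables (K : fieldType) (d : nat).
Implicit Type f : 'I_d -> K.

(** Extension by 0 to all naturals: formulas with shifted indices then hold at the border without
    case distinctions. *)
Definition ext f (a : nat) : K := if insub a is Some i then f i else 0.

Lemma ext_ord f (i : 'I_d) : ext f i = f i.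
Proof. by rewrite /ext valK. Qed.

Lemma extE f a (ad : (a < d)%N) : ext f a = f (Ordinal ad).
Proof. by rewrite /ext insubT. Qed.

Lemma ext_out f a : (d <= a)%N -> ext f a = 0.
Proof. by move=> da; rewrite /ext insubN // -leqNgt. Qed.

Lemma eq_ext f g : f =1 g -> ext f =1 ext g.
Proof. by move=> fg a; rewrite /ext; case: insub. Qed.

Lemma extD f g a : ext (fun i => f i + g i) a = ext f a + ext g a.
Proof. by rewrite /ext; case: insub => //; rewrite addr0. Qed.

Lemma extZ c f a : ext (fun i => c * f i) a = c * ext f a.
Proof. by rewrite /ext; case: insub => //; rewrite mulr0. Qed.

Lemma ext0 a : ext (fun _ : 'I_d => 0) a = 0.
Proof. by rewrite /ext; case: insub. Qed.

End Extension.

Section StandardModule.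
Variables (K F : fieldType) (q : K) (res : K -> F -> Prop).
Hypothesis rP : residue q res.
Variable l : nat.
Local Notation d := l.+1.

Let q0 : q != 0 := q_unit rP.

(** The one-sided q-integer, preferred to the symmetric one because it is integral at q = 0, with
    residue 1 for [n > 0]. *)
Definition gint (n : nat) : K := \sum_(i < n) q ^+ (2 * i).

Lemma gint0 : gint 0 = 0. Proof. by rewrite /gint big_ord0. Qed.

Lemma res_gint n : (0 < n)%N -> res (gint n) 1.
Proof.
case: n => // n _; rewrite /gint big_ord_recl -[X in res _ X]addr0.
apply: (resD rP); first by rewrite expr0; exact: res1 rP.
have : res (\sum_(i < n) q ^+ (2 * lift ord0 i)) (\sum_(i < n) 0).
  by apply: (res_sum rP) => i _; exact: (resqX rP _).
by rewrite big1_eq.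
Qed.

Lemma gint_neq0 n : (0 < n)%N -> gint n != 0.
Proof. by move=> n0; apply: (res_eq0 rP (res_gint n0)); exact: oner_neq0. Qed.

Lemma q2_neq1 : q ^+ 2 - 1 != 0.
Proof. by rewrite subr_eq0 (qX_neq1 rP). Qed.

Lemma gintE n : gint n = ((q ^+ n) ^+ 2 - 1) / (q ^+ 2 - 1).
Proof.
elim: n => [|n IH]; first by rewrite gint0 expr1n subrr mul0r.
rewrite /gint big_ord_recr /= -/(gint n) IH mulnC exprM [q ^+ n.+1]exprS; field.
exact: q2_neq1.
Qed.

(* The coefficient of [w_a] in [F w_(a-1)]; it is [a][l+1-a] in terms of
   symmetric q-integers. *)
Definition phi (a : nat) : K := q ^ (1 - l%:Z) * gint a * gint (d - a).

Lemma phi0 : phi 0 = 0. Proof. by rewrite /phi gint0 mulr0 mul0r. Qed.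

Lemma phi_neq0 a : (0 < a <= l)%N -> phi a != 0.
Proof.
move=> /andP[a0 al]; rewrite !mulf_neq0 ?expfz_neq0 ?gint_neq0 //; lia.
Qed.

Lemma phi_diff a : (a <= l)%N -> phi a.+1 - phi a
  = (q - q^-1)^-1 * (q ^ (l%:Z - a%:Z - a%:Z) - q ^ (a%:Z + a%:Z - l%:Z)).
Proof.
move=> al; rewrite /phi !gintE.
have -> : (d - a = (d - a.+1).+1)%N by lia.
have -> : l%:Z = a%:Z + (d - a.+1)%:Z by lia.
move: (d - a.+1)%N => b; rewrite !exprS.
rewrite !(opprD, opprK, expfzDr, addrA) // !exprnP -!invr_expz -!exprnP.
move: (expf_neq0 a q0) (expf_neq0 b q0) q2_neq1.
set A := q ^+ a; set B := q ^+ b => A0 B0 q21.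
have q21' : q * q - 1 != 0 by rewrite -expr2.
by rewrite expr1; field; rewrite q0 A0 B0 q21'.
Qed.

(** The basis is scaled so that [E] is a plain shift and all q-integers sit in [F]. *)
Definition Emx : 'M[K]_d := \matrix_(i, j) (val j == (val i).+1)%:R.
Definition Fmx : 'M[K]_d := \matrix_(i, j) ((val i == (val j).+1)%:R * phi i).
Definition Kmx (la : weight) : 'M[K]_d :=
  diag_mx (\row_i q ^ wprod la (l%:Z - i%:Z, i%:Z)).

Lemma Emx_row (f : 'I_d -> K) (i : 'I_d) : \sum_j Emx i j * f j = ext f i.+1.
Proof.
rewrite /ext; case: insubP => [k _ ki|ik].
  rewrite (bigD1 k) //= mxE ki eqxx mul1r big1 ?addr0 // => j jk.
  by rewrite mxE -ki (inj_eq val_inj) (negPf jk) mul0r.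
rewrite big1 // => j _; rewrite mxE ltn_eqF ?mul0r //.
by rewrite -leqNgt in ik; exact: leq_trans (ltn_ord j) ik.
Qed.

Lemma Emx_col (f : 'I_d -> K) (i : 'I_d) :
  \sum_j Emx j i * f j = if val i is a.+1 then ext f a else 0.
Proof.
case: i => [[|a] ad] /=; first by rewrite big1 // => j _; rewrite mxE mul0r.
rewrite /ext insubT ?(ltnW ad) // => ad'; rewrite (bigD1 (Sub a ad')) //= mxE eqxx mul1r.
rewrite big1 ?addr0 // => j ja; rewrite mxE /= eqSS eq_sym.
by rewrite -val_eqE /= in ja; rewrite (negPf ja) mul0r.
Qed.

Lemma Fmx_row (f : 'I_d -> K) (i : 'I_d) :
  \sum_j Fmx i j * f j = phi i * ext f (val i).-1.
Proof.
transitivity (phi i * \sum_j Emx j i * f j).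
  rewrite mulr_sumr; apply: eq_bigr => j _; rewrite !mxE; ring.
by rewrite Emx_col; case: i => [[|a] ad] //=; rewrite phi0 !mul0r.
Qed.

Lemma Fmx_col (f : 'I_d -> K) (i : 'I_d) :
  \sum_j Fmx j i * f j = phi i.+1 * ext f i.+1.
Proof.
transitivity (\sum_j Emx i j * (phi i.+1 * f j)); last by rewrite Emx_row extZ.
apply: eq_bigr => j _; rewrite !mxE.
by have [->|_] := eqVneq (val j) (val i).+1; rewrite ?mul1r ?mul0r.
Qed.

Lemma Kmx_add la mu : Kmx la *m Kmx mu = Kmx (la + mu).
Proof.
apply/matrixP => i j; rewrite mul_diag_mx !mxE.
case: eqP => _; rewrite ?mulr1n ?mulr0n ?mulr0 // -expfzDr //.
by congr (q ^ _); rewrite /wprod /=; ring.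
Qed.

Lemma Kmx_0 : Kmx 0 = 1%:M.
Proof.
apply/matrixP => i j; rewrite !mxE /wprod /= !mul0r addr0 expr0z.
by case: eqP.
Qed.

Lemma Kmx_E la : Kmx la *m Emx = q ^ wprod alpha la *: (Emx *m Kmx la).
Proof.
apply/matrixP => i j; rewrite mul_diag_mx mul_mx_diag !mxE.
case: eqP => [ji|_]; rewrite ?mulr0 ?mul0r ?mulr0 // mulr1 mul1r -expfzDr //.
by congr (q ^ _); rewrite /wprod /alpha /= ji intS; ring.
Qed.

Lemma Kmx_F la : Kmx la *m Fmx = q ^ (- wprod alpha la) *: (Fmx *m Kmx la).
Proof.
apply/matrixP => i j; rewrite mul_diag_mx mul_mx_diag !mxE.
case: eqP => [ij|_]; rewrite ?mul0r ?mulr0 ?mul0r ?mulr0 // !mul1r.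
rewrite [RHS]mulrCA [LHS]mulrC -expfzDr //; congr (_ * q ^ _).
by rewrite /wprod /alpha /= ij intS; ring.
Qed.

Lemma Emx_Fmx : Emx *m Fmx - Fmx *m Emx
  = (q - q^-1)^-1 *: (Kmx alpha - Kmx (- alpha)).
Proof.
apply/matrixP => i j; rewrite !mxE Emx_row.
have -> : \sum_k Fmx i k * Emx k j = phi i * (i == j)%:R.
  rewrite Fmx_row; case: i => [[|a] ad] /=; first by rewrite phi0 !mul0r.
  by congr (_ * _); rewrite (extE _ (ltnW ad)) mxE /= -val_eqE /= eq_sym.
have -> : ext (fun k => Fmx k j) i.+1 = phi i.+1 * (i == j)%:R.
  have [id_|] := ltnP i.+1 d.
    by rewrite (extE _ id_) mxE /= eqSS mulrC -val_eqE.
  rewrite ltnS => di; have -> : i = l :> nat by apply/eqP; rewrite eqn_leq di -ltnS ltn_ord.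
  by rewrite ext_out // /phi subnn gint0 mulr0 mul0r.
rewrite -mulrBl phi_diff -1?ltnS ?ltn_ord //.
case: eqP => [->|_]; last by rewrite !mulr0n subrr mulr0 mulr0.
by rewrite !mulr1n mulr1 /wprod /=; congr (_ * (q ^ _ - q ^ _)); lia.
Qed.

Definition V0 : uqmod q := UqMod Kmx_add Kmx_0 Kmx_E Kmx_F Emx_Fmx.

Lemma V0_weighted : @weighted _ _ V0 (fun i => nat_of_ord i) l.
Proof. by split=> // i; rewrite -ltnS ltn_ord. Qed.

End StandardModule.

(** * Tensor squares *)

Lemma tens_mulmxE (K : fieldType) m n (A : 'M[K]_m) (B : 'M[K]_n)
    (x : 'cV_(m * n)) i j :
  ((A *t B) *m x) (mxtens_index (i, j)) 0
  = \sum_i' A i i' * (\sum_j' B j j' * x (mxtens_index (i', j')) 0).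
Proof.
rewrite mxE; under [RHS]eq_bigr => i' _ do rewrite mulr_sumr.
rewrite pair_big /= (reindex (@mxtens_index m n)) /=.
  by apply: eq_bigr => -[i' j'] _; rewrite tensmxE mulrA.
by exists (@mxtens_unindex m n) => k _; rewrite (mxtens_indexK, mxtens_unindexK).
Qed.

Lemma sum_diag_mx (K : fieldType) n (D : 'rV[K]_n) (f : 'I_n -> K) i :
  \sum_j diag_mx D i j * f j = D 0 i * f i.
Proof.
rewrite (bigD1 i) //= mxE eqxx mulr1n big1 ?addr0 // => j ji.
by rewrite mxE eq_sym (negPf ji) mulr0n mul0r.
Qed.

Lemma sum_1_mx (K : fieldType) n (f : 'I_n -> K) i : \sum_j 1%:M i j * f j = f i.
Proof.
rewrite (bigD1 i) //= mxE eqxx mul1r big1 ?addr0 // => j ji.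
by rewrite mxE eq_sym (negPf ji) mul0r.
Qed.

Section Square.
Variables (K : fieldType) (d : nat).
Local Notation vT := 'cV[K]_(d * d).

Definition get2 (x : vT) (a b : nat) : K :=
  ext (fun i => ext (fun j => x (mxtens_index (i, j)) 0) b) a.

Definition mk2 (f : nat -> nat -> K) : vT :=
  \col_k f (mxtens_unindex k).1 (mxtens_unindex k).2.

Lemma get2_ord x (i j : 'I_d) : get2 x i j = x (mxtens_index (i, j)) 0.
Proof. by rewrite /get2 !ext_ord. Qed.

Lemma get2_outl x a b : (d <= a)%N -> get2 x a b = 0.
Proof. exact: ext_out. Qed.

Lemma get2_outr x a b : (d <= b)%N -> get2 x a b = 0.
Proof.
by move=> db; rewrite /get2 (eq_ext (g := fun=> 0)) ?ext0 // => i; rewrite ext_out.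
Qed.

Lemma get2_mk2 f a b : (a < d)%N -> (b < d)%N -> get2 (mk2 f) a b = f a b.
Proof.
move=> ad bd; have := get2_ord (mk2 f) (Ordinal ad) (Ordinal bd).
by rewrite /= => ->; rewrite mxE mxtens_indexK.
Qed.

Lemma get2_inj x y :
  (forall a b, (a < d)%N -> (b < d)%N -> get2 x a b = get2 y a b) -> x = y.
Proof.
move=> xy; apply/colP => k; case: (mxtens_indexP k) => i j.
by rewrite -!get2_ord xy.
Qed.

Lemma get2D x y a b : get2 (x + y) a b = get2 x a b + get2 y a b.
Proof.
rewrite /get2 -extD; apply: eq_ext => i; rewrite -extD.
by apply: eq_ext => j; rewrite mxE.
Qed.

Lemma get2Z c x a b : get2 (c *: x) a b = c * get2 x a b.
Proof.
rewrite /get2 -extZ; apply: eq_ext => i; rewrite -extZ.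
by apply: eq_ext => j; rewrite mxE.
Qed.

Lemma get20 a b : get2 0 a b = 0.
Proof. by rewrite -(scale0r (0 : vT)) get2Z mul0r. Qed.

End Square.

Section StandardSquare.
Variables (K F : fieldType) (q : K) (res : K -> F -> Prop).
Hypothesis rP : residue q res.
Variable l : nat.
Local Notation d := l.+1.
Local Notation V := (V0 rP l).
Local Notation vT := 'cV[K]_(d * d).

Let q0 : q != 0 := q_unit rP.

Definition V2 : uqmod q := tensU V V.

Definition wt2 (k : 'I_(d * d)) : nat :=
  ((mxtens_unindex k).1 + (mxtens_unindex k).2)%N.

Lemma V2_weighted : @weighted _ _ V2 wt2 (l + l).
Proof. exact: (tensU_weighted q0 (V0_weighted rP l) (V0_weighted rP l)). Qed.

Local Notation wsp2 := (@wsp K q V2 wt2).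

Lemma wsp2P m (x : vT) :
  reflect (forall a b, (a < d)%N -> (b < d)%N -> (a + b)%N != m -> get2 x a b = 0)
    (x \in wsp2 m).
Proof.
apply: (iffP (wspP _ _ _)) => [x0 a b ad bd abm|x0 k].
  have := get2_ord x (Ordinal ad) (Ordinal bd); rewrite /= => ->.
  by apply: x0; rewrite /wt2 mxtens_indexK.
case: (mxtens_indexP k) => i j; rewrite /wt2 mxtens_indexK /= => ijm.
by rewrite -get2_ord x0.
Qed.

Lemma get2_E (x : vT) a b : (a < d)%N -> (b < d)%N ->
  get2 (actE V2 *m x) a b
  = get2 x a.+1 b + q ^ (l%:Z - a%:Z - a%:Z) * get2 x a b.+1.
Proof.
move=> ad bd; pose i := Ordinal ad; pose j := Ordinal bd.
rewrite -[a]/(nat_of_ord i) -[b]/(nat_of_ord j) get2_ord /= /DeltaE mulmxDl mxE !tens_mulmxE /=.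
rewrite Emx_row; congr (_ + _).
  by rewrite /get2; apply: eq_ext => i'; rewrite sum_1_mx (extE _ bd).
rewrite sum_diag_mx mxE Emx_row /get2 (extE _ ad); congr (q ^ _ * _).
by rewrite /wprod /=; lia.
Qed.

Lemma get2_F (x : vT) a b : (a < d)%N -> (b < d)%N ->
  get2 (actF V2 *m x) a b
  = phi q l a * q ^ (b%:Z + b%:Z - l%:Z) * get2 x a.-1 b
    + phi q l b * get2 x a b.-1.
Proof.
move=> ad bd; pose i := Ordinal ad; pose j := Ordinal bd.
rewrite -[a]/(nat_of_ord i) -[b]/(nat_of_ord j) get2_ord /= /DeltaF mulmxDl mxE !tens_mulmxE /=.
rewrite Fmx_row sum_1_mx Fmx_row; congr (_ + _).
  rewrite -mulrA; congr (_ * _); rewrite /get2 -extZ; apply: eq_ext => i'.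
  rewrite sum_diag_mx mxE (extE _ bd); congr (q ^ _ * _).
  by rewrite /wprod /=; lia.
by rewrite /get2 (extE _ ad).
Qed.

Lemma get2_ET (x : vT) a b : (a < d)%N -> (b < d)%N ->
  get2 ((actE V2)^T *m x) a b
  = (if a is a'.+1 then get2 x a' b else 0)
    + q ^ (l%:Z - a%:Z - a%:Z) * (if b is b'.+1 then get2 x a b' else 0).
Proof.
move=> ad bd; pose i := Ordinal ad; pose j := Ordinal bd.
rewrite -[a]/(nat_of_ord i) -[b]/(nat_of_ord j) get2_ord /= /DeltaE linearD /= !trmx_tens.
rewrite tr_diag_mx trmx1 mulmxDl mxE !tens_mulmxE /=; congr (_ + _).
  under eq_bigr => i' _ do rewrite sum_1_mx mxE.
  rewrite Emx_col /=; case: (a) => // a'.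
  by rewrite /get2; apply: eq_ext => i'; rewrite (extE _ bd).
rewrite sum_diag_mx mxE; congr (q ^ _ * _); first by rewrite /wprod /=; lia.
under eq_bigr => i' _ do rewrite mxE.
rewrite Emx_col /=; case: (b) => // b'.
by rewrite /get2 (extE _ ad).
Qed.

Lemma get2_FT (x : vT) a b : (a < d)%N -> (b < d)%N ->
  get2 ((actF V2)^T *m x) a b
  = phi q l a.+1 * q ^ (b%:Z + b%:Z - l%:Z) * get2 x a.+1 b
    + phi q l b.+1 * get2 x a b.+1.
Proof.
move=> ad bd; pose i := Ordinal ad; pose j := Ordinal bd.
rewrite -[a]/(nat_of_ord i) -[b]/(nat_of_ord j) get2_ord /= /DeltaF linearD /= !trmx_tens.
rewrite tr_diag_mx trmx1 mulmxDl mxE !tens_mulmxE /= sum_1_mx; congr (_ + _).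
  under eq_bigr => i' _ do rewrite mxE.
  rewrite Fmx_col -mulrA; congr (_ * _); rewrite /get2 -extZ; apply: eq_ext => i'.
  rewrite sum_diag_mx mxE (extE _ bd); congr (q ^ _ * _).
  by rewrite /wprod /=; lia.
under eq_bigr => i' _ do rewrite mxE.
by rewrite Fmx_col /get2 (extE _ ad).
Qed.

End StandardSquare.

(** * Highest weight vectors and invariant functionals of the tensor square *)

Section Braiding.
Variables (K F : fieldType) (q : K) (res : K -> F -> Prop).
Hypothesis rP : residue q res.
Variable l : nat.
Local Notation d := l.+1.
Local Notation V2 := (V2 rP l).
Local Notation vT := 'cV[K]_(d * d).
Local Notation wsp2 := (@wsp K q V2 (@wt2 l)).
Local Notation phi := (phi q l).
Local Notation gint := (gint q).

Let q0 : q != 0 := q_unit rP.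
Let qzD (a b : int) : q ^ (a + b) = q ^ a * q ^ b. Proof. exact: expfzDr. Qed.
Let qz0 (a : int) : q ^ a != 0. Proof. exact: expfz_neq0. Qed.

(* The coefficients of the highest weight vectors of V (x) V. *)
Definition hco (a : nat) : K := (-1) ^+ a * q ^ (a%:Z * l%:Z - a%:Z * (a%:Z - 1)).

Lemma hcoS a : hco a.+1 = - (q ^ (l%:Z - a%:Z - a%:Z) * hco a).
Proof.
rewrite /hco exprS mulN1r mulNr mulrCA -qzD; congr (- (_ * q ^ _)).
by rewrite intS; ring.
Qed.

Definition hv (j : nat) : vT := mk2 d (fun a b => (a + b == j)%N%:R * hco a).

(** The equation [E x = 0] is a two-term recursion along the antidiagonal [a + b = j], started by
    the entry at [(0, j)]. *)
Lemma hw_unique j (x : vT) : (j <= l)%N -> x \in wsp2 j -> actE V2 *m x = 0 ->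
  x = get2 x 0 j *: hv j.
Proof.
move=> jl xj Ex; have rec a : (a <= j)%N -> get2 x a (j - a) = get2 x 0 j * hco a.
  elim: a => [|a IH] aj; first by rewrite subn0 /hco mul0r sub0r mul0r oppr0 expr0z !mulr1.
  have := congr1 (fun y => get2 y a (j - a.+1)) Ex.
  rewrite /= get2_E ?get20; [|lia|lia]; move/eqP; rewrite addr_eq0 => /eqP ->.
  by rewrite (_ : (j - a.+1).+1 = j - a)%N ?IH ?hcoS; [ring|lia|lia].
apply: (@get2_inj _ d) => a b ad bd; rewrite get2Z get2_mk2 //.
have [abj|abj] := eqVneq (a + b)%N j; last first.
  by rewrite mul0r mulr0; move/wsp2P: xj; apply.
by rewrite mul1r -rec; [congr (get2 x a _)|]; lia.
Qed.

(* The coefficients of the functional [x |-> \sum_a eco j a * x_(a,j-a)]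
   vanishing on the image of F. *)
Definition rho (j a : nat) : K :=
  \prod_(i < a) (gint (j - i) * gint (l - j + i.+1) / (gint i.+1 * gint (l - i))).

Definition eco (j a : nat) : K := (-1) ^+ a
  * q ^ (a%:Z * (l%:Z - j%:Z - j%:Z + 1) + a%:Z * a%:Z) * rho j a.

Lemma res_rho j a : (a <= j)%N -> (j <= l)%N -> res (rho j a) 1.
Proof.
move=> aj jl; apply: (res_prod1 rP) => i _; have ia := ltn_ord i.
have g n : (0 < n)%N -> res (gint n) 1 by exact: res_gint.
have gM m n : (0 < m)%N -> (0 < n)%N -> res (gint m * gint n) 1.
  by move=> m0 n0; rewrite -[X in res _ X]mulr1; apply: (resM rP); exact: g.
rewrite -[X in res _ X](divr1 1); apply: (resM rP); first by apply: gM; lia.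
by apply: (resV rP); [exact: oner_neq0|apply: gM; lia].
Qed.

Lemma ecoS j a : (a < j <= l)%N ->
  phi a.+1 * q ^ ((j - a.+1)%N%:Z + (j - a.+1)%N%:Z - l%:Z) * eco j a.+1
  = - (phi (j - a) * eco j a).
Proof.
move=> /andP[aj jl]; rewrite /eco /rho big_ord_recr /= -/(rho j a) /phi.
have g n : (0 < n)%N -> gint n != 0 by exact: (gint_neq0 rP).
rewrite (_ : l.+1 - a.+1 = l - a)%N; last by lia.
rewrite (_ : l.+1 - (j - a) = l - j + a.+1)%N; last by lia.
rewrite exprS; set e := (_ + _ * _)%R.
have -> : q ^ e = q ^ (a%:Z * (l%:Z - j%:Z - j%:Z + 1) + a%:Z * a%:Z)
    * (q ^ ((j - a.+1)%N%:Z + (j - a.+1)%N%:Z - l%:Z))^-1.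
  rewrite invr_expz -qzD; congr (q ^ _); rewrite /e -subzn // intS; ring.
by field; rewrite qz0 !g //; lia.
Qed.

(** A functional is stored as its vector of coefficients, so vanishing on the image of [F] becomes a
    kernel condition on the transpose of [actF V2]. *)
Definition ev (j : nat) : vT := mk2 d (fun a b => (a + b == j)%N%:R * eco j a).

Lemma ev_unique j (x : vT) : (j <= l)%N -> x \in wsp2 j -> (actF V2)^T *m x = 0 ->
  x = get2 x 0 j *: ev j.
Proof.
move=> jl xj Fx; have rec a : (a <= j)%N -> get2 x a (j - a) = get2 x 0 j * eco j a.
  elim: a => [|a IH] aj.
    by rewrite subn0 /eco /rho big_ord0 !mul0r addr0 expr0z !mulr1.
  have := congr1 (fun y => get2 y a (j - a.+1)) Fx.
  rewrite /= get2_FT ?get20; [|lia|lia]; move/eqP; rewrite addr_eq0.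
  have u : phi a.+1 * q ^ ((j - a.+1)%N%:Z + (j - a.+1)%N%:Z - l%:Z) != 0.
    by rewrite mulf_neq0 // (phi_neq0 rP) //; lia.
  rewrite (_ : (j - a.+1).+1 = j - a)%N ?IH; [|lia|lia].
  move=> /eqP e; apply: (mulfI u); rewrite e mulrCA [RHS]mulrCA ecoS; last by lia.
  by rewrite mulrN.
apply: (@get2_inj _ d) => a b ad bd; rewrite get2Z get2_mk2 //.
have [abj|abj] := eqVneq (a + b)%N j; last first.
  by rewrite mul0r mulr0; move/wsp2P: xj; apply.
by rewrite mul1r -rec; [congr (get2 x a _)|]; lia.
Qed.

Lemma actF_ev j : (j <= l)%N -> (actF V2)^T *m ev j = 0.
Proof.
move=> jl; apply: (@get2_inj _ d) => a b ad bd; rewrite get2_FT // get20.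
have [abj|abj] := eqVneq (a + b).+1 j; last first.
  rewrite /ev; have [ad'|ad'] := ltnP a.+1 d; last first.
    rewrite get2_outl // mulr0 add0r; have [bd'|bd'] := ltnP b.+1 d; last first.
      by rewrite get2_outr // mulr0.
    by rewrite get2_mk2 // addnS (negPf abj) mul0r mulr0.
  rewrite get2_mk2 // addSn (negPf abj) mul0r mulr0 add0r.
  have [bd'|bd'] := ltnP b.+1 d; last by rewrite get2_outr // mulr0.
  by rewrite get2_mk2 // addnS (negPf abj) mul0r mulr0.
rewrite /ev !get2_mk2; try lia.
rewrite addSn addnS abj eqxx !mul1r.
have be : b = (j - a.+1)%N by lia.
rewrite {1 2}be ecoS; last by lia.
by rewrite (_ : j - a = b.+1)%N ?addNr //; lia.
Qed.

(* The functional [x |-> \sum_n bco n * x_(l-n,l-k+n)] vanishing on the image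
   of E. *)
Definition bco (n : nat) : K := (-1) ^+ n * q ^ (n%:Z * (n%:Z - 1) - n%:Z * l%:Z).

Lemma bcoS n : bco n.+1 = - (q ^ (n%:Z + n%:Z - l%:Z) * bco n).
Proof.
rewrite /bco exprS mulN1r mulNr mulrCA -qzD; congr (- (_ * q ^ _)).
by rewrite intS; ring.
Qed.

Definition bv (k : nat) : vT :=
  mk2 d (fun a b => (a + b == l + l - k)%N%:R * bco (l - a)).

Lemma bv_unique k (x : vT) : (k <= l)%N -> x \in wsp2 (l + l - k)%N ->
  (actE V2)^T *m x = 0 -> x = get2 x l (l - k) *: bv k.
Proof.
move=> kl xk Ex.
have rec n : (n <= k)%N -> get2 x (l - n) (l - k + n) = get2 x l (l - k) * bco n.
  elim: n => [|n IH] nk.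
    by rewrite subn0 addn0 /bco !mul0r subr0 expr0z !mulr1.
  have := congr1 (fun y => get2 y (l - n) (l - k + n.+1)) Ex.
  rewrite /= get2_ET ?get20; [|lia|lia].
  rewrite (_ : l - n = (l - n.+1).+1)%N; last by lia.
  rewrite addnS; move/eqP; rewrite addr_eq0 => /eqP ->.
  rewrite (_ : (l - n.+1).+1 = l - n)%N; last by lia.
  rewrite IH ?bcoS; last by lia.
  rewrite mulrN mulrCA; congr (- (_ * (q ^ _ * _))); lia.
apply: (@get2_inj _ d) => a b ad bd; rewrite get2Z get2_mk2 //.
have [abj|abj] := eqVneq (a + b)%N (l + l - k)%N; last first.
  by rewrite mul0r mulr0; move/wsp2P: xk; apply.
by rewrite mul1r -rec; [congr (get2 x _ _)|]; lia.
Qed.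

Lemma actE_bv k : (k <= l)%N -> (actE V2)^T *m bv k = 0.
Proof.
move=> kl; apply: (@get2_inj _ d) => a b ad bd; rewrite get2_ET // get20.
have [abj|abj] := eqVneq (a + b)%N (l + l - k).+1; last first.
  case: a ad abj => [|a] ad abj; rewrite ?add0r.
    case: b bd abj => [|b] bd abj; rewrite ?mulr0 // /bv get2_mk2 // 1?ltnW //.
    by rewrite addnS eqSS in abj; rewrite (negPf abj) mul0r mulr0.
  rewrite /bv get2_mk2 // 1?ltnW // addSn eqSS in abj *.
  rewrite (negPf abj) mul0r add0r.
  case: b bd abj => [|b] bd abj; rewrite ?mulr0 // get2_mk2 // 1?ltnW //.
  by rewrite addSnnS (negPf abj) mul0r mulr0.
case: a ad abj => [|a] ad abj; first by lia.
case: b bd abj => [|b] bd abj; first by lia.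
rewrite /bv !get2_mk2 // 1?ltnW //.
have e : (a + b.+1)%N = (l + l - k)%N by lia.
rewrite addSnnS e eqxx !mul1r (_ : (l - a = (l - a.+1).+1)%N); last by lia.
rewrite bcoS; apply/eqP; rewrite addrC subr_eq0; apply/eqP.
by congr (q ^ _ * _); lia.
Qed.

End Braiding.

Lemma vspan_stable (K : fieldType) (vT : vectType K) (A : set vT) (f : 'End(vT)) :
  (forall v, A v -> A (f v)) -> forall v, v \in vspan A -> f v \in vspan A.
Proof.
move=> Af v vA; rewrite memv_preim; move: v vA; apply/subvP/vspanP => v Av.
rewrite -memv_preim; have /vspanP := subvv (vspan A); apply; exact: Af.
Qed.

Lemma mem_vspan (K : fieldType) (vT : vectType K) (A : set vT) v :
  A v -> v \in vspan A.
Proof. by move=> Av; have /vspanP := subvv (vspan A); apply. Qed.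

(** * Spans of eigenvectors of one sign *)

Section SignSpan.
Variables (K F : fieldType) (q : K) (res : K -> F -> Prop).
Hypothesis rP : residue q res.
Variable n : nat.
Local Notation vT := 'cV[K]_n.

(* For s = false and s = true this is the space of braided symmetric,
   respectively braided alternating, tensors of the braiding P. *)
Definition sgn_span (P : 'M[K]_n) (s : bool) : {vspace vT} :=
  vspan [set v : vT | exists k : int, P *m v = ((-1) ^+ s * q ^ k) *: v].

Variable P : 'M[K]_n.

Lemma sgn_span_comm (A : 'M[K]_n) s v :
  A *m P = P *m A -> v \in sgn_span P s -> A *m v \in sgn_span P s.
Proof.
move=> AP vS; have := @vspan_stable _ _ [set v : vT | exists k : int, P *m v = ((-1) ^+ s * q ^ k) *: v] (linfun (mulmx A)) _ v vS.
rewrite lfunE; apply => w [k Pw]; exists k.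
by rewrite lfunE /= mulmxA -AP -mulmxA Pw scalemxAr.
Qed.

(** Moving [P] across the pairing of [y] with an eigenvector yields two different multiples of the
    same value. *)
Lemma sgn_span_functional (y : vT) (c : K) (s : bool) v :
  P^T *m y = c *: y -> (forall k : int, c != (-1) ^+ s * q ^ k) ->
  v \in sgn_span P s -> y^T *m v = 0.
Proof.
move=> Py cN vS; pose f := linfun (mulmx y^T : vT -> 'cV_1).
suff : v \in lker f by rewrite memv_ker lfunE => /eqP.
move: v vS; apply/subvP/vspanP => v [k Pv]; rewrite memv_ker lfunE /=.
have : c *: (y^T *m v) = ((-1) ^+ s * q ^ k) *: (y^T *m v).
  by rewrite scalemxAl -linearZ /= -Py trmx_mul trmxK -mulmxA Pv scalemxAr.
move/eqP; rewrite -subr_eq0 -scalerBl scaler_eq0 subr_eq0.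
by rewrite (negPf (cN k)).
Qed.

Lemma sign_q_neq (s : bool) (j : nat) (e k : int) : odd j != s ->
  (-1) ^+ j * q ^ e != (-1) ^+ s * q ^ k :> K.
Proof.
rewrite -signr_odd; case: (odd j); case: s => // _; rewrite !mulN1r !mul1r.
  by rewrite eq_sym; exact: (qz_neqN rP).
exact: (qz_neqN rP).
Qed.

End SignSpan.

Section Braiding.
Variables (K F : fieldType) (q : K) (res : K -> F -> Prop).
Hypothesis rP : residue q res.
Variable l : nat.
Local Notation d := l.+1.
Local Notation V2 := (V2 rP l).
Local Notation vT := 'cV[K]_(d * d).
Local Notation wsp2 := (@wsp K q V2 (@wt2 l)).
Local Notation gint := (gint q).

Let q0 : q != 0 := q_unit rP.
Let qzD (a b : int) : q ^ (a + b) = q ^ a * q ^ b. Proof. exact: expfzDr. Qed.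
Let qz0 (a : int) : q ^ a != 0. Proof. exact: expfz_neq0. Qed.

(* The last three fields express that R - R_0 raises the first and lowers the
   second index. *)
Record braid_op (P : 'M[K]_(d * d)) : Prop := BraidOp {
  brE : P *m actE V2 = actE V2 *m P;
  brF : P *m actF V2 = actF V2 *m P;
  brK : forall la, P *m actK V2 la = actK V2 la *m P;
  br_row : forall (x : vT) b, (b <= l)%N ->
    get2 (P *m x) b 0 = q ^ (l%:Z * (l%:Z - b%:Z)) * get2 x 0 b;
  br_col0 : forall (x : vT) a, (a <= l)%N ->
    get2 (P^T *m x) a 0 = q ^ (l%:Z * (l%:Z - a%:Z)) * get2 x 0 a;
  br_coll : forall (x : vT) b, (b <= l)%N ->
    get2 (P^T *m x) l b = q ^ (l%:Z * b%:Z) * get2 x b l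
}.

Variable P : 'M[K]_(d * d).
Hypothesis bP : braid_op P.

Lemma br_wt i j : wt2 i != wt2 j -> P i j = 0.
Proof.
move=> ij; apply: (wt_entry_shift rP (V2_weighted rP l) (e := 0)).
  by rewrite expr0z scale1r (brK bP).
by rewrite addr0; apply: contra_neq ij => -[].
Qed.

Lemma br_wsp m x : x \in wsp2 m -> P *m x \in wsp2 m.
Proof.
move/wspP => x0; apply/wspP => i im; rewrite mxE big1 // => j _.
have [ji|ji] := eqVneq (wt2 j) (wt2 i); last by rewrite br_wt ?mul0r // eq_sym.
by rewrite (x0 j) ?mulr0 // ji.
Qed.

Lemma br_wspT m x : x \in wsp2 m -> P^T *m x \in wsp2 m.
Proof.
move/wspP => x0; apply/wspP => i im; rewrite mxE big1 // => j _; rewrite mxE.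
have [ji|ji] := eqVneq (wt2 j) (wt2 i); last by rewrite br_wt ?mul0r.
by rewrite (x0 j) ?mulr0 // ji.
Qed.

Lemma br_wproj m : wproj (M := V2) (@wt2 l) m *m P = P *m wproj (M := V2) (@wt2 l) m.
Proof.
apply/matrixP => i j; rewrite mul_diag_mx mul_mx_diag !mxE mulrC.
by have [->//|ij] := eqVneq (wt2 i) (wt2 j); rewrite br_wt // !mul0r.
Qed.

Lemma actE_hv j : (j <= l)%N -> actE V2 *m hv q l j = 0.
Proof.
move=> jl; apply: (@get2_inj _ d) => a b ad bd; rewrite get2_E // get20 /hv.
have [ad'|ad'] := ltnP a.+1 d; have [bd'|bd'] := ltnP b.+1 d.
- rewrite !get2_mk2 // addnS addSn; case: eqP => _; rewrite ?mul0r ?mulr0 ?addr0 //.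
  by rewrite !mul1r (hcoS rP) addNr.
- rewrite (get2_outr _ _ bd') get2_mk2 // (_ : (a.+1 + b == j)%N = false); last by lia.
  by rewrite mul0r mulr0 addr0.
- rewrite (get2_outl _ _ ad') get2_mk2 // (_ : (a + b.+1 == j)%N = false); last by lia.
  by rewrite mul0r mulr0 addr0.
- by rewrite (get2_outr _ _ bd') (get2_outl _ _ ad') mulr0 addr0.
Qed.

Lemma hv_wsp j : hv q l j \in wsp2 j.
Proof. by apply/wsp2P => a b ad bd abj; rewrite get2_mk2 // (negPf abj) mul0r. Qed.

Lemma ev_wsp j : ev q l j \in wsp2 j.
Proof. by apply/wsp2P => a b ad bd abj; rewrite get2_mk2 // (negPf abj) mul0r. Qed.

Lemma bv_wsp k : bv q l k \in wsp2 (l + l - k).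
Proof. by apply/wsp2P => a b ad bd abj; rewrite get2_mk2 // (negPf abj) mul0r. Qed.

(** [P] commutes with [E] and preserves weights, so [hw_unique] makes the image a multiple of [hv].
    The scalar follows by comparing the entries at [(j, 0)], which [br_row] provides. *)
Lemma hv_eigen j : (j <= l)%N ->
  exists e : int, P *m hv q l j = ((-1) ^+ j * q ^ e) *: hv q l j.
Proof.
move=> jl; have := @hw_unique _ _ _ _ rP l j (P *m hv q l j) jl (br_wsp (hv_wsp j)).
rewrite mulmxA -(brE bP) -mulmxA actE_hv // mulmx0 => /(_ erefl).
set c := get2 _ 0 j => Ph.
have := br_row bP (hv q l j) jl; rewrite Ph get2Z !get2_mk2 // add0n addn0 !eqxx.
rewrite !mul1r {2}/hco mul0r sub0r mul0r oppr0 expr0z expr0 !mulr1 => cE.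
(* The exponent from [br_row] minus that of [hco j]; the sign is the sign of [hco j]. *)
exists (l%:Z * (l%:Z - j%:Z) - (j%:Z * l%:Z - j%:Z * (j%:Z - 1))).
congr (_ *: _); have hN : hco q l j != 0 by rewrite mulf_neq0 // signr_eq0.
apply: (mulIf hN); rewrite cE /hco mulrACA -expr2 sqrr_sign mul1r -qzD.
by congr (q ^ _); ring.
Qed.

(** Numerators and denominators are the same q-integers in opposite order. This makes the eigenvalue
    of [ev j] a signed power of [q]. *)
Lemma rho_diag j : (j <= l)%N -> rho q l j j = 1.
Proof.
move=> jl; rewrite /rho prodf_div !big_split /=.
have -> : \prod_(i < j) gint (j - i) = \prod_(i < j) gint i.+1.
  rewrite (reindex_inj rev_ord_inj); apply: eq_bigr => i _ /=.
  by congr gint; have := ltn_ord i; lia.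
have -> : \prod_(i < j) gint (l - j + i.+1) = \prod_(i < j) gint (l - i).
  rewrite (reindex_inj rev_ord_inj); apply: eq_bigr => i _ /=.
  by congr gint; have := ltn_ord i; lia.
rewrite divff // mulf_neq0 //; apply/prodf_neq0 => i _; apply: (gint_neq0 rP) => //.
by have := ltn_ord i; lia.
Qed.

Lemma ev_eigen j : (j <= l)%N ->
  exists e : int, P^T *m ev q l j = ((-1) ^+ j * q ^ e) *: ev q l j.
Proof.
move=> jl; have := @ev_unique _ _ _ _ rP l j (P^T *m ev q l j) jl (br_wspT (ev_wsp j)).
rewrite mulmxA -trmx_mul (brF bP) trmx_mul -mulmxA actF_ev // mulmx0 => /(_ erefl).
set c := get2 _ 0 j => Ph.
have := br_col0 bP (ev q l j) jl; rewrite Ph get2Z !get2_mk2 // add0n addn0 !eqxx.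
rewrite !mul1r {2}/eco /rho big_ord0 !mul0r addr0 expr0z expr0 !mulr1 => cE.
have rjj : rho q l j j = 1.
  exact: rho_diag jl.
exists (l%:Z * (l%:Z - j%:Z) - (j%:Z * (l%:Z - j%:Z - j%:Z + 1) + j%:Z * j%:Z)).
congr (_ *: _).
have hN : eco q l j j != 0 by rewrite /eco rjj mulr1 mulf_neq0 // signr_eq0.
apply: (mulIf hN); rewrite cE /eco rjj mulr1 mulrACA -expr2 sqrr_sign mul1r -qzD.
by congr (q ^ _); ring.
Qed.

Lemma bv_eigen k : (k <= l)%N ->
  exists e : int, P^T *m bv q l k = ((-1) ^+ k * q ^ e) *: bv q l k.
Proof.
move=> kl; have := @bv_unique _ _ _ _ rP l k (P^T *m bv q l k) kl (br_wspT (bv_wsp k)).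
rewrite mulmxA -trmx_mul (brE bP) trmx_mul -mulmxA actE_bv // mulmx0 => /(_ erefl).
have := br_coll bP (bv q l k) (leq_subr k l) => -> Ph.
rewrite Ph get2_mk2 //; last by rewrite ltnS leq_subr.
rewrite (_ : (l - k + l == l + l - k)%N = true); last by lia.
rewrite mul1r subKn // /bco mulrCA -qzD.
by eexists.
Qed.

End Braiding.

Lemma pair_mk2 (K : fieldType) d (f : nat -> nat -> K) (x : 'cV_(d * d)) :
  ((mk2 d f)^T *m x) 0 0 = \sum_(a < d) \sum_(b < d) f a b * get2 x a b.
Proof.
rewrite mxE pair_big /= (reindex (@mxtens_index d d)) /=.
  by apply: eq_bigr => -[a b] _; rewrite !mxE mxtens_indexK get2_ord.
by exists (@mxtens_unindex d d) => k _; rewrite (mxtens_indexK, mxtens_unindexK).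
Qed.

Section Decomposition.
Variables (K F : fieldType) (q : K) (res : K -> F -> Prop).
Hypothesis rP : residue q res.
Variable l : nat.
Local Notation d := l.+1.
Local Notation V2 := (V2 rP l).
Local Notation vT := 'cV[K]_(d * d).
Local Notation wsp2 := (@wsp K q V2 (@wt2 l)).
Variable P : 'M[K]_(d * d).
Hypothesis bP : braid_op rP P.
Local Notation Sg := (sgn_span q P).

Let q0 : q != 0 := q_unit rP.
Let qzD (a b : int) : q ^ (a + b) = q ^ a * q ^ b. Proof. exact: expfzDr. Qed.

Lemma pair_ev j (x : vT) : (j <= l)%N ->
  ((ev q l j)^T *m x) 0 0 = \sum_(a < j.+1) eco q l j a * get2 x a (j - a).
Proof.
move=> jl; rewrite pair_mk2.
rewrite (big_ord_widen d (fun a => eco q l j a * get2 x a (j - a))) //.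
rewrite [RHS]big_mkcond /=; apply: eq_bigr => a _; rewrite ltnS.
have [aj|ja] := leqP a j; last first.
  rewrite big1 // => b _; rewrite (_ : (a + b == j)%N = false) ?mul0r //; lia.
have bd : (j - a < d)%N by lia.
rewrite (bigD1 (Ordinal bd)) //= subnKC // eqxx mul1r big1 ?addr0 // => b /eqP bN.
rewrite (_ : (a + b == j)%N = false) ?mul0r //; apply/negP => /eqP e.
by apply: bN; apply: val_inj; rewrite /= -e addKn.
Qed.

Lemma pair_bv k (x : vT) : (k <= l)%N ->
  ((bv q l k)^T *m x) 0 0 = \sum_(n < k.+1) bco q l n * get2 x (l - n) (l - k + n).
Proof.
move=> kl; rewrite pair_mk2 (reindex_inj rev_ord_inj) /=.
rewrite (big_ord_widen d (fun n => bco q l n * get2 x (l - n) (l - k + n))) //.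
rewrite [RHS]big_mkcond /=; apply: eq_bigr => n _; rewrite ltnS subSS.
have nl : (n <= l)%N by rewrite -ltnS.
have [nk|kn] := leqP n k; last first.
  rewrite big1 // => b _; have := ltn_ord b => bd.
  rewrite (_ : (l - n + b == l + l - k)%N = false) ?mul0r //; lia.
have bd : (l - k + n < d)%N by lia.
rewrite (bigD1 (Ordinal bd)) //= (_ : (l - n + (l - k + n) == l + l - k)%N = true); last by lia.
rewrite mul1r subKn // big1 ?addr0 // => b /eqP bN.
rewrite (_ : (l - n + b == l + l - k)%N = false) ?mul0r //; apply/negP => /eqP e.
by apply: bN; apply: val_inj => /=; lia.
Qed.

Lemma sgn_ev j (s : bool) (x : vT) : (j <= l)%N -> odd j != s -> x \in Sg s ->
  \sum_(a < j.+1) eco q l j a * get2 x a (j - a) = 0.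
Proof.
move=> jl js xS; rewrite -pair_ev //; have [e Pe] := ev_eigen bP jl.
by rewrite (sgn_span_functional Pe _ xS) ?mxE // => k; apply: (sign_q_neq rP).
Qed.

Lemma sgn_bv k (s : bool) (x : vT) : (k <= l)%N -> odd k != s -> x \in Sg s ->
  \sum_(n < k.+1) bco q l n * get2 x (l - n) (l - k + n) = 0.
Proof.
move=> kl ks xS; rewrite -pair_bv //; have [e Pe] := bv_eigen bP kl.
by rewrite (sgn_span_functional Pe _ xS) ?mxE // => i; apply: (sign_q_neq rP).
Qed.

Lemma sgn_hv j : (j <= l)%N -> hv q l j \in Sg (odd j).
Proof.
move=> jl; have [e Pe] := hv_eigen bP jl.
by apply: mem_vspan; exists e; rewrite signr_odd.
Qed.

(** The term of index [a] is [q^(2a(l - j + 1))] times a factor of residue 1, so the sum has residue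
    1. *)
Lemma pair_ev_hv j : (j <= l)%N ->
  \sum_(a < j.+1) eco q l j a * get2 (hv q l j) a (j - a) != 0.
Proof.
move=> jl; apply: (res_eq0 rP _ (oner_neq0 F)).
have -> : (1 : F) = \sum_(a < j.+1) ((a : nat) == 0%N)%:R.
  by rewrite big_ord_recl big1 ?addr0.
apply: (res_sum rP) => a _; have aj : (a <= j)%N by rewrite -ltnS.
rewrite get2_mk2; [|lia|lia]; rewrite subnKC // eqxx mul1r /eco /hco.
have -> : forall s A r B : K, s * A * r * (s * B) = s ^+ 2 * (A * B) * r.
  by move=> *; ring.
rewrite sqrr_sign mul1r -qzD.
have -> : a%:Z * (l%:Z - j%:Z - j%:Z + 1) + a%:Z * a%:Z
    + (a%:Z * l%:Z - a%:Z * (a%:Z - 1)) = (2 * (a * (l - j + 1)))%N%:Z.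
  by rewrite !PoszM PoszD -subzn //; ring.
rewrite (_ : (a == 0 :> nat) = (2 * (a * (l - j + 1)) == 0)%N); last first.
  by rewrite !muln_eq0 addn1 orbF.
rewrite -[X in res _ X]mulr1; apply: (resM rP); first exact: (resqX rP).
by apply: (res_rho rP).
Qed.

Lemma sgn_E s x : x \in Sg s -> actE V2 *m x \in Sg s.
Proof. by apply: sgn_span_comm; rewrite (brE bP). Qed.

Lemma sgn_F s x : x \in Sg s -> actF V2 *m x \in Sg s.
Proof. by apply: sgn_span_comm; rewrite (brF bP). Qed.

Lemma sgn_K la s x : x \in Sg s -> actK V2 la *m x \in Sg s.
Proof. by apply: sgn_span_comm; rewrite (brK bP). Qed.

Lemma sgn_wproj m s x : x \in Sg s -> wproj (M := V2) (@wt2 l) m *m x \in Sg s.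
Proof. by apply: sgn_span_comm; rewrite (br_wproj bP). Qed.

(** Each [hv j] has an eigenvalue of definite sign, and these vectors generate the upper half of the
    weights under [F]. Together with [sgn_cap] this gives the diagonalization of the braiding that
    is needed. *)
Lemma sgn_full : (Sg false + Sg true)%VS = fullv.
Proof.
have sumP (A : 'M_(d * d)) : (forall s x, x \in Sg s -> A *m x \in Sg s) ->
    forall x, x \in (Sg false + Sg true)%VS -> A *m x \in (Sg false + Sg true)%VS.
  by move=> AS x /memv_addP[u uS [v vS ->]]; rewrite mulmxDr memv_add ?AS.
have NF := sumP _ sgn_F.
apply: (weighted_top_half rP (V2_weighted rP l) (sumP _ sgn_E) NF) => m ml.
apply/subvP => x xm.
have sl2 := weighted_sl2 rP (V2_weighted rP l).
have fE (u : vT) : u \in (fullv : {vspace vT}) -> opE V2 u \in (fullv : {vspace vT}).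
  by rewrite !memvf.
have fF (u : vT) : u \in (fullv : {vspace vT}) -> opF V2 u \in (fullv : {vspace vT}).
  by rewrite !memvf.
have mL : (2 * m <= (l + l).+1)%N by lia.
have xg : x \in gr wsp2 fullv m by rewrite memv_cap memvf.
have [h [hh ->]] := gr_span sl2 fE fF mL xg.
apply: memv_suml => k _; have km : (k <= m)%N by rewrite -ltnS.
have /hwP[_ hT] := hh k km; rewrite lfunE /= => hE.
have hN : h k \in (Sg false + Sg true)%VS.
  rewrite (hw_unique _ hT hE); last by lia.
  apply: memvZ; have := sgn_hv (j := m - k); case: odd => hS.
    by rewrite -[hv _ _ _]add0r memv_add ?mem0v ?hS //; lia.
  by rewrite -[hv _ _ _]addr0 memv_add ?mem0v ?hS //; lia.
by apply: (iterF_M _ _ hN) => u; rewrite lfunE; exact: NF.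
Qed.

(** A nonzero intersection would contain some [hv m] up to scalar; the functional [ev m] kills the
    part of sign opposite to [m], but does not kill [hv m]. *)
Lemma sgn_cap : (Sg false :&: Sg true)%VS = 0%VS.
Proof.
have capP (A : 'M_(d * d)) : (forall s x, x \in Sg s -> A *m x \in Sg s) ->
    forall x, x \in (Sg false :&: Sg true)%VS -> A *m x \in (Sg false :&: Sg true)%VS.
  by move=> AS x; rewrite !memv_cap => /andP[xf xt]; rewrite !AS.
apply: (weighted_hw_eq0 rP (V2_weighted rP l) (capP _ sgn_E) (capP _ sgn_F)).
  by move=> m; apply: capP; exact: sgn_wproj.
move=> m ml; have {}ml : (m <= l)%N by lia.
apply/eqP; rewrite -subv0; apply/subvP => x /hwP[xN xm]; rewrite lfunE /= => Ex.
have := hw_unique ml xm Ex; set c := get2 x 0 m => xE.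
rewrite memv0 xE scaler_eq0; apply/orP; left.
have xS : x \in Sg (~~ odd m) by move: xN; rewrite memv_cap => /andP[]; case: odd.
have oN : odd m != ~~ odd m by case: odd.
have := sgn_ev ml oN xS; rewrite xE.
under eq_bigr => a _ do rewrite get2Z mulrCA.
by move/eqP; rewrite -mulr_sumr mulf_eq0 (negPf (pair_ev_hv ml)) orbF.
Qed.

Lemma sgn_decomp (x : vT) : exists u : bool -> vT,
  (forall s, u s \in Sg s) /\ x = u false + u true.
Proof.
have := memvf x; rewrite -sgn_full => /memv_addP[u uS [v vS ->]].
by exists (fun s => if s then v else u); split=> // -[].
Qed.

Lemma sgn_cap_eq0 s (x : vT) : x \in Sg s -> x \in Sg (~~ s) -> x = 0.
Proof.
move=> xs xs'; apply/eqP; rewrite -memv0 -sgn_cap memv_cap.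
by case: s xs xs' => -> ->.
Qed.

End Decomposition.

(** * Residues of q-Pascal arrays *)

(** The unknowns are eliminated in increasing order. Once the earlier ones vanish, [c i] is given by
    its own equation, by the partial sum up to [i], or by the partial sum up to [i + 1] together
    with [c (i + 1) = 0]. *)
Lemma residue_system_eq0 (F : fieldType) (m : nat) (c : nat -> F) (J C : pred nat) :
  (forall j, (j <= m)%N -> J j -> \sum_(t < j.+1) c t = 0) ->
  (forall i, (i <= m)%N -> C i -> c i = 0) ->
  (forall i, (i <= m)%N -> [|| C i, J i | [&& (i < m)%N, J i.+1 & C i.+1]]) ->
  forall i, (i <= m)%N -> c i = 0.
Proof.
move=> cJ cC cond i; elim: i {-2}i (leqnn i) => [|n IH] i lein im.
  move: lein; rewrite leqn0 => /eqP i0; move: im; rewrite {}i0 => im.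
  case/or3P: (cond _ im) => [/cC->//|/cJ|/and3P[m0 J1 C1]].
    by rewrite big_ord1 => ->.
  have := cJ _ m0 J1; rewrite !big_ord_recl big_ord0 addr0 /= => <-.
  by rewrite (cC 1%N) // addr0.
have below : \sum_(t < i) c t = 0.
  by rewrite big1 // => t _; apply: IH; have := ltn_ord t; lia.
case/or3P: (cond _ im) => [/cC->//|/cJ|/and3P[m0 J1 C1]].
  by rewrite big_ord_recr /= below add0r => ->.
have := cJ _ m0 J1; rewrite !big_ord_recr /= below add0r => <-.
by rewrite (cC i.+1) // addr0.
Qed.

Section Residues.
Variables (K F : fieldType) (q : K) (res : K -> F -> Prop).
Hypothesis rP : residue q res.

Let q0 : q != 0 := q_unit rP.
Let qzD (a b : int) : q ^ (a + b) = q ^ a * q ^ b. Proof. exact: expfzDr. Qed.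
Let qz0 (a : int) : q ^ a != 0. Proof. exact: expfz_neq0. Qed.

Lemma normalized_eq0 (m : nat) (y : nat -> K) :
  (forall u c, u != 0 -> (forall i, (i <= m)%N -> res (u * y i) (c i)) ->
     forall i, (i <= m)%N -> c i = 0) ->
  forall i, (i <= m)%N -> y i = 0.
Proof.
move=> H i im; apply/eqP; apply/negPn/negP => yi.
have [|u [u0 [c [uc [i0 i0m ci0]]]]] := res_normalize rP (n := m.+1) (y := y).
  by exists i.
by rewrite (H u c u0 uc) ?eqxx in ci0.
Qed.

Section Triangle.
Variables (l m : nat).
Hypothesis ml : (m <= l)%N.

Definition hw_rel (X : nat -> nat -> nat -> K) : Prop :=
  forall a b c, (a + b + c).+1 = m ->
  X a.+1 b c + q ^ (l%:Z - a%:Z - a%:Z) * X a b.+1 c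
    + q ^ (l%:Z + l%:Z - a%:Z - a%:Z - b%:Z - b%:Z) * X a b c.+1 = 0.

Lemma hw_relZ u X : hw_rel X -> hw_rel (fun a b c => u * X a b c).
Proof.
move=> HX a b c abc; rewrite !(mulrCA _ u) -!mulrDr HX //; exact: mulr0.
Qed.

(** The exponent for which dividing by [q^zexp] gives the recursion [zcoordS], whose coefficients
    are nonnegative powers of [q]. *)
Definition zexp (a b : nat) : int :=
  2 * a%:Z * (l%:Z + 1) + b%:Z * (l%:Z + 1 - b%:Z) - 2 * a%:Z * (a%:Z + b%:Z).

(* The normalization of the coordinates of a highest weight vector in which
   its relations become the q-Pascal recursion [zcoordS]. *)
Definition zcoord (X : nat -> nat -> nat -> K) (a b : nat) : K :=
  (-1) ^+ b * q ^ (- zexp a b) * X a b (m - a - b)%N.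

Lemma zcoordZ u X a b :
  zcoord (fun a b c => u * X a b c) a b = u * zcoord X a b.
Proof. by rewrite /zcoord; ring. Qed.

Variable X : nat -> nat -> nat -> K.
Hypothesis HX : hw_rel X.
Local Notation z := (zcoord X).

Lemma zcoordK a b : (a + b <= m)%N ->
  X a b (m - a - b)%N = (-1) ^+ b * q ^ zexp a b * z a b.
Proof.
move=> abm; rewrite /zcoord.
have -> : forall s A B x : K, s * A * (s * B * x) = s ^+ 2 * (A * B) * x by move=> *; ring.
by rewrite sqrr_sign -qzD subrr expr0z !mul1r.
Qed.

Lemma zcoordS a b : (a + b < m)%N ->
  z a b.+1 = q ^ (2 * a%:Z) * z a b + z a.+1 b.
Proof.
move=> abm; have abc : (a + b + (m - a - b.+1)).+1 = m by lia.
have := HX abc.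
have e1 : (m - a - b.+1)%N = (m - a.+1 - b)%N by lia.
have e2 : (m - a - b.+1).+1 = (m - a - b)%N by lia.
rewrite {1}e1 e2 !zcoordK; [|lia..].
move/eqP; rewrite [X in X == 0]addrAC addr_eq0 => /eqP.
have -> : zexp a.+1 b = zexp a b + (2 * l%:Z - 4 * a%:Z - 2 * b%:Z).
  by rewrite /zexp intS; ring.
have -> : zexp a b.+1 = zexp a b + (l%:Z - 2 * a%:Z - 2 * b%:Z).
  by rewrite /zexp intS; ring.
have -> : l%:Z + l%:Z - a%:Z - a%:Z - b%:Z - b%:Z
    = 2 * a%:Z + (2 * l%:Z - 4 * a%:Z - 2 * b%:Z) by ring.
have -> : q ^ (l%:Z - a%:Z - a%:Z) * ((-1) ^+ b.+1 * q ^ (zexp a b + (l%:Z - 2 * a%:Z - 2 * b%:Z)) * z a b.+1)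
    = - ((-1) ^+ b * q ^ zexp a b * q ^ (2 * l%:Z - 4 * a%:Z - 2 * b%:Z) * z a b.+1).
  rewrite exprS; have -> : 2 * l%:Z - 4 * a%:Z - 2 * b%:Z = (l%:Z - a%:Z - a%:Z) + (l%:Z - 2 * a%:Z - 2 * b%:Z) by ring.
  by rewrite !qzD; ring.
rewrite opprK => e.
have u : (-1) ^+ b * q ^ zexp a b * q ^ (2 * l%:Z - 4 * a%:Z - 2 * b%:Z) != 0.
  by rewrite !mulf_neq0 // signr_eq0.
by apply: (mulfI u); rewrite -[LHS]e !qzD; ring.
Qed.

Lemma zcoord_eq0 : (forall i, (i <= m)%N -> z i 0 = 0) ->
  forall a b c, (a + b + c)%N = m -> X a b c = 0.
Proof.
move=> z0; have zab b : forall a, (a + b <= m)%N -> z a b = 0.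
  elim: b => [|b IH] a abm; first by apply: z0; rewrite addn0 in abm.
  by rewrite zcoordS ?IH ?mulr0 ?addr0 //; lia.
move=> a b c abc; have -> : c = (m - a - b)%N by lia.
by rewrite zcoordK ?zab ?mulr0 //; lia.
Qed.

Variable c : nat -> F.
Hypothesis zc : forall i, (i <= m)%N -> res (z i 0) (c i).

(** For [a > 0] the coefficient [q^(2a)] of the recursion has residue 0, and only the shift
    survives. *)
Lemma res_zcoord b : forall a, (0 < a)%N -> (a + b <= m)%N -> res (z a b) (c (a + b)).
Proof.
elim: b => [|b IH] a a0 abm; first by rewrite addn0 in abm *; exact: zc.
rewrite zcoordS; last by lia.
rewrite -[c _]add0r -(mul0r (c (a + b)%N)); apply: (resD rP); last first.
  by rewrite addnS -addSn; apply: IH => //; lia.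
apply: (resM rP); last by apply: IH => //; lia.
rewrite (_ : 0 = (2 * a%:Z == 0)%:R); last by case: a a0 {abm}.
by apply: (resqz rP); lia.
Qed.

(** At [a = 0] the coefficient is 1, so the residues accumulate. *)
Lemma res_zcoord0 b : (b <= m)%N -> res (z 0 b) (\sum_(t < b.+1) c t).
Proof.
elim: b => [|b IH] bm; first by rewrite big_ord1; exact: zc.
rewrite zcoordS // mulr0 expr0z mul1r big_ord_recr /=; apply: (resD rP).
  by apply: IH; lia.
by have := res_zcoord (b := b) (a := 1); rewrite add1n; apply.
Qed.

Lemma res_z_int a b : (a + b <= m)%N -> exists v, res (z a b) v.
Proof.
case: a => [|a] abm; eexists; first by apply: res_zcoord0.
exact: res_zcoord.
Qed.

(** All terms but the first carry a positive power of [q], so the residue of the sum is [v]. *)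
Lemma res_weighted_sum (n : nat) (w : nat -> nat) (r y : nat -> K) v :
  w 0%N = 0%N -> (forall a, (0 < a)%N -> (0 < w a)%N) ->
  (forall a, (a <= n)%N -> res (r a) 1) ->
  (forall a, (a <= n)%N -> exists v, res (y a) v) -> res (y 0%N) v ->
  \sum_(a < n.+1) q ^+ (w a) * (r a * y a) = 0 -> v = 0.
Proof.
move=> w0 wS r1 yO y0v; rewrite big_ord_recl w0 expr0 mul1r => sum0.
have : res (r 0%N * y 0%N + \sum_(i < n) q ^+ w i.+1 * (r i.+1 * y i.+1))
    (1 * v + \sum_(i < n) (0 : F)).
  apply: (resD rP); first by apply: (resM rP) => //; exact: r1.
  apply: (res_sum rP) => i _; have [|v' yv'] := yO i.+1; first exact: ltn_ord.
  rewrite -(mul0r (1 * v')); apply: (resM rP); last by apply: (resM rP) => //; apply: r1; exact: ltn_ord.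
  by have := resqX rP (w i.+1); rewrite (_ : (w i.+1 == 0)%N = false) // eqn0Ngt wS.
by rewrite sum0 big1_eq addr0 mul1r => /(res_inj rP (res0 rP)).
Qed.

Lemma first_residue j : (j <= m)%N ->
  \sum_(a < j.+1) eco q l j a * X a (j - a) (m - j) = 0 ->
  \sum_(t < j.+1) c t = 0.
Proof.
move=> jm sum0.
apply: (@res_weighted_sum j (fun a => 2 * (a * (l + 1 - j)))%N (rho q l j) (fun a => z a (j - a))) => //.
- by move=> a a0; rewrite !muln_gt0 a0 /=; lia.
- by move=> a aj; apply: (res_rho rP) => //; lia.
- by move=> a aj; apply: res_z_int; lia.
- by rewrite subn0; exact: res_zcoord0.
(* This is the normalization of the leading term [a = 0], with exponent [zexp 0 j]; dividing by it
   leaves [q^(2a(l + 1 - j))] in the other terms. *)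
have u : (-1) ^+ j * q ^ (j%:Z * (l%:Z + 1 - j%:Z)) != 0 by rewrite mulf_neq0 // signr_eq0.
apply: (mulfI u); rewrite mulr0 -[RHS]sum0 mulr_sumr; apply: eq_bigr => a _.
have aj : (a <= j)%N by rewrite -ltnS.
have -> : (m - j = m - a - (j - a))%N by lia.
rewrite zcoordK; last by lia.
rewrite /eco (_ : (-1) ^+ j = (-1) ^+ a * (-1) ^+ (j - a) :> K); last by rewrite -exprD subnKC.
have -> : forall s t A B r y : K, s * A * r * (t * B * y) = s * t * (A * B) * (r * y).
  by move=> *; ring.
have reassoc (S A B y : K) : S * A * (B * y) = S * (A * B) * y by ring.
rewrite [LHS]reassoc (exprnP q) -!qzD; congr (_ * q ^ _ * _); rewrite /zexp -subzn // !PoszM -subzn; last by lia.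
by rewrite PoszD; ring.
Qed.

Lemma second_residue k : (k <= m)%N ->
  \sum_(b < k.+1) eco q l k b * X (m - k) b (k - b) = 0 -> c (m - k) = 0.
Proof.
move=> km sum0.
apply: (@res_weighted_sum k (fun b => 2 * (b * (l + 1 - m)))%N (rho q l k) (fun b => z (m - k) b)) => //.
- by move=> a a0; rewrite !muln_gt0 a0 /=; lia.
- by move=> a aj; apply: (res_rho rP) => //; lia.
- by move=> a aj; apply: res_z_int; lia.
- by apply: zc; lia.
(* The exponent is [zexp (m - k) 0], that of the term [b = 0], which lies on the edge with residues
   [c]. *)
have u : q ^ (2 * (m%:Z - k%:Z) * (l%:Z + 1) - 2 * (m%:Z - k%:Z) * (m%:Z - k%:Z)) != 0 by [].
apply: (mulfI u); rewrite mulr0 -[RHS]sum0 mulr_sumr; apply: eq_bigr => b _.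
have bk : (b <= k)%N by rewrite -ltnS.
have -> : (k - b = m - (m - k) - b)%N by lia.
rewrite zcoordK; last by lia.
rewrite /eco.
have -> : forall s A B r y : K, s * A * r * (s * B * y) = s ^+ 2 * (A * B) * (r * y).
  by move=> *; ring.
rewrite sqrr_sign mul1r [LHS]mulrA (exprnP q) -!qzD; congr (q ^ _ * _).
by rewrite /zexp !PoszM -!subzn ?PoszD; [ring|lia..].
Qed.

End Triangle.
End Residues.

(** * Tensor cubes *)

Section Cube.
Variables (K : fieldType) (d : nat).
Local Notation vT := 'cV[K]_(d * d * d).

Definition sl12 (x : vT) (c : nat) : 'cV[K]_(d * d) :=
  \col_k ext (fun c' => x (mxtens_index (k, c')) 0) c.

Definition get3 (x : vT) (a b c : nat) : K := get2 (sl12 x c) a b.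

Definition sl23 (x : vT) (a : nat) : 'cV[K]_(d * d) := mk2 d (get3 x a).

Lemma sl12_out x c : (d <= c)%N -> sl12 x c = 0.
Proof. by move=> dc; apply/colP => k; rewrite !mxE ext_out. Qed.

Lemma sl12_lin u x y c : sl12 (u *: x + y) c = u *: sl12 x c + sl12 y c.
Proof.
apply/colP => k; rewrite !mxE -extZ -extD.
by apply: eq_ext => c'; rewrite !mxE.
Qed.

Lemma sl12D x y c : sl12 (x + y) c = sl12 x c + sl12 y c.
Proof. by rewrite -{1}[x]scale1r sl12_lin scale1r. Qed.

Lemma get3_lin u x y a b c :
  get3 (u *: x + y) a b c = u * get3 x a b c + get3 y a b c.
Proof. by rewrite /get3 sl12_lin get2D get2Z. Qed.

Lemma sl12_0 c : sl12 0 c = 0.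
Proof.
apply/colP => k; rewrite !mxE (eq_ext (g := fun=> 0)) ?ext0 // => c'.
by rewrite mxE.
Qed.

Lemma get30 a b c : get3 0 a b c = 0.
Proof. by rewrite /get3 sl12_0 get20. Qed.

Lemma get3Z u x a b c : get3 (u *: x) a b c = u * get3 x a b c.
Proof. by rewrite -[u *: x]addr0 get3_lin get30 addr0. Qed.

Lemma sl23_lin u x y a : sl23 (u *: x + y) a = u *: sl23 x a + sl23 y a.
Proof. by apply/colP => k; rewrite !mxE get3_lin. Qed.

Lemma get3_outl x a b c : (d <= a)%N -> get3 x a b c = 0.
Proof. exact: get2_outl. Qed.

Lemma get3_outm x a b c : (d <= b)%N -> get3 x a b c = 0.
Proof. exact: get2_outr. Qed.

Lemma get3_outr x a b c : (d <= c)%N -> get3 x a b c = 0.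
Proof. by move=> dc; rewrite /get3 sl12_out ?get20. Qed.

Lemma sl23_out x a : (d <= a)%N -> sl23 x a = 0.
Proof. by move=> da; apply/colP => k; rewrite !mxE get3_outl. Qed.

Lemma get2_sl23 x a b c : get2 (sl23 x a) b c = get3 x a b c.
Proof.
have [bd|db] := ltnP b d; last by rewrite get2_outl // get3_outm.
have [cd|dc] := ltnP c d; last by rewrite get2_outr // get3_outr.
by rewrite get2_mk2.
Qed.

Lemma get3_ord x (i j k : 'I_d) :
  get3 x i j k = x (mxtens_index (mxtens_index (i, j), k)) 0.
Proof. by rewrite /get3 get2_ord mxE ext_ord. Qed.

Lemma get3_inj x y :
  (forall a b c, (a < d)%N -> (b < d)%N -> (c < d)%N -> get3 x a b c = get3 y a b c) ->
  x = y.
Proof.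
move=> xy; apply/colP => n; case: (mxtens_indexP n) => m k.
by case: (mxtens_indexP m) => i j; rewrite -!get3_ord xy.
Qed.

Lemma sl12_inj x y : (forall c, (c < d)%N -> sl12 x c = sl12 y c) -> x = y.
Proof. by move=> xy; apply: get3_inj => a b c ad bd cd; rewrite /get3 xy. Qed.

Lemma sl23_inj x y : (forall a, (a < d)%N -> sl23 x a = sl23 y a) -> x = y.
Proof.
by move=> xy; apply: get3_inj => a b c ad bd cd; rewrite -!get2_sl23 xy.
Qed.

Definition mk12 (f : nat -> 'cV[K]_(d * d)) : vT :=
  \col_n f (mxtens_unindex n).2 (mxtens_unindex n).1 0.

Definition mk23 (f : nat -> 'cV[K]_(d * d)) : vT :=
  mk12 (fun c => mk2 d (fun a b => get2 (f a) b c)).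

Lemma sl12_mk12 f c : (c < d)%N -> sl12 (mk12 f) c = f c.
Proof.
by move=> cd; apply/colP => k; rewrite !mxE (extE _ cd) !mxE mxtens_indexK.
Qed.

Lemma sl23_mk23 f a : (a < d)%N -> sl23 (mk23 f) a = f a.
Proof.
move=> ad; apply: get2_inj => b c bd cd.
by rewrite get2_sl23 /get3 sl12_mk12 // get2_mk2.
Qed.

End Cube.

Section StandardCube.
Variables (K F : fieldType) (q : K) (res : K -> F -> Prop).
Hypothesis rP : residue q res.
Variable l : nat.
Local Notation d := l.+1.
Local Notation V := (V0 rP l).
Local Notation V2 := (V2 rP l).
Local Notation vT := 'cV[K]_(d * d * d).
Local Notation phi := (phi q l).

Let q0 : q != 0 := q_unit rP.
Let qzD (a b : int) : q ^ (a + b) = q ^ a * q ^ b. Proof. exact: expfzDr. Qed.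

Definition V3 : uqmod q := tensU V2 V.

Definition wt3 (k : 'I_(d * d * d)) : nat :=
  (wt2 (mxtens_unindex k).1 + (mxtens_unindex k).2)%N.

Lemma V3_weighted : @weighted _ _ V3 wt3 (l + l + l).
Proof. exact: (tensU_weighted q0 (V2_weighted rP l) (V0_weighted rP l)). Qed.

Local Notation wsp3 := (@wsp K q V3 wt3).

Lemma wsp3P m (x : vT) :
  reflect (forall a b c, (a < d)%N -> (b < d)%N -> (c < d)%N ->
             (a + b + c)%N != m -> get3 x a b c = 0)
    (x \in wsp3 m).
Proof.
apply: (iffP (wspP _ _ _)) => [x0 a b c ad bd cd abm|x0 n].
  have := get3_ord x (Ordinal ad) (Ordinal bd) (Ordinal cd); rewrite /= => ->.
  by apply: x0; rewrite /wt3 mxtens_indexK /wt2 mxtens_indexK.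
case: (mxtens_indexP n) => n' k; case: (mxtens_indexP n') => i j.
rewrite /wt3 mxtens_indexK /wt2 mxtens_indexK /= => ijm.
by rewrite -get3_ord x0.
Qed.

Lemma sl12_tens (A : 'M[K]_(d * d)) (B : 'M[K]_d) (x : vT) (c : 'I_d) :
  sl12 ((A *t B) *m x) c = A *m (\col_k \sum_c' B c c' * x (mxtens_index (k, c')) 0).
Proof.
apply/colP => k; rewrite !mxE ext_ord tens_mulmxE.
by apply: eq_bigr => k' _; rewrite mxE.
Qed.

Lemma get2_K la (x : 'cV_(d * d)) a b : (a < d)%N -> (b < d)%N ->
  get2 (actK V2 la *m x) a b
  = q ^ wprod la (l%:Z + l%:Z - a%:Z - b%:Z, a%:Z + b%:Z) * get2 x a b.
Proof.
move=> ad bd; rewrite -[a]/(nat_of_ord (Ordinal ad)) -[b]/(nat_of_ord (Ordinal bd)).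
rewrite !get2_ord (wtK (V2_weighted rP l)) mul_diag_mx !mxE /wt2 mxtens_indexK /=.
by congr (q ^ wprod la (_, _) * _); rewrite !PoszD; ring.
Qed.

Lemma sl12_E (x : vT) c : (c < d)%N ->
  sl12 (actE V3 *m x) c = actE V2 *m sl12 x c + actK V2 alpha *m sl12 x c.+1.
Proof.
move=> cd; rewrite -[c]/(nat_of_ord (Ordinal cd)).
rewrite [actE V3]/(DeltaE V2 V) /DeltaE mulmxDl sl12D !sl12_tens.
congr (_ + _); congr (_ *m _); apply/colP => k; rewrite !mxE ?ext_ord.
  by rewrite sum_1_mx.
by rewrite Emx_row.
Qed.

Lemma sl12_F (x : vT) c : (c < d)%N ->
  sl12 (actF V3 *m x) c
  = q ^ (c%:Z + c%:Z - l%:Z) *: (actF V2 *m sl12 x c) + phi c *: sl12 x c.-1.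
Proof.
move=> cd; rewrite -[c]/(nat_of_ord (Ordinal cd)).
rewrite [actF V3]/(DeltaF V2 V) /DeltaF mulmxDl sl12D !sl12_tens mul1mx.
rewrite scalemxAr; congr (_ + _); last first.
  by apply/colP => k; rewrite !mxE Fmx_row.
congr (_ *m _); apply/colP => k; rewrite !mxE sum_diag_mx mxE ext_ord.
by congr (q ^ _ * _); rewrite /wprod /=; lia.
Qed.

Lemma get3_E (x : vT) a b c : (a < d)%N -> (b < d)%N -> (c < d)%N ->
  get3 (actE V3 *m x) a b c
  = get3 x a.+1 b c + q ^ (l%:Z - a%:Z - a%:Z) * get3 x a b.+1 c
    + q ^ (l%:Z + l%:Z - a%:Z - a%:Z - b%:Z - b%:Z) * get3 x a b c.+1.
Proof.
move=> ad bd cd; rewrite /get3 sl12_E // get2D get2_E // get2_K //.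
by congr (_ + q ^ _ * _); rewrite /wprod /=; ring.
Qed.

Lemma get3_F (x : vT) a b c : (a < d)%N -> (b < d)%N -> (c < d)%N ->
  get3 (actF V3 *m x) a b c
  = phi a * q ^ (b%:Z + b%:Z - l%:Z + (c%:Z + c%:Z - l%:Z)) * get3 x a.-1 b c
    + phi b * q ^ (c%:Z + c%:Z - l%:Z) * get3 x a b.-1 c
    + phi c * get3 x a b c.-1.
Proof.
move=> ad bd cd; rewrite /get3 sl12_F // get2D !get2Z get2_F // [q ^ (_ + (_ + _ - _))]qzD.
by ring.
Qed.

Lemma sl23_E (x : vT) a : (a < d)%N ->
  sl23 (actE V3 *m x) a
  = sl23 x a.+1 + q ^ (l%:Z - a%:Z - a%:Z) *: (actE V2 *m sl23 x a).
Proof.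
move=> ad; apply: (@get2_inj _ d) => b c bd cd.
rewrite get2D get2Z get2_E // !get2_sl23 get3_E // mulrDr addrA mulrA -qzD.
by congr (_ + q ^ _ * _); ring.
Qed.

Lemma sl23_F (x : vT) a : (a < d)%N ->
  sl23 (actF V3 *m x) a
  = phi a *: (actK V2 (- alpha) *m sl23 x a.-1) + actF V2 *m sl23 x a.
Proof.
move=> ad; apply: (@get2_inj _ d) => b c bd cd.
rewrite get2D get2Z get2_K // get2_F // !get2_sl23 get3_F // -addrA mulrA.
congr (_ * q ^ _ * _ + _).
by rewrite /wprod /=; ring.
Qed.

End StandardCube.

Section HighestWeight.
Variables (K F : fieldType) (q : K) (res : K -> F -> Prop).
Hypothesis rP : residue q res.
Variable l : nat.
Local Notation d := l.+1.
Local Notation V2 := (V2 rP l).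
Local Notation V3 := (V3 rP l).
Local Notation vT := 'cV[K]_(d * d * d).
Local Notation phi := (phi q l).
Local Notation gint := (gint q).
Local Notation wsp3 := (@wsp K q V3 (@wt3 l)).
Variable P : 'M[K]_(d * d).
Hypothesis bP : braid_op rP P.
Local Notation Sg := (sgn_span q P).

Let q0 : q != 0 := q_unit rP.
Let qzD (a b : int) : q ^ (a + b) = q ^ a * q ^ b. Proof. exact: expfzDr. Qed.
Let qz0 (a : int) : q ^ a != 0. Proof. exact: expfz_neq0. Qed.

(** Membership in [Sg s] tensored with the third factor, tested slice by slice; slices outside the
    range are 0 and impose nothing. *)
Definition L12 (s : bool) (x : vT) : Prop := forall c, sl12 x c \in Sg s.
Definition L23 (s : bool) (x : vT) : Prop := forall a, sl23 x a \in Sg s.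

Lemma L12_E s x : L12 s x -> L12 s (actE V3 *m x).
Proof.
move=> xs c; have [cd|dc] := ltnP c d; last by rewrite sl12_out ?mem0v.
by rewrite sl12_E // memvD ?(sgn_E bP) ?(sgn_K bP).
Qed.

Lemma L12_F s x : L12 s x -> L12 s (actF V3 *m x).
Proof.
move=> xs c; have [cd|dc] := ltnP c d; last by rewrite sl12_out ?mem0v.
by rewrite sl12_F // memvD // memvZ // (sgn_F bP).
Qed.

Lemma L23_E s x : L23 s x -> L23 s (actE V3 *m x).
Proof.
move=> xs a; have [ad|da] := ltnP a d; last by rewrite sl23_out ?mem0v.
by rewrite sl23_E // memvD // memvZ // (sgn_E bP).
Qed.

Lemma L23_F s x : L23 s x -> L23 s (actF V3 *m x).
Proof.
move=> xs a; have [ad|da] := ltnP a d; last by rewrite sl23_out ?mem0v.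
by rewrite sl23_F // memvD // ?memvZ ?(sgn_F bP) ?(sgn_K bP).
Qed.

Lemma get2_wproj m (y : 'cV_(d * d)) a b :
  get2 (wproj (M := V2) (@wt2 l) m *m y) a b = (a + b == m)%N%:R * get2 y a b.
Proof.
have [ad|da] := ltnP a d; last by rewrite !get2_outl // mulr0.
have [bd|db] := ltnP b d; last by rewrite !get2_outr // mulr0.
rewrite -[a]/(nat_of_ord (Ordinal ad)) -[b]/(nat_of_ord (Ordinal bd)).
by rewrite !get2_ord (@wprojE _ _ V2) /wt2 mxtens_indexK.
Qed.

Lemma get3_wproj m (x : vT) a b c :
  get3 (wproj (M := V3) (@wt3 l) m *m x) a b c = (a + b + c == m)%N%:R * get3 x a b c.
Proof.
have [ad|da] := ltnP a d; last by rewrite !get3_outl // mulr0.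
have [bd|db] := ltnP b d; last by rewrite !get3_outm // mulr0.
have [cd|dc] := ltnP c d; last by rewrite !get3_outr // mulr0.
rewrite -[a]/(nat_of_ord (Ordinal ad)) -[b]/(nat_of_ord (Ordinal bd)) -[c]/(nat_of_ord (Ordinal cd)).
by rewrite !get3_ord (@wprojE _ _ V3) /wt3 mxtens_indexK /wt2 mxtens_indexK.
Qed.

Lemma L12_wproj m s x : L12 s x -> L12 s (wproj (M := V3) (@wt3 l) m *m x).
Proof.
move=> xs c; have [cm|mc] := leqP c m.
  suff -> : sl12 (wproj (M := V3) (@wt3 l) m *m x) c
      = wproj (M := V2) (@wt2 l) (m - c) *m sl12 x c by exact: (sgn_wproj bP).
  apply: (@get2_inj _ d) => a b ad bd.
  rewrite get2_wproj -[LHS]/(get3 _ a b c) get3_wproj.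
  by congr (_%:R * _); congr (nat_of_bool _); lia.
rewrite (_ : sl12 _ _ = 0) ?mem0v //; apply: (@get2_inj _ d) => a b ad bd.
rewrite -[LHS]/(get3 _ a b c) get3_wproj get20 (_ : (a + b + c == m)%N = false) ?mul0r //.
by lia.
Qed.

Lemma L23_wproj m s x : L23 s x -> L23 s (wproj (M := V3) (@wt3 l) m *m x).
Proof.
move=> xs a; have [am|ma] := leqP a m.
  suff -> : sl23 (wproj (M := V3) (@wt3 l) m *m x) a
      = wproj (M := V2) (@wt2 l) (m - a) *m sl23 x a by exact: (sgn_wproj bP).
  apply: (@get2_inj _ d) => b c bd cd.
  rewrite get2_wproj !get2_sl23 get3_wproj.
  by congr (_%:R * _); congr (nat_of_bool _); lia.
rewrite (_ : sl23 _ _ = 0) ?mem0v //; apply: (@get2_inj _ d) => b c bd cd.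
rewrite get2_sl23 get3_wproj get20 (_ : (a + b + c == m)%N = false) ?mul0r //.
by lia.
Qed.

Lemma L12_decomp x : exists u : bool -> vT, (forall s, L12 s (u s)) /\ x = u false + u true.
Proof.
have /boolp.choice[u uP] c := sgn_decomp bP (sl12 x c).
exists (fun s => mk12 (fun c => u c s)); split=> [s c|].
  have [cd|dc] := ltnP c d; last by rewrite sl12_out ?mem0v.
  by rewrite sl12_mk12 //; case: (uP c).
by apply: sl12_inj => c cd; rewrite sl12D !sl12_mk12 //; case: (uP c).
Qed.

Lemma L23_decomp x : exists u : bool -> vT, (forall s, L23 s (u s)) /\ x = u false + u true.
Proof.
have /boolp.choice[u uP] a := sgn_decomp bP (sl23 x a).
exists (fun s => mk23 (fun a => u a s)); split=> [s a|].
  have [ad|da] := ltnP a d; last by rewrite sl23_out ?mem0v.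
  by rewrite sl23_mk23 //; case: (uP a).
apply: sl23_inj => a ad; rewrite -[u' in sl23 (u' + _)]scale1r sl23_lin scale1r.
by rewrite !sl23_mk23 //; case: (uP a).
Qed.

Lemma L12_cap s x : L12 s x -> L12 (~~ s) x -> x = 0.
Proof.
move=> xs xs'; apply: sl12_inj => c _.
by rewrite (sgn_cap_eq0 bP (xs c) (xs' c)) sl12_0.
Qed.

Lemma L23_cap s x : L23 s x -> L23 (~~ s) x -> x = 0.
Proof.
move=> xs xs'; apply: get3_inj => a b c _ _ _.
by rewrite -get2_sl23 (sgn_cap_eq0 bP (xs a) (xs' a)) get20 get30.
Qed.

Definition hw3 m (x : vT) : Prop := x \in wsp3 m /\ actE V3 *m x = 0.

(** * Highest weight vectors of degree [m <= l] *)

Section CaseI.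
Variable m : nat.
Hypothesis ml : (m <= l)%N.

Definition f1_I j (x : vT) : K := \sum_(a < j.+1) eco q l j a * get3 x a (j - a) (m - j).

Definition f2_I i (x : vT) : K :=
  \sum_(b < (m - i).+1) eco q l (m - i) b * get3 x i b (m - i - b).

Lemma f1_I_L12 s j x : (j <= m)%N -> odd j != s -> L12 s x -> f1_I j x = 0.
Proof. by move=> jm js xs; apply: (sgn_ev bP _ js (xs _)); lia. Qed.

Lemma f2_I_L23 s i x : (i <= m)%N -> odd (m - i) != s -> L23 s x -> f2_I i x = 0.
Proof.
move=> im js xs; have kl : (m - i <= l)%N by lia.
rewrite -[RHS](sgn_ev bP kl js (xs i)); apply: eq_bigr => b _.
by rewrite get2_sl23.
Qed.

Lemma hw_rel_get3 x : hw3 m x -> hw_rel q l m (get3 x).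
Proof.
move=> [_ Ex] a b c abc; rewrite -(get3_E rP) ?Ex; [|lia..].
exact: get30.
Qed.

(** [J] and [C] are the indices at which the two families of functionals are known to vanish; they
    are left free, since the counting argument makes several choices. As [m <= l], all triples of
    sum [m] lie in the cube, so the recursion holds without truncation. *)
Lemma vanish_I (J C : pred nat) x : hw3 m x ->
  (forall j, (j <= m)%N -> J j -> f1_I j x = 0) ->
  (forall i, (i <= m)%N -> C i -> f2_I i x = 0) ->
  (forall i, (i <= m)%N -> [|| C i, J i | [&& (i < m)%N, J i.+1 & C i.+1]]) ->
  x = 0.
Proof.
move=> hx xJ xC cond; have HX := hw_rel_get3 hx.
suff z0 : forall i, (i <= m)%N -> zcoord q l m (get3 x) i 0 = 0.
  apply: get3_inj => a b c ad bd cd; rewrite [RHS]get30.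
  have [abc|abc] := eqVneq (a + b + c)%N m; last by move/wsp3P: hx.1; apply.
  exact: (zcoord_eq0 rP ml HX z0 abc).
apply: (normalized_eq0 rP) => u c u0 uc.
have HuX := hw_relZ u HX.
have zc i : (i <= m)%N -> res (zcoord q l m (fun a b c => u * get3 x a b c) i 0) (c i).
  by move=> im; rewrite zcoordZ; exact: uc.
apply: (residue_system_eq0 (J := J) (C := C)) cond => [j jm Jj|i im Ci].
  apply: (first_residue rP ml HuX zc jm).
  by under eq_bigr => a _ do rewrite mulrCA; rewrite -mulr_sumr -/(f1_I j x) xJ ?mulr0.
rewrite -(subKn im); apply: (second_residue rP ml HuX zc (leq_subr i m)).
rewrite subKn //.
by under eq_bigr => a _ do rewrite mulrCA; rewrite -mulr_sumr -/(f2_I i x) xC ?mulr0.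
Qed.

End CaseI.

(** * Highest weight vectors of degree [m = l + s0], whose weight is [w = 3l - 2m] *)

Section CaseII.
Variables w s0 : nat.
Hypothesis lE : l = (w + 2 * s0)%N.
Local Notation m := (l + s0)%N.
Local Notation m' := (w + s0)%N.

Let sl2 := weighted_sl2 rP (V3_weighted rP l).

Definition Xs (x : vT) (s : nat) : vT := iter s (opF V3) x.

Lemma XsS x s : Xs x s.+1 = actF V3 *m Xs x s.
Proof. by rewrite /Xs iterS lfunE. Qed.

Lemma Xs_lin u x y s : Xs (u *: x + y) s = u *: Xs x s + Xs y s.
Proof. by elim: s => // s IH; rewrite !XsS IH mulmxDr scalemxAr. Qed.

Lemma L12_Xs s n x : L12 s x -> L12 s (Xs x n).
Proof. by move=> xs; elim: n => // n IH; rewrite XsS; exact: L12_F. Qed.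

Lemma L23_Xs s n x : L23 s x -> L23 s (Xs x n).
Proof. by move=> xs; elim: n => // n IH; rewrite XsS; exact: L23_F. Qed.

Lemma sum_brII s : (s <= w)%N ->
  \sum_(i < s.+1) br q (l + l + l) (m + i) = q ^ (1 - w%:Z) * gint s.+1 * gint (w - s).
Proof.
move=> sw; rewrite (sum_br rP) !(gintE rP).
have -> : (l + l + l)%N%:Z - m%:Z - m%:Z - s.+1%:Z + 1 = (w - s)%N%:Z by lia.
have -> : m%:Z + m%:Z + s.+1%:Z - (l + l + l)%N%:Z - 1 = - (w - s)%N%:Z by lia.
have -> : 1 - w%:Z = 1 - (w - s)%N%:Z - s%:Z by lia.
move: (w - s)%N => b; rewrite !exprS intS.
have qN1 : q ^ (1 : int) = q by [].
rewrite !(opprD, opprK, qzD, addrA) -!invr_expz qN1 -!exprnP.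
move: (expf_neq0 s q0) (expf_neq0 b q0) (q2_neq1 rP).
set A := q ^+ s; set B := q ^+ b => A0 B0 q21.
have q21' : q * q - 1 != 0 by rewrite -expr2.
by field; rewrite q0 A0 B0 q21'.
Qed.

(** This vector is again annihilated by [E], its scalar containing [gint 0], and it has negative
    weight. *)
Lemma Xs_last x : hw3 m x -> Xs x w.+1 = 0.
Proof.
move=> [xm Ex]; apply: (sl2_hw_neg sl2 (m := m + w.+1)); first by lia.
  exact: iterF_T sl2 _ _ _ xm.
rewrite (sl2_EFk sl2 w xm); last by rewrite lfunE.
by rewrite sum_brII // subnn gint0 mulr0 scale0r.
Qed.

Lemma Xs_E0 x : hw3 m x -> actE V3 *m Xs x 0 = 0.
Proof. by case. Qed.

Lemma Xs_ES x s : hw3 m x -> (s <= w)%N ->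
  actE V3 *m Xs x s.+1 = (q ^ (1 - w%:Z) * gint s.+1 * gint (w - s)) *: Xs x s.
Proof.
move=> [xm Ex] sw; have := sl2_EFk sl2 s xm; rewrite sum_brII // !lfunE /= => <- //.
Qed.

(* The normalization turning the components of the F^s x with extreme first
   index into an array satisfying the relations of a highest weight vector. *)
Definition gam (s : nat) : K := \prod_(i < s) (gint i.+1 * gint (w - i)).

Definition gII (s : nat) : K :=
  (-1) ^+ s * q ^ (s%:Z * (4 * s0%:Z - 2 * l%:Z) + s%:Z * s%:Z) * gam s.

Lemma res_gam s : (s <= w)%N -> res (gam s) 1.
Proof.
move=> sw; apply: (res_prod1 rP) => i _; have := ltn_ord i => si.
by rewrite -[X in res _ X]mulr1; apply: (resM rP); apply: (res_gint rP); lia.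
Qed.

Lemma gII_neq0 s : (s <= w)%N -> gII s != 0.
Proof.
move=> sw; rewrite !mulf_neq0 ?signr_eq0 //.
exact: (res_eq0 rP (res_gam sw) (oner_neq0 F)).
Qed.

Lemma gIIS s : gII s.+1 = - (q ^ (4 * s0%:Z - 2 * l%:Z + 2 * s%:Z + 1)
  * (gint s.+1 * gint (w - s)) * gII s).
Proof.
rewrite /gII /gam big_ord_recr /= exprS.
have -> : s.+1%:Z * (4 * s0%:Z - 2 * l%:Z) + s.+1%:Z * s.+1%:Z
    = (4 * s0%:Z - 2 * l%:Z + 2 * s%:Z + 1) + (s%:Z * (4 * s0%:Z - 2 * l%:Z) + s%:Z * s%:Z).
  by rewrite intS; ring.
by rewrite qzD; ring.
Qed.

(** [F^s x] has degree [l + s0 + s], so first index [l] leaves [i + b = s0 + s]. With [n = w - s]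
    these entries fill a triangle [i + b + n = m'], like those of a highest weight vector of degree
    [m' <= l]; the part [n > w] is filled with 0. *)
Definition YII (x : vT) (i b n : nat) : K :=
  if (n <= w)%N then get3 (Xs x (w - n)) l i b / gII (w - n) else 0.

(** At first index [l] the summand of [E] with first index [l + 1] is 0. As [E F^(s+1) x] is a
    multiple of [F^s x], this relates two entries of [F^(s+1) x] to one of [F^s x], and the factors
    [gII] adjust the coefficients. *)
Lemma hw_rel_YII x : hw3 m x -> hw_rel q l m' (YII x).
Proof.
move=> hx a b n abn; rewrite /YII.
have [nw|wn] := leqP n w; last first.
  by rewrite (_ : (n < w)%N = false) ?mulr0 ?addr0 //; lia.
have ad : (a < d)%N by lia.
have bd : (b < d)%N by lia.
have rel := get3_E rP (Xs x (w - n)) (ltnSn l) ad bd.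
rewrite (get3_outl _ _ _ (leqnn d)) add0r in rel.
have [nw'|wn] := ltnP n w; last first.
  (* At [n = w] the power of [F] is 0: the relation is [E x = 0], and the third term is the default
     value 0. *)
  have nE : n = w by apply/eqP; rewrite eqn_leq nw.
  move: rel; rewrite nE subnn (Xs_E0 hx) get30 mulr0 addr0 => rel.
  rewrite mulrA -mulrDl.
  apply/eqP; rewrite mulf_eq0; apply/orP; left; apply/eqP.
  apply: (mulfI (qz0 (l%:Z - l%:Z - l%:Z))); rewrite mulr0 rel mulrDr mulrA -qzD.
  by congr (_ + q ^ _ * _); ring.
have [s sE] : exists s, (w - n)%N = s.+1 by exists (w - n).-1; lia.
have sw : (s <= w)%N by lia.
have -> : (w - n.+1)%N = s by lia.
move: rel; rewrite sE (Xs_ES hx sw) get3Z => rel.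
set X1 := get3 _ l a.+1 b in rel *; set X2 := get3 _ l a b.+1 in rel *.
set X3 := get3 _ l a b in rel *; rewrite gIIS.
have gN : gint s.+1 * gint (w - s) != 0.
  by rewrite mulf_neq0 //; apply: (gint_neq0 rP); lia.
have X1E : X1 = q ^ (l%:Z + (1 - w%:Z)) * (gint s.+1 * gint (w - s)) * X3
    - q ^ (l%:Z - a%:Z - a%:Z) * X2.
  apply: (mulfI (qz0 (l%:Z - l%:Z - l%:Z))); rewrite mulrBr !mulrA -!qzD.
  apply/eqP; rewrite eq_sym subr_eq; apply/eqP.
  transitivity (q ^ (1 - w%:Z) * gint s.+1 * gint (w - s) * X3).
    by congr (q ^ _ * _ * _ * _); ring.
  by rewrite rel; congr (_ + q ^ _ * _); ring.
rewrite X1E.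
have -> : l%:Z + l%:Z - a%:Z - a%:Z - b%:Z - b%:Z
    = (l%:Z + (1 - w%:Z)) - (4 * s0%:Z - 2 * l%:Z + 2 * s%:Z + 1) by lia.
rewrite [q ^ (l%:Z + (1 - w%:Z) - _)]qzD -[q ^ (- _)]invr_expz.
move: (qz0 (l%:Z + (1 - w%:Z))) (qz0 (4 * s0%:Z - 2 * l%:Z + 2 * s%:Z + 1)) (gII_neq0 sw) gN.
set A := q ^ _; set B := q ^ _; set G := gint s.+1 * gint (w - s) => A0 B0 g0 G0.
by field; rewrite (negPf g0) (negPf B0) oppr_eq0 mulf_neq0 // mulf_neq0.
Qed.

Definition f1_II j (x : vT) : K :=
  \sum_(a < j.+1) eco q l j a * get3 (Xs x (j - s0)) l a (j - a).

(** At third index 0 the first two factors have degree [l + i], where the functional is [bv] with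
    [k = l - i]. *)
Definition f2_II i (x : vT) : K :=
  \sum_(n < (l - i).+1) bco q l n * get3 (Xs x (i - s0)) (l - n) (i + n) 0.

Lemma f1_II_L23 s j x : (j <= l)%N -> odd j != s -> L23 s x -> f1_II j x = 0.
Proof.
move=> jl js xs; rewrite -[RHS](sgn_ev bP jl js (L23_Xs (j - s0) xs l)).
by apply: eq_bigr => b _; rewrite get2_sl23.
Qed.

Lemma f2_II_L12 s i x : (i <= l)%N -> odd (l - i) != s -> L12 s x -> f2_II i x = 0.
Proof.
move=> il js xs; rewrite -[RHS](sgn_bv bP (leq_subr i l) js (L12_Xs (i - s0) xs 0%N)).
by apply: eq_bigr => n _; rewrite subKn.
Qed.

Section Second.
Variables (x : vT) (hx : hw3 m x) (c : nat -> F) (u : K).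
Let Y := fun a b n => u * YII x a b n.
Let z := zcoord q l m' Y.
Hypothesis zc : forall i, (i <= m')%N -> res (z i 0) (c i).

(** The entries met by [f2_II]. Only those with [n = 0] belong to the triangle [YII], on its edge;
    the others are reached through the action of [F]. *)
Let U n s : K := u * get3 (Xs x s) (l - n) (s0 + s + n) 0.

Let NII (n s : nat) : int := n%:Z * (l%:Z - 2 * s0%:Z - 2 * s%:Z) - n%:Z * (n%:Z + 1)
  + (s%:Z * (4 * s0%:Z - 2 * l%:Z) + s%:Z * s%:Z
     + 2 * (s0%:Z + s%:Z) * (l%:Z + 1) - 2 * (s0%:Z + s%:Z) * (s0%:Z + s%:Z)).

Let Ut n s : K := (-1) ^+ (n + s) * q ^ (- NII n s) * U n s.

Lemma Ut0 s : (s <= w)%N -> Ut 0 s = gam s * z (s0 + s) 0.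
Proof.
move=> sw; rewrite /Ut /U /z /zcoord /Y /YII !subn0 addn0 add0n expr0 mul1r.
rewrite (_ : m' - (s0 + s) <= w)%N; last by lia.
rewrite (_ : w - (m' - (s0 + s)) = s)%N; last by lia.
set y := get3 _ _ _ _; rewrite -[y in LHS](divfK (gII_neq0 sw)).
set y' := y / _; rewrite /gII.
have -> : - zexp l (s0 + s) 0
    = - NII 0 s + (s%:Z * (4 * s0%:Z - 2 * l%:Z) + s%:Z * s%:Z).
  by rewrite /zexp /NII PoszD; ring.
rewrite qzD; have -> : forall e a b v k : K,
    e * a * (v * (y' * (e * b * k))) = e ^+ 2 * (k * (a * b * (v * y'))) by move=> *; ring.
by rewrite sqrr_sign mul1r !qzD.
Qed.

(** The formula for [F] at third index 0, where its last term drops out. The exponent [NII] is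
    chosen so that [Ut n s] has no power of [q] in front and [Ut n s.+1] has a positive one. *)
Lemma UtS n s : (n.+1 + s <= m')%N ->
  gint (l - n) * gint n.+1 * Ut n.+1 s
  = gint (s0 + s + n.+1) * gint (d - (s0 + s + n.+1)) * Ut n s
    + q ^ (2 * (l%:Z - n%:Z - s%:Z)) * Ut n s.+1.
Proof.
move=> nsm; set b := (s0 + s + n.+1)%N.
have ad : (l - n < d)%N by lia.
have bd : (b < d)%N by rewrite /b; lia.
have := get3_F rP (Xs x s) ad bd (ltn0Sn l).
rewrite -XsS /= phi0 mul0r addr0 => rel.
have relU : U n s.+1 = phi (l - n) * q ^ (b%:Z + b%:Z - l%:Z + (0%:Z + 0%:Z - l%:Z)) * U n.+1 s
    + phi b * q ^ (0%:Z + 0%:Z - l%:Z) * U n s.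
  rewrite /U (_ : (s0 + s.+1 + n)%N = b); last by rewrite /b; lia.
  rewrite rel (_ : (l - n).-1 = (l - n.+1)%N); last by lia.
  rewrite (_ : b.-1 = (s0 + s + n)%N); last by rewrite /b; lia.
  by ring.
rewrite /Ut relU /phi (_ : (d - (l - n))%N = n.+1); last by lia.
have -> : - NII n s.+1 = - NII n s - (1 - 2 * s%:Z - 2 * n%:Z).
  by rewrite /NII intS; ring.
have -> : - NII n.+1 s = - NII n s - (l%:Z - 2 * (s0%:Z + s%:Z + n%:Z + 1)).
  by rewrite /NII intS; ring.
rewrite addnS addSn exprS.
have bZ : b%:Z = s0%:Z + s%:Z + n%:Z + 1 by rewrite /b; lia.
rewrite bZ; set N := - NII n s; set e := (-1) ^+ (n + s).
set A := gint (l - n); set B := gint n.+1; set C := gint b; set D := gint (d - b).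
set U1 := U n.+1 s; set U0 := U n s.
have -> : q ^ (2 * (l%:Z - n%:Z - s%:Z)) * (-1 * e * q ^ (N - (1 - 2 * s%:Z - 2 * n%:Z))
      * (q ^ (1 - l%:Z) * A * B
           * q ^ (s0%:Z + s%:Z + n%:Z + 1 + (s0%:Z + s%:Z + n%:Z + 1) - l%:Z + (0%:Z + 0%:Z - l%:Z)) * U1
         + q ^ (1 - l%:Z) * C * D * q ^ (0%:Z + 0%:Z - l%:Z) * U0))
    = - (e * A * B * (q ^ (2 * (l%:Z - n%:Z - s%:Z)) * q ^ (N - (1 - 2 * s%:Z - 2 * n%:Z)) * q ^ (1 - l%:Z)
        * q ^ (s0%:Z + s%:Z + n%:Z + 1 + (s0%:Z + s%:Z + n%:Z + 1) - l%:Z + (0%:Z + 0%:Z - l%:Z))) * U1)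
      - e * C * D * (q ^ (2 * (l%:Z - n%:Z - s%:Z)) * q ^ (N - (1 - 2 * s%:Z - 2 * n%:Z)) * q ^ (1 - l%:Z)
        * q ^ (0%:Z + 0%:Z - l%:Z)) * U0 by ring.
rewrite -!qzD.
have -> : 2 * (l%:Z - n%:Z - s%:Z) + (N - (1 - 2 * s%:Z - 2 * n%:Z)) + (1 - l%:Z)
    + (s0%:Z + s%:Z + n%:Z + 1 + (s0%:Z + s%:Z + n%:Z + 1) - l%:Z + (0%:Z + 0%:Z - l%:Z))
    = N - (l%:Z - 2 * (s0%:Z + s%:Z + n%:Z + 1)) by ring.
have -> : 2 * (l%:Z - n%:Z - s%:Z) + (N - (1 - 2 * s%:Z - 2 * n%:Z)) + (1 - l%:Z)
    + (0%:Z + 0%:Z - l%:Z) = N by ring.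
by ring.
Qed.

Lemma Xs_gt s : (w < s)%N -> Xs x s = 0.
Proof.
move=> ws; rewrite -(subnKC ws) addnC /Xs iterD -/(Xs x w.+1) Xs_last //.
by elim: (s - w.+1)%N => //= n ->; rewrite linear0.
Qed.

(** By [UtS] the residue does not depend on [n], since the q-integers involved have residue 1; at
    [n = 0] it comes from the edge. The value 0 belongs to [s > w], where [F^s x = 0]. *)
Lemma res_Ut n : forall s, (n + s <= m')%N ->
  res (Ut n s) (if (s0 + s <= m')%N then c (s0 + s)%N else 0).
Proof.
elim: n => [|n IH] s nsm.
  have [sw|ws] := leqP s w; last first.
    rewrite (_ : (s0 + s <= m')%N = false); last by lia.
    by rewrite /Ut /U Xs_gt // get30 !mulr0; exact: (res0 rP).
  rewrite (_ : (s0 + s <= m')%N); last by lia.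
  rewrite Ut0 // -[c _]mul1r; apply: (resM rP); first exact: res_gam.
  by apply: zc; lia.
have gN : gint (l - n) * gint n.+1 != 0.
  by rewrite mulf_neq0 //; apply: (gint_neq0 rP); lia.
have -> : Ut n.+1 s = (gint (l - n) * gint n.+1)^-1 *
    (gint (s0 + s + n.+1) * gint (d - (s0 + s + n.+1)) * Ut n s
     + q ^ (2 * (l%:Z - n%:Z - s%:Z)) * Ut n s.+1).
  by rewrite -UtS // mulKf.
set v := if _ then _ else _.
have gM a b : (0 < a)%N -> (0 < b)%N -> res (gint a * gint b) 1.
  move=> a0 b0; rewrite -[X in res _ X]mulr1.
  by apply: (resM rP); apply: (res_gint rP).
rewrite -[v]mul1r -[X in res _ (X * _)]invr1; apply: (resM rP).
  by apply: (resV rP); [exact: oner_neq0|apply: gM; lia].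
rewrite -[v]addr0; apply: (resD rP).
  rewrite -[v]mul1r; apply: (resM rP); first by apply: gM; lia.
  by apply: IH; lia.
have := IH s.+1; set v' := (if _ then _ else _); move=> rv.
rewrite -(mul0r v'); apply: (resM rP); last by apply: rv; lia.
rewrite (_ : 0 = (2 * (l%:Z - n%:Z - s%:Z) == 0)%:R); last first.
  by rewrite (_ : (_ == 0) = false) //; lia.
by apply: (resqz rP); lia.
Qed.

(** In terms of [Ut], the term of index [n] carries [q^(-2n(1 + i))] up to a common factor, so the
    last one, [n = k], is leading; the sum is therefore read backwards. *)
Lemma second_residue_II i : (s0 <= i <= m')%N -> f2_II i x = 0 -> c i = 0.
Proof.
move=> /andP[s0i im] sum0; pose s := (i - s0)%N; pose k := (l - i)%N.
have kl : (k <= l)%N by rewrite leq_subr.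
have iE : i = (s0 + s)%N by rewrite subnKC.
apply: (@res_weighted_sum _ _ _ _ rP k (fun a => 2 * (a * (1 + i)))%N (fun=> 1)
   (fun a => Ut (k - a) s)) => //.
- by move=> a a0; rewrite !muln_gt0 a0.
- by move=> a _; exact: (res1 rP).
- by move=> a ak; eexists; apply: res_Ut; rewrite /k /s; lia.
- have := res_Ut (n := k) (s := s); rewrite subn0 -iE im; apply.
  by rewrite /k /s; lia.
pose N0 : int := s%:Z * (4 * s0%:Z - 2 * l%:Z) + s%:Z * s%:Z
     + 2 * (s0%:Z + s%:Z) * (l%:Z + 1) - 2 * (s0%:Z + s%:Z) * (s0%:Z + s%:Z).
have un : (-1) ^+ s * q ^ (N0 - 2 * k%:Z * (1 + i%:Z)) != 0.
  by rewrite mulf_neq0 // signr_eq0.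
have {}sum0 : u * f2_II i x = 0 by rewrite sum0 mulr0.
apply: (mulfI un); rewrite mulr0 -[RHS]sum0 /f2_II -/k -/s !mulr_sumr.
rewrite (reindex_inj rev_ord_inj) /=; apply: eq_bigr => n _.
have nk : (n <= k)%N by rewrite -ltnS.
rewrite subSS subKn // mul1r.
rewrite iE [RHS]mulrCA -[u * get3 _ _ _ _]/(U n s).
have -> : U n s = (-1) ^+ (n + s) * q ^ NII n s * Ut n s.
  rewrite /Ut; have -> : forall e a b v : K, e * a * (e * b * v) = e ^+ 2 * (a * b) * v by move=> *; ring.
  by rewrite sqrr_sign -qzD subrr expr0z !mul1r.
rewrite /bco exprD; have -> : forall e f a b v : K,
   e * a * (e * f * b * v) = e ^+ 2 * (f * (a * b) * v) by move=> *; ring.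
rewrite sqrr_sign mul1r -qzD mulrA; congr (_ * _).
rewrite -[LHS]mulrA (exprnP q) -qzD; congr (_ * q ^ _).
have kn : (k - n)%N%:Z = k%:Z - n%:Z by lia.
rewrite /NII /N0 ?(PoszM, PoszD) kn.
by ring.
Qed.

End Second.

(** The formula for [F] expresses an entry of first index [a - 1] by entries of first index [a] of
    the same vector and of its image under [F], since [phi a] is nonzero; so the indices descend
    from [l]. *)
Lemma Xs_eq0 x : hw3 m x ->
  (forall s a b, (a < d)%N -> (b < d)%N -> get3 (Xs x s) l a b = 0) -> x = 0.
Proof.
move=> hx X0.
suff H n : forall s a b, (n <= l)%N -> (a < d)%N -> (b < d)%N -> get3 (Xs x s) (l - n) a b = 0.
  apply: get3_inj => a b c ad bd cd; rewrite get30 -(subKn (m := a) (n := l)) -1?ltnS //.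
  by apply: (H _ 0%N); rewrite ?leq_subr.
elim: n => [|n IH] s b c nl bd cd; first by rewrite subn0 X0.
have ad : (l - n < d)%N by lia.
have := get3_F rP (Xs x s) ad bd cd; rewrite -XsS (IH s.+1 b c) ?(ltnW nl) //.
rewrite (IH s b.-1 c) ?(IH s b c.-1); try lia.
rewrite !mulr0 !addr0 (_ : (l - n).-1 = (l - n.+1)%N); last by lia.
move/esym/eqP; rewrite mulf_eq0 => /orP[|/eqP //].
by rewrite mulf_eq0 (negPf (qz0 _)) orbF (negPf (phi_neq0 rP _)) //; lia.
Qed.

Lemma vanish_II (J C : pred nat) x : hw3 m x ->
  (forall j, (s0 <= j <= m')%N -> J j -> f1_II j x = 0) ->
  (forall i, (s0 <= i <= m')%N -> C i -> f2_II i x = 0) ->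
  (forall i, (s0 <= i <= m')%N -> [|| C i, J i | [&& (i < m')%N, J i.+1 & C i.+1]]) ->
  x = 0.
Proof.
move=> hx xJ xC cond; have HY := hw_rel_YII hx.
have ml : (m' <= l)%N by lia.
suff z0 : forall i, (i <= m')%N -> zcoord q l m' (YII x) i 0 = 0.
  apply: (Xs_eq0 hx) => s a b ad bd.
  have [sw|ws] := leqP s w; last by rewrite Xs_gt // get30.
  have [ab|ab] := eqVneq (a + b)%N (s0 + s)%N; last first.
    have /wsp3P := iterF_T sl2 s hx.1; apply => //; lia.
  have := zcoord_eq0 rP ml HY z0 (a := a) (b := b) (c := (w - s)%N).
  rewrite /YII leq_subr subKn // => /(_ _)/eqP; rewrite mulf_eq0 invr_eq0 (negPf (gII_neq0 sw)) orbF.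
  by move=> H; apply/eqP/H; lia.
apply: (normalized_eq0 rP) => u c u0 uc.
have HuY := hw_relZ u HY.
have zc i : (i <= m')%N -> res (zcoord q l m' (fun a b n => u * YII x a b n) i 0) (c i).
  by move=> im; rewrite zcoordZ; exact: uc.
apply: (residue_system_eq0 (J := fun j => (s0 <= j)%N && J j) (C := fun i => (i < s0)%N || C i))
    => [j jm /andP[s0j Jj]|i im|i im].
- apply: (first_residue rP ml HuY zc jm).
  have s0jm : (s0 <= j <= m')%N by rewrite s0j.
  transitivity (u / gII (j - s0) * f1_II j x); last by rewrite xJ // mulr0.
  rewrite mulr_sumr; apply: eq_bigr => a _; rewrite /YII.
  rewrite (_ : (m' - j <= w)%N); last by lia.
  rewrite (_ : (w - (m' - j) = j - s0)%N); last by lia.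
  by ring.
- have [is0 _|s0i /= Ci] := ltnP i s0; last first.
    by apply: (second_residue_II hx zc) => //; [rewrite s0i|apply: xC => //; rewrite s0i].
  have := zc i im; rewrite zcoordZ /zcoord /YII subn0.
  rewrite (_ : (m' - i <= w)%N = false); last by lia.
  by rewrite !mulr0 => /(res_inj rP (res0 rP)).
have [is0|s0i] := ltnP i s0; first by rewrite orTb.
rewrite orFb; have := cond i; rewrite s0i im => /(_ isT).
by case/or3P => [->|->|/and3P[-> -> ->]]; rewrite ?orbT // leqW ?orbT.
Qed.

End CaseII.

End HighestWeight.

(** * Multiplicities of highest weight vectors *)

Section Coordinates.
Variables (K : fieldType) (vT : vectType K) (N : nat) (f : vT -> 'cV[K]_N).
Hypothesis f_lin : forall a u v, f (a *: u + v) = a *: f u + f v.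

Lemma linear_hom : exists g : 'Hom(vT, 'cV[K]_N), g =1 f.
Proof.
pose fl : {linear vT -> 'cV[K]_N} :=
  HB.pack f (GRing.isLinear.Build K vT 'cV[K]_N *:%R f f_lin).
by exists (linfun fl) => u; rewrite lfunE.
Qed.

Lemma dim_by_coords (U : {vspace vT}) :
  (forall u, u \in U -> f u = 0 -> u = 0) ->
  (forall y, exists2 u, u \in U & f u = y) -> \dim U = N.
Proof.
move=> inj surj; have [g gf] := linear_hom.
rewrite -(limg_ker_dim g U).
have -> : (U :&: lker g)%VS = 0%VS.
  apply/eqP; rewrite -subv0; apply/subvP => u; rewrite memv_cap memv_ker gf memv0.
  by move=> /andP[uU /eqP /(inj _ uU) ->].
have -> : (g @: U)%VS = fullv.
  apply/eqP; rewrite eqEsubv subvf; apply/subvP => y _.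
  by have [u uU <-] := surj y; rewrite -gf memv_img.
by rewrite dimv0 dimvf /dim /= muln1.
Qed.

Lemma common_kernel (U : {vspace vT}) : (N < \dim U)%N ->
  exists2 u, u \in U & u != 0 /\ f u = 0.
Proof.
move=> NU; have [g gf] := linear_hom.
have : (U :&: lker g)%VS != 0%VS.
  rewrite -dimv_eq0; have := limg_ker_dim g U.
  have : (\dim (g @: U) <= N)%N.
    by rewrite (leq_trans (dimvS (subvf _))) // dimvf /dim /= muln1.
  by lia.
rewrite -vpick0 => u0; exists (vpick (U :&: lker g)).
  by have := memv_pick (U :&: lker g); rewrite memv_cap => /andP[].
split=> //; have := memv_pick (U :&: lker g); rewrite memv_cap memv_ker gf.
by move=> /andP[_ /eqP].
Qed.

End Coordinates.

(** * Counting equations, for both ranges of degrees at once *)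

Section Counting.
Variables (K : fieldType) (vT : vectType K) (H : {vspace vT}).
(** For [m <= l] these are [L12], [L23] with [(lo, hi, p) = (0, m, m)]; beyond [l] they are [L23],
    [L12] with [(s0, w + s0, l)]. *)
Variables (A B : bool -> vT -> Prop) (f1 f2 : nat -> vT -> K) (lo hi p : nat).
Hypothesis lohi : (lo <= hi <= p)%N.
Hypothesis f1_lin : forall j a u v, f1 j (a *: u + v) = a * f1 j u + f1 j v.
Hypothesis f2_lin : forall j a u v, f2 j (a *: u + v) = a * f2 j u + f2 j v.
Hypothesis f1A : forall s j x, (lo <= j <= hi)%N -> odd j != s -> A s x -> f1 j x = 0.
Hypothesis f2B : forall s i x, (lo <= i <= hi)%N -> odd (p - i) != s -> B s x -> f2 i x = 0.
Hypothesis vanish : forall (J C : pred nat) x, x \in H ->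
  (forall j, (lo <= j <= hi)%N -> J j -> f1 j x = 0) ->
  (forall i, (lo <= i <= hi)%N -> C i -> f2 i x = 0) ->
  (forall i, (lo <= i <= hi)%N -> [|| C i, J i | [&& (i < hi)%N, J i.+1 & C i.+1]]) ->
  x = 0.
Variables (W : {vspace vT}) (s : bool).
Hypothesis WP : forall x, x \in W <-> [/\ x \in H, A s x & B s x].

(** For [p] odd, [i] and [p - i] have opposite parities, so every index has an equation from one of
    the two families. *)
Lemma count_odd : odd p -> \dim W = 0%N.
Proof.
move=> op; apply/eqP; rewrite dimv_eq0 -subv0; apply/subvP => x /WP[xH xA xB].
rewrite memv0; apply/eqP.
apply: (vanish (J := fun j => odd j != s) (C := fun i => odd (p - i) != s) xH).
- by move=> j jI Jj; exact: f1A Jj xA.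
- by move=> i iI Ci; exact: f2B Ci xB.
move=> i iI; rewrite oddB ?op; last by lia.
by case: (odd i); case: (s).
Qed.

Section EvenParity.
Hypothesis ep : ~~ odd p.

Lemma even_parity i : (i <= hi)%N -> odd (p - i) = odd i.
Proof. by move=> ih; rewrite oddB ?(negPf ep) //; lia. Qed.

(** Both families give equations at the indices of parity different from [s]. Every other index is
    followed by such an index within the range, as [hi] is one of them. *)
Lemma count_minor : odd hi != s -> \dim W = 0%N.
Proof.
move=> hs; apply/eqP; rewrite dimv_eq0 -subv0; apply/subvP => x /WP[xH xA xB].
rewrite memv0; apply/eqP.
apply: (vanish (J := fun j => odd j != s) (C := fun i => odd i != s) xH).
- by move=> j jI Jj; exact: f1A Jj xA.
- move=> i iI Ci; apply: (f2B (s := s)) => //; rewrite even_parity //; lia.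
move=> i /andP[_ ih]; have [oi|oi] := eqVneq (odd i) s; last by [].
have ih' : (i < hi)%N by rewrite ltn_neqAle ih andbT; apply: contraNneq hs => <-; rewrite oi.
by rewrite ih' /= oi; case: (s).
Qed.

(** Only the index [hi] lacks an equation, so the functional [f2 hi] is injective on [W]. *)
Lemma count_le1 : odd hi = s -> (\dim W <= 1)%N.
Proof.
move=> hs.
have top x : x \in W -> f2 hi x = 0 -> x = 0.
  move=> /WP[xH xA xB] xh.
  apply: (vanish (J := fun j => odd j != s) (C := fun i => (odd i != s) || (i == hi)) xH).
  - by move=> j jI Jj; exact: f1A Jj xA.
  - move=> i iI /orP[Ci|/eqP -> //]; apply: (f2B (s := s)) => //.
    by rewrite even_parity //; lia.
  move=> i /andP[_ ih]; have [oi|oi] := eqVneq (odd i) s; last by [].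
  have [->|ih'] := eqVneq i hi; first by rewrite orbT.
  by rewrite (_ : (i < hi)%N) /= ?oi; [case: (s)|rewrite ltn_neqAle ih' ih].
have [->|W0] := eqVneq W 0%VS; first by rewrite dimv0.
pose x := vpick W; have xW : x \in W := memv_pick W.
have x0 : x != 0 by rewrite vpick0.
have fx : f2 hi x != 0 by apply: contra_neq x0; exact: top.
suff /dimvS : (W <= <[x]>)%VS by move=> /leq_trans -> //; rewrite dim_vline leq_b1.
apply/subvP => y yW; apply/vlineP; exists (f2 hi y / f2 hi x).
apply/eqP; rewrite -subr_eq0 -scaleNr addrC; apply/eqP/top.
  by rewrite memvD ?memvZ.
by rewrite f2_lin mulNr divfK // addNr.
Qed.

Hypothesis A_dec : forall x, x \in H -> exists u : bool -> vT,
  (forall s, u s \in H /\ A s (u s)) /\ x = u false + u true.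
Hypothesis B_dec : forall x, x \in H -> exists u : bool -> vT,
  (forall s, u s \in H /\ B s (u s)) /\ x = u false + u true.
Hypothesis dimH : (hi - lo < \dim H)%N.

(** Between two ends of parity [s] lie [n] indices of the other parity, giving [2n = hi - lo]
    equations on a space of larger dimension. A nonzero solution turns out to lie in [W]. *)
Lemma count_major : odd hi = s -> odd lo = s -> \dim W = 1%N.
Proof.
move=> hs los; apply/eqP; rewrite eqn_leq count_le1 //=.
pose n := (hi - lo)./2.
have nE : (hi - lo = n + n)%N.
  rewrite addnn -[LHS]odd_double_half oddB ?hs ?los ?addbb //; lia.
pose ff (t : nat) x := if (t < n)%N then f1 (lo + 1 + t.*2) x else f2 (lo + 1 + (t - n).*2) x.
pose f x : 'cV[K]_(n + n) := \col_t ff t x.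
have f_lin a u v : f (a *: u + v) = a *: f u + f v.
  by apply/colP => t; rewrite !mxE /ff; case: ifP; rewrite ?f1_lin ?f2_lin.
have [x xH [x0 fx]] : exists2 u, u \in H & u != 0 /\ f u = 0.
  by apply: common_kernel f_lin _ _; rewrite -nE.
have fx1 j : (lo <= j <= hi)%N -> odd j != s -> f1 j x = 0.
  move=> jI js; have [t tn jE] : exists2 t, (t < n)%N & j = (lo + 1 + t.*2)%N.
    have jlo : (lo < j)%N.
      by rewrite ltn_neqAle andbC; case/andP: jI => -> _ /=; apply: contraNneq js => <-; rewrite los.
    have oj : odd (j - lo.+1) = false.
      rewrite oddB // oddS los; move: js; case: (odd j); case: (s) => //.
    exists ((j - lo.+1)./2).
      by have := odd_double_half (j - lo.+1); rewrite oj; lia.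
    by have := odd_double_half (j - lo.+1); rewrite oj; lia.
  have tnn : (t < n + n)%N by lia.
  have := congr1 (fun y : 'cV_(n + n) => y (Ordinal tnn) 0) fx.
  by rewrite !mxE /ff /= tn -jE.
have fx2 j : (lo <= j <= hi)%N -> odd j != s -> f2 j x = 0.
  move=> jI js; have [t tn jE] : exists2 t, (t < n)%N & j = (lo + 1 + t.*2)%N.
    have jlo : (lo < j)%N.
      by rewrite ltn_neqAle andbC; case/andP: jI => -> _ /=; apply: contraNneq js => <-; rewrite los.
    have oj : odd (j - lo.+1) = false.
      rewrite oddB // oddS los; move: js; case: (odd j); case: (s) => //.
    exists ((j - lo.+1)./2).
      by have := odd_double_half (j - lo.+1); rewrite oj; lia.
    by have := odd_double_half (j - lo.+1); rewrite oj; lia.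
  have tnn : (n + t < n + n)%N by lia.
  have := congr1 (fun y : 'cV_(n + n) => y (Ordinal tnn) 0) fx.
  by rewrite !mxE /ff /= ltnNge leq_addr /= addKn -jE.
have f1D j u v : f1 j (u + v) = f1 j u + f1 j v by rewrite -[u]scale1r f1_lin mul1r scale1r.
have f2D j u v : f2 j (u + v) = f2 j u + f2 j v by rewrite -[u]scale1r f2_lin mul1r scale1r.
have xA : A s x.
  have [u [uH xE]] := A_dec xH.
  have u0 : u (~~ s) = 0.
    (* The component of the wrong sign is killed by every [f1 j]: for one parity by its own sign,
       for the other because [x] and the remaining component are killed. The family [f1] alone
       suffices for vanishing. *)
    apply: (vanish (J := predT) (C := pred0)) => // [|j jI _]; first by case: (uH (~~ s)).
    have [oj|oj] := eqVneq (odd j) (~~ s); last by apply: f1A oj (uH _).2.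
    have js : odd j != s by rewrite oj; case: (s).
    have := fx1 j jI js; rewrite xE f1D.
    have := f1A jI js (uH s).2; case: (s) => -> /=; by rewrite ?add0r ?addr0.
  have -> : x = u s by rewrite xE; case: (s) u0 => /= ->; rewrite ?add0r ?addr0.
  exact: (uH s).2.
have xB : B s x.
  have [u [uH xE]] := B_dec xH.
  have u0 : u (~~ s) = 0.
    apply: (vanish (J := pred0) (C := predT)) => // [|j jI _]; first by case: (uH (~~ s)).
    have jh : (j <= hi)%N by case/andP: jI.
    have [oj|oj] := eqVneq (odd j) (~~ s); last first.
      by apply: f2B (uH _).2; rewrite ?even_parity.
    have js : odd j != s by rewrite oj; case: (s).
    have := fx2 j jI js; rewrite xE f2D.
    have := f2B jI _ (uH s).2; rewrite even_parity // => /(_ js).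
    case: (s) => -> /=; by rewrite ?add0r ?addr0.
  have -> : x = u s by rewrite xE; case: (s) u0 => /= ->; rewrite ?add0r ?addr0.
  exact: (uH s).2.
rewrite lt0n dimv_eq0; apply: contraNneq x0 => W0.
by rewrite -memv0 -W0; apply/WP.
Qed.

End EvenParity.
End Counting.

Lemma wsp_dim (K : fieldType) (q : K) (M : uqmod q) (wt : 'I_(udim M) -> nat) m :
  \dim (wsp wt m) = #|[pred i | wt i == m]|.
Proof.
set A := [pred i | wt i == m].
pose f (x : 'cV[K]_(udim M)) : 'cV[K]_#|A| := \col_t x (enum_val t) 0.
apply: (dim_by_coords (f := f)) => [a u v|u /wspP u0 fu|y].
- by apply/colP => t; rewrite !mxE.
- apply/colP => i; rewrite mxE; have [im|/u0//] := eqVneq (wt i) m.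
  have iA : i \in A by rewrite inE im.
  have := congr1 (fun y : 'cV_#|A| => y (enum_rank_in iA i) 0) fu.
  by rewrite !mxE enum_rankK_in.
exists (\sum_t y t 0 *: delta_mx (enum_val t) 0).
  apply/wspP => i im; rewrite summxE big1 // => t _; rewrite !mxE.
  have := enum_valP t; rewrite inE => /eqP ti.
  by case: eqP => [e|_]; rewrite ?mulr0 //; rewrite e ti eqxx in im.
apply/colP => t; rewrite mxE summxE (bigD1 t) //= !mxE !eqxx mulr1 big1 ?addr0 // => t' tt'.
by rewrite !mxE (inj_eq enum_val_inj) eq_sym (negPf tt') mulr0.
Qed.

Lemma sum_ord_eq n (e j : nat) :
  (\sum_(b < n) (e + b == j)%N = ((e <= j) && (j < n + e)) :> nat)%N.
Proof.
elim: n => [|n IH]; first by rewrite big_ord0; case: leqP => //; lia.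
by rewrite big_ord_recr /= IH; lia.
Qed.

Section Dimensions.
Variables (K F : fieldType) (q : K) (res : K -> F -> Prop).
Hypothesis rP : residue q res.
Variable l : nat.
Local Notation d := l.+1.
Local Notation V3 := (V3 rP l).
Local Notation vT := 'cV[K]_(d * d * d).
Local Notation wsp3 := (@wsp K q V3 (@wt3 l)).
Local Notation L := (l + l + l)%N.

(** The number of pairs [a, b <= l] with [a + b = j]. *)
Let N2 (j : nat) : nat := (minn d j.+1 - (j - l))%N.
Let N3 (m : nat) : nat := \dim (wsp3 m).

Lemma N3E m : N3 m = (\sum_(c < d) if (c <= m)%N then N2 (m - c) else 0)%N.
Proof.
rewrite /N3 wsp_dim -sum1_card big_mkcond /=.
rewrite (reindex (@mxtens_index (d * d) d)) /=; last first.
  by exists (@mxtens_unindex (d * d) d) => k _; rewrite (mxtens_indexK, mxtens_unindexK).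
rewrite -(pair_bigA _ (fun k c => if mxtens_index (k, c) \in [pred i | wt3 i == m] then 1 else 0)%N) /=.
rewrite exchange_big /=; apply: eq_bigr => c _.
rewrite (reindex (@mxtens_index d d)) /=; last first.
  by exists (@mxtens_unindex d d) => k _; rewrite (mxtens_indexK, mxtens_unindexK).
rewrite -(pair_bigA _ (fun a b => if mxtens_index (mxtens_index (a, b), c) \in [pred i | wt3 i == m] then 1 else 0)%N) /=.
transitivity (\sum_(a < d) ((c + a <= m) && (m < d + (c + a))) : nat)%N.
  apply: eq_bigr => a _; rewrite -sum_ord_eq; apply: eq_bigr => b _.
  rewrite inE /wt3 mxtens_indexK /wt2 mxtens_indexK /=.
  by rewrite addnAC [(a + c)%N]addnC; case: eqP.
case: leqP => [cm|mc]; last by rewrite big1 // => a _; rewrite (_ : (c + a <= m)%N = false) //; lia.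
rewrite /N2 -sum_ord_between [RHS]big_mkcond; apply: eq_bigr => a _.
by have := ltn_ord c; case: ifP; lia.
Qed.

(** [N3] is a sliding sum of [l + 1] values of [N2]; one value enters and one leaves. *)
Lemma N3S m : (N3 m.+1 + (if l <= m then N2 (m - l) else 0) = N3 m + N2 m.+1)%N.
Proof.
rewrite !N3E big_ord_recl [in RHS]big_ord_recr /= subn0.
rewrite (eq_bigr (fun i : 'I_l => if i <= m then N2 (m - i) else 0)%N) => [|i _]; last first.
  by rewrite /bump /= add1n ltnS subSS.
by rewrite -addnA addnC.
Qed.

Let fE (x : vT) : x \in (fullv : {vspace vT}) -> opE V3 x \in (fullv : {vspace vT}).
Proof. by rewrite !memvf. Qed.
Let fF (x : vT) : x \in (fullv : {vspace vT}) -> opF V3 x \in (fullv : {vspace vT}).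
Proof. by rewrite !memvf. Qed.

Lemma dim_hw_full m : (2 * m <= L)%N ->
  \dim (hw (opE V3) wsp3 fullv m) = if (m <= l)%N then m.+1 else (L - 2 * m).+1.
Proof.
have sl2 := weighted_sl2 rP (V3_weighted rP l).
have gE n : \dim (gr wsp3 fullv n) = N3 n by rewrite /gr capfv.
case: m => [_|m mL].
  rewrite -(dim_gr0 sl2) gE N3E /= big_ord_recl big1 => [|i _] /=.
    by rewrite /N2 addn0; lia.
  by rewrite /bump.
have mL' : (2 * m < L)%N by lia.
have := dim_grS sl2 fE fF mL'; rewrite !gE; have := N3S m; rewrite /N2.
move: (N3 m) (N3 m.+1) (\dim (hw _ _ _ _)) => n3 n3' D.
by case: (leqP l m) => lm H H'; lia.
Qed.

Variable P : 'M[K]_(d * d).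
Hypothesis bP : braid_op rP P.
Variables (M : {vspace vT}) (s : bool).
Hypothesis MP : forall x, x \in M <-> L12 q P s x /\ L23 q P s x.

Lemma M_E x : x \in M -> actE V3 *m x \in M.
Proof.
by move=> /MP[x1 x2]; apply/MP; split; [exact: (L12_E bP)|exact: (L23_E bP)].
Qed.

Lemma M_F x : x \in M -> actF V3 *m x \in M.
Proof.
by move=> /MP[x1 x2]; apply/MP; split; [exact: (L12_F bP)|exact: (L23_F bP)].
Qed.

Lemma M_wproj m x : x \in M -> wproj (M := V3) (@wt3 l) m *m x \in M.
Proof.
by move=> /MP[x1 x2]; apply/MP; split; [exact: (L12_wproj bP)|exact: (L23_wproj bP)].
Qed.

Lemma hw3P m x : reflect (hw3 rP m x) (x \in hw (opE V3) wsp3 fullv m).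
Proof.
apply: (iffP (hwP _ _ _ _ _)); first by rewrite lfunE => -[].
by move=> [xm Ex]; rewrite memvf lfunE.
Qed.

Lemma hwM m x : x \in hw (opE V3) wsp3 M m <->
  [/\ x \in hw (opE V3) wsp3 fullv m, L12 q P s x & L23 q P s x].
Proof.
split=> [/hwP[/MP[x1 x2] xm Ex]|[/hwP[_ xm Ex] x1 x2]].
  by split=> //; apply/hwP; rewrite memvf.
by apply/hwP; split=> //; apply/MP.
Qed.

Section Decompositions.
Variables (A : bool -> vT -> Prop) (m : nat).
Hypothesis A_E : forall t x, A t x -> A t (actE V3 *m x).
Hypothesis A_wproj : forall t x, A t x -> A t (wproj (M := V3) (@wt3 l) m *m x).
Hypothesis A_cap : forall t x, A t x -> A (~~ t) x -> x = 0.
Hypothesis A_N : forall t x, A t x -> A t (- x).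
Hypothesis A_dec : forall x, exists u : bool -> vT, (forall t, A t (u t)) /\ x = u false + u true.

(** The components, projected to degree [m], have opposite images under [E]; these lie in both parts
    and so vanish. *)
Lemma hw_decomp x : x \in hw (opE V3) wsp3 fullv m ->
  exists u : bool -> vT,
    (forall t, u t \in hw (opE V3) wsp3 fullv m /\ A t (u t)) /\ x = u false + u true.
Proof.
move/hw3P => [xm Ex]; have [u [uA xE]] := A_dec x.
pose v t := wproj (M := V3) (@wt3 l) m *m u t.
have vA t : A t (v t) by exact: A_wproj.
have xv : x = v false + v true.
  by rewrite -mulmxDr -xE (wproj_id _ xm) eqxx scale1r.
have Ev : actE V3 *m v false = - (actE V3 *m v true).
  by apply/eqP; rewrite -addr_eq0 -mulmxDr -xv Ex.
have E0 : actE V3 *m v false = 0.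
  by apply: A_cap (A_E (vA false)) _; rewrite Ev; apply/A_N/A_E/vA.
exists v; split=> // t; split=> //; apply/hw3P; split; first exact: wproj_wsp.
by case: t => //; move/eqP: Ev; rewrite E0 eq_sym oppr_eq0 => /eqP.
Qed.

End Decompositions.

Lemma L12_N t x : L12 q P t x -> L12 q P t (- x).
Proof. by move=> xt c; rewrite -scaleN1r -[_ *: x]addr0 sl12_lin sl12_0 addr0 memvZ. Qed.

Lemma L23_N t x : L23 q P t x -> L23 q P t (- x).
Proof.
move=> xt a; rewrite -scaleN1r -[_ *: x]addr0 sl23_lin memvD ?memvZ //.
by rewrite (_ : sl23 0 a = 0) ?mem0v //; apply/colP => k; rewrite !mxE get30.
Qed.

(** For [m <= l] the index range starts at 0, so only symmetric vectors of even degree occur. Beyond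
    [l] there are none for [l] odd; for [l] even both ends of the range have the parity of [m],
    which decides the sign. *)
Definition hw_mult (m : nat) : nat :=
  if odd l then (m <= l)%N && ~~ odd m && ~~ s
  else if (m <= l)%N then ~~ odd m && ~~ s else odd m == s.

Lemma dim_hwM m : (2 * m <= L)%N -> \dim (hw (opE V3) wsp3 M m) = hw_mult m.
Proof.
move=> mL; have dH := dim_hw_full mL.
pose W := hw (opE V3) wsp3 M m.
have A12 := hw_decomp (L12_E bP) (L12_wproj bP m) (L12_cap bP) L12_N (L12_decomp bP).
have A23 := hw_decomp (L23_E bP) (L23_wproj bP m) (L23_cap bP) L23_N (L23_decomp bP).
have [ml|lm] := leqP m l.
  have f1l j (a : K) (u v : vT) : f1_I q m j (a *: u + v) = a * f1_I q m j u + f1_I q m j v.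
    by rewrite mulr_sumr -big_split; apply: eq_bigr => i _; rewrite get3_lin /=; ring.
  have f2l i (a : K) (u v : vT) : f2_I q m i (a *: u + v) = a * f2_I q m i u + f2_I q m i v.
    by rewrite mulr_sumr -big_split; apply: eq_bigr => j _; rewrite get3_lin /=; ring.
  have van (J C : pred nat) (x : vT) : x \in hw (opE V3) wsp3 fullv m ->
    (forall j, (0 <= j <= m)%N -> J j -> f1_I q m j x = 0) ->
    (forall i, (0 <= i <= m)%N -> C i -> f2_I q m i x = 0) ->
    (forall i, (0 <= i <= m)%N -> [|| C i, J i | [&& (i < m)%N, J i.+1 & C i.+1]]) -> x = 0.
    by move=> /hw3P hx; exact: (vanish_I ml hx).
  have h1 (t : bool) (j : nat) (x : vT) : (0 <= j <= m)%N -> odd j != t -> L12 q P t x -> f1_I q m j x = 0.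
    by move=> jm; exact: (f1_I_L12 bP ml jm).
  have h2 (t : bool) (i : nat) (x : vT) : (0 <= i <= m)%N -> odd (m - i) != t -> L23 q P t x -> f2_I q m i x = 0.
    by move=> im; exact: (f2_I_L23 bP ml im).
  have dH' : (m - 0 < \dim (hw (opE V3) wsp3 fullv m))%N by rewrite dH ml subn0.
  have mm : (0 <= m <= m)%N by rewrite leqnn.
  rewrite /hw_mult ml /=; have [om|em] := boolP (odd m).
    by rewrite (count_odd mm h1 h2 van (hwM m) om); case: odd.
  case sE: s => /=.
    rewrite (count_minor mm h1 h2 van (hwM m) em) ?if_same //.
    by rewrite sE (negPf em).
  rewrite (count_major mm f1l f2l h1 h2 van (hwM m) em A12 A23 dH') ?if_same //.
  by rewrite (negPf em).
pose s0 := (m - l)%N; pose w := (L - 2 * m)%N.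
have lE : l = (w + 2 * s0)%N by rewrite /w /s0; lia.
have mE : m = (l + s0)%N by rewrite /s0; lia.
rewrite /hw_mult (leqNgt m l) lm /=.
have f1l j (a : K) (u v : vT) : f1_II rP s0 j (a *: u + v) = a * f1_II rP s0 j u + f1_II rP s0 j v.
  by rewrite mulr_sumr -big_split; apply: eq_bigr => i _; rewrite Xs_lin get3_lin /=; ring.
have f2l i (a : K) (u v : vT) : f2_II rP s0 i (a *: u + v) = a * f2_II rP s0 i u + f2_II rP s0 i v.
  by rewrite mulr_sumr -big_split; apply: eq_bigr => j _; rewrite Xs_lin get3_lin /=; ring.
have van (J C : pred nat) (x : vT) : x \in hw (opE V3) wsp3 fullv m ->
  (forall j, (s0 <= j <= w + s0)%N -> J j -> f1_II rP s0 j x = 0) ->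
  (forall i, (s0 <= i <= w + s0)%N -> C i -> f2_II rP s0 i x = 0) ->
  (forall i, (s0 <= i <= w + s0)%N -> [|| C i, J i | [&& (i < w + s0)%N, J i.+1 & C i.+1]]) -> x = 0.
  by move=> /hw3P; rewrite mE => hx; exact: (vanish_II lE hx).
have h1 (t : bool) (j : nat) (x : vT) : (s0 <= j <= w + s0)%N -> odd j != t -> L23 q P t x -> f1_II rP s0 j x = 0.
  by move=> jm; apply: (f1_II_L23 bP); lia.
have h2 (t : bool) (i : nat) (x : vT) : (s0 <= i <= w + s0)%N -> odd (l - i) != t -> L12 q P t x -> f2_II rP s0 i x = 0.
  by move=> im; apply: (f2_II_L12 bP); lia.
have dH' : (w + s0 - s0 < \dim (hw (opE V3) wsp3 fullv m))%N.
  by rewrite dH (leqNgt m l) lm /= addnK.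
have mm : (s0 <= w + s0 <= l)%N by lia.
have hwM' x : x \in hw (opE V3) wsp3 M m <->
  [/\ x \in hw (opE V3) wsp3 fullv m, L23 q P s x & L12 q P s x].
  by rewrite hwM; split=> -[].
have [ol|el] := boolP (odd l); first by rewrite (count_odd mm h1 h2 van hwM' ol).
have os0 : odd s0 = odd m by rewrite /s0 oddB ?(negPf el) ?addbF // ltnW.
have ohi : odd (w + s0) = odd m.
  by rewrite oddD os0 /w oddB // oddM /= !oddD (negPf el).
case: eqVneq => [oms|oms]; last by rewrite (count_minor mm h1 h2 van hwM' el) // ohi.
by rewrite (count_major mm f1l f2l h1 h2 van hwM' el A23 A12 dH') // ?ohi ?os0.
Qed.

Lemma dim_M : \dim M = (\sum_(i < (L./2).+1) hw_mult i * (L - 2 * i).+1)%N.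
Proof.
rewrite (weighted_dim rP (V3_weighted rP l) M_E M_F M_wproj).
apply: eq_bigr => i _; rewrite dim_hwM //.
by have := ltn_ord i; rewrite ltnS => iL; lia.
Qed.

End Dimensions.

(** * Summing the multiplicities *)

Section HighestWeightCount.
Local Open Scope nat_scope.

Lemma bin2_mul2 n : 'C(n.+1, 2) * 2 = n.+1 * n.
Proof. by rewrite -[2 in LHS]/(2`!) bin_ffact !ffactnS ffactn0 muln1. Qed.

Lemma sum_same_parity n :
  \sum_(r < n.+1) (odd r == odd n) * (2 * r).+1 = 'C(n + 2, 2).
Proof.
pose g r := (2 * r).+1.
(* Every other term is skipped, so the induction carries two consecutive cases. *)
have H : \sum_(r < n.+1) (odd r == odd n) * g r = 'C(n + 2, 2)
  /\ \sum_(r < n.+2) (odd r == odd n.+1) * g r = 'C(n + 3, 2).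
  elim: n => [|n [IH1 IH2]]; first by rewrite !big_ord_recr !big_ord0.
  split; first by rewrite addSn -addnS.
  rewrite big_ord_recr big_ord_recr /=.
  under eq_bigr => i _ do rewrite negbK.
  rewrite IH1 !negbK eqxx mul1n (_ : (~~ odd n == odd n) = false) ?mul0n; last by case: odd.
  have := bin2_mul2 n.+3; have := bin2_mul2 n.+1.
  by rewrite (addn2 n) (addn3 n.+1) /g; lia.
exact: H.1.
Qed.

Lemma sum_even_weights k L : 4 * k <= L + 4 ->
  \sum_(i < 2 * k) ~~ odd i * (L - 2 * i).+1 + 2 * (k * k.-1) = k * L.+1.
Proof.
elim: k => [|k IH] kL; first by rewrite muln0 big_ord0.
have e : 2 * k.+1 = (2 * k).+2 by lia.
rewrite e !big_ord_recr /= oddM /=.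
have := IH ltac:(lia); case: k {IH e} kL => [|k] kL /=; first by rewrite big_ord0; lia.
by nia.
Qed.

Lemma hw_mult_alternating l :
  \sum_(i < ((l + l + l)./2).+1) hw_mult l true i * (l + l + l - 2 * i).+1
  = delta l * 'C(l./2 + 1, 2).
Proof.
rewrite /hw_mult /delta; have [ol|el] := boolP (odd l).
  by rewrite big1 // => i _; rewrite andbF.
have lE : l = (l./2).*2 by have := odd_double_half l; rewrite (negPf el).
set p := l./2 in lE *.
have -> : (l + l + l)./2 = 3 * p by rewrite lE; lia.
rewrite mul1n (reindex_inj rev_ord_inj) /=.
(* With [l = 2p] and [i = 3p - r] the weight is [2r], and [i > l] means [r < p]: only odd degrees
   beyond [l] contribute. *)
rewrite (eq_bigr (fun r : 'I_(3 * p).+1 => if r < p then (odd r != odd p) * (2 * r).+1 else 0)).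
  rewrite -big_mkcond /= -(big_ord_widen _ (fun r => (odd r != odd p) * (2 * r).+1)); last by lia.
  case: p lE => [|p] lE; first by rewrite big_ord0.
  rewrite (_ : p.+1 + 1 = p + 2); last by lia.
  rewrite -sum_same_parity; apply: eq_bigr => r _ /=.
  by case: (odd r); case: (odd p).
move=> r _; have := ltn_ord r => rp.
have -> : (3 * p).+1 - r.+1 = 3 * p - r by lia.
have -> : l + l + l - 2 * (3 * p - r) = 2 * r by lia.
have -> : (3 * p - r <= l) = ~~ (r < p) by lia.
case: ltnP => rp'; rewrite /= ?andbF //.
by rewrite oddB ?oddM //=; case: (odd p); case: (odd r).
Qed.

(** For [l] odd the even degrees up to [l] add up to [(l + 1)^2]. For [l = 2p] all even degrees up
    to [3p] occur, and the total ['C(3p + 2, 2)] equals [(2p + 1)^2 + 'C(p + 1, 2)]. *)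
Lemma hw_mult_symmetric l :
  \sum_(i < ((l + l + l)./2).+1) hw_mult l false i * (l + l + l - 2 * i).+1
  = (l + 1) ^ 2 + delta l * 'C(l./2 + 1, 2).
Proof.
rewrite /hw_mult /delta; have [ol|el] := boolP (odd l).
  have lE : l = (l./2).*2.+1 by have := odd_double_half l; rewrite ol.
  set p := l./2 in lE *.
  have -> : (l + l + l)./2.+1 = (2 * p.+1) + p by rewrite lE; lia.
  rewrite big_split_ord /= [X in _ + X]big1 => [|i _]; last first.
    by rewrite (_ : (_ <= l) = false) //; lia.
  rewrite addn0 mul0n addn0.
  rewrite (eq_bigr (fun i : 'I_(2 * p.+1) => ~~ odd i * (l + l + l - 2 * i).+1)).
    by have := @sum_even_weights p.+1 (l + l + l) ltac:(lia); rewrite lE /=; nia.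
  by move=> i _; have := ltn_ord i => ip; rewrite (_ : (i <= l)) ?andbT //; lia.
have lE : l = (l./2).*2 by have := odd_double_half l; rewrite (negPf el).
set p := l./2 in lE *.
have -> : (l + l + l)./2 = 3 * p by rewrite lE; lia.
rewrite mul1n (reindex_inj rev_ord_inj) /=.
transitivity 'C(3 * p + 2, 2).
  rewrite -sum_same_parity; apply: eq_bigr => r _; have := ltn_ord r => rp.
  have -> : (3 * p).+1 - r.+1 = 3 * p - r by lia.
  have -> : l + l + l - 2 * (3 * p - r) = 2 * r by lia.
  rewrite !andbT eqbF_neg oddB; last by lia.
  by case: ifP => _; rewrite ?andbT; case: (odd (3 * p)); case: (odd r).
have := bin2_mul2 (3 * p).+1; have := bin2_mul2 p; rewrite addn2 (addn1 p) lE.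
by rewrite -mulnn addn1; nia.
Qed.

Lemma symmetric_cube_not_flat l : 2 < l ->
  (l + 1) ^ 2 + delta l * 'C(l./2 + 1, 2) < 'C(l.+1 + 3 - 1, 3).
Proof.
move=> l2; have b3 n : 'C(n.+3, 3) * 6 = n.+3 * (n.+2 * n.+1).
  by rewrite -[6]/(3`!) bin_ffact !ffactnS ffactn0 muln1.
rewrite (_ : l.+1 + 3 - 1 = l.+3); last by lia.
rewrite (addn1 l./2); have dl1 : delta l * 'C((l./2).+1, 2) <= 'C((l./2).+1, 2).
  by rewrite /delta; case: odd; rewrite ?mul1n.
suff : (l + 1) ^ 2 + 'C((l./2).+1, 2) < 'C(l.+3, 3).
  by move=> H; apply: leq_ltn_trans H; rewrite leq_add2l.
have half : 'C((l./2).+1, 2) * 8 <= (l + 2) * l.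
  have lh : l./2.*2 <= l by have := odd_double_half l; lia.
  have -> : 'C((l./2).+1, 2) * 8 = (l./2.*2 + 2) * l./2.*2.
    by have := bin2_mul2 l./2; lia.
  by rewrite leq_mul // leq_add2r.
have := b3 l; move: 'C(_, 2) 'C(_, 3) half => c2 c3.
have -> : l = (l - 3) + 3 by lia.
move: (l - 3) => k half; rewrite -mulnn => c3E.
lia.
Qed.

End HighestWeightCount.

(** * Words and quadratic relations *)

Section WordNumbers.
Variable d : nat.
Hypothesis d0 : (0 < d)%N.

(** The position of a basis tensor: its letters are base [d] digits, the first being the most
    significant, in accordance with [mxtens_index]. *)
Definition wnum (w : seq nat) : nat := foldl (fun n a => n * d + a)%N 0%N w.

Lemma wnum_rcons w a : wnum (rcons w a) = (wnum w * d + a)%N.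
Proof. by rewrite /wnum foldl_rcons. Qed.

Lemma wnum_cat u v : wnum (u ++ v) = (wnum u * d ^ size v + wnum v)%N.
Proof.
elim/last_ind: v => [|v a IH]; first by rewrite cats0 muln1 addn0.
by rewrite -rcons_cat !wnum_rcons IH size_rcons expnS; lia.
Qed.

Lemma wnum_mid u a b v :
  wnum (u ++ [:: a, b & v])
  = (wnum u * d ^ 2 * d ^ size v + (a * d + b) * d ^ size v + wnum v)%N.
Proof.
rewrite -(cat1s a) -(cat1s b) !catA !wnum_cat /= !expn1 [wnum [:: a]]/wnum [wnum [:: b]]/wnum /= !mul0n !add0n.
by rewrite -mulnn !mulnDl -!mulnA; lia.
Qed.

Lemma wnum_lt w : all (fun a => a < d)%N w -> (wnum w < d ^ size w)%N.
Proof.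
elim/last_ind: w => // w a IH; rewrite all_rcons => /andP[ad /IH wd].
by rewrite wnum_rcons size_rcons expnS; nia.
Qed.

Fixpoint word n k : seq nat :=
  if n is n'.+1 then rcons (word n' (k %/ d)%N) (k %% d)%N else [::].

Lemma size_word n k : size (word n k) = n.
Proof. by elim: n k => //= n IH k; rewrite size_rcons IH. Qed.

Lemma all_word n k : all (fun a => a < d)%N (word n k).
Proof. by elim: n k => //= n IH k; rewrite all_rcons IH ltn_mod d0. Qed.

Lemma wnumK n k : (k < d ^ n)%N -> wnum (word n k) = k.
Proof.
elim: n k => [|n IH] k /=; first by case: k.
by rewrite expnS mulnC -ltn_divLR // => /IH e; rewrite wnum_rcons e -divn_eq.
Qed.

Lemma wordK w : all (fun a => a < d)%N w -> word (size w) (wnum w) = w.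
Proof.
elim/last_ind: w => // w a IH; rewrite all_rcons => /andP[ad /IH e].
rewrite size_rcons /= wnum_rcons divnMDl // divn_small // addn0 e.
by rewrite modnMDl modn_small.
Qed.

End WordNumbers.

Lemma unsorted_descent (w : seq nat) : ~~ sorted leq w ->
  exists u a b v, w = u ++ b :: a :: v /\ (a < b)%N.
Proof.
elim: w => [|x [|y w] IH] //=; rewrite negb_and -ltnNge => /orP[yx|/IH].
  by exists [::], y, x, w.
by move=> [u [a [b [v [-> ab]]]]]; exists (x :: u), a, b, v.
Qed.

Lemma sorted_012 (w : seq nat) : sorted leq w -> all (fun a => a < 3)%N w ->
  w = nseq (count_mem 0%N w) 0%N ++ nseq (count_mem 1%N w) 1%N
      ++ nseq (count_mem 2 w) 2.
Proof.
elim: w => // x w IH /= xw /andP[x3 w3].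
have geq : all (leq x) w by apply: order_path_min xw; exact: leq_trans.
have {}IH := IH (path_sorted xw) w3.
have c0 y : (y < x)%N -> count_mem y w = 0%N.
  move=> yx; apply/eqP; rewrite -leqn0 leqNgt -has_count; apply/hasPn => z /(allP geq).
  by move=> xz /=; rewrite gtn_eqF // (leq_trans yx).
case: x x3 {xw geq} c0 => [|[|[|x]]] //= _ c0; rewrite {1}IH //.
  by rewrite (c0 0%N isT).
by rewrite (c0 0%N isT) (c0 1%N isT).
Qed.

Section PBW.
Variables (K : fieldType) (p : K).

(* The quadratic relations [x_b x_a = p x_a x_b] and
   [x_2 x_0 = x_0 x_2 + (p - 1) x_1^2], read on the dual side. *)
Definition straight (X : seq nat -> K) (u v : seq nat) (b a : nat) : K :=
  if (b == 2) && (a == 0)%N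
  then X (u ++ [:: 0%N, 2 & v]) + (p - 1) * X (u ++ [:: 1%N, 1%N & v])
  else p * X (u ++ [:: a, b & v]).

(** The coefficient in [x_2 x_0^a = x_0^a x_2 + (bet a) x_0^(a-1) x_1^2]. *)
Fixpoint bet (a : nat) : K := if a is a'.+1 then bet a' + (p - 1) * p ^+ (2 * a') else 0.

(* The coefficient of the monomial x_0^a x_1^b x_2^c in the word w. *)
Fixpoint coefw (w : seq nat) (a b c : nat) : K :=
  match w with
  | [::] => ((a == 0) && (b == 0) && (c == 0))%N%:R
  | 0 :: w' => if a is a'.+1 then coefw w' a' b c else 0
  | 1 :: w' => if b is b'.+1 then p ^+ a * coefw w' a b' c else 0
  | _ :: w' => (if c is c'.+1 then p ^+ b * coefw w' a b c' else 0)
      + (if b is b'.+2 then bet a.+1 * coefw w' a.+1 b' c else 0)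
  end.

(** The consistency of the straightening: left multiplication by letters on sorted monomials, as
    encoded in [coefw], obeys the quadratic relations. For an empty prefix [u] this is a
    computation, and longer prefixes act linearly. *)
Lemma coefw_straight u v b a i j k : (a < b < 3)%N ->
  coefw (u ++ [:: b, a & v]) i j k
  = straight (fun w => coefw w i j k) u v b a.
Proof.
move=> ab; rewrite /straight.
elim: u i j k => [|x u IH] i j k.
  case: b ab => [|[|[|b]]] ab; try (by exfalso; lia);
    case: a ab => [|[|a]] ab; try (by exfalso; lia); rewrite /=.
  - by case: i => [|i]; case: j => [|j]; rewrite ?mulr0 //= exprS; ring.
  - case: i => [|i]; case: j => [|[|j]]; case: k => [|k] //=;
      rewrite ?mulr0 ?addr0 ?add0r ?mulr0 ?mul0n ?expr0 //=; rewrite ?mul2n -?addnn ?exprD; ring.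
  - case: j => [|[|[|j]]]; case: k => [|k] //=; rewrite ?mulr0 ?addr0 ?add0r ?exprS; ring.
have lin X1 X2 X3 e f : (e : K) = (if (b == 2) && (a == 0)%N then X1 + (p - 1) * X2 else p * X3) ->
   f * e = if (b == 2) && (a == 0)%N then f * X1 + (p - 1) * (f * X2) else p * (f * X3).
  by move=> ->; case: ifP => _; ring.
case: x => [|[|x]] /=.
- by case: i => [|i]; rewrite ?IH // !mulr0 addr0 if_same.
- by case: j => [|j]; [rewrite !mulr0 addr0 if_same|apply: lin].
case: j => [|[|j]]; case: k => [|k]; rewrite ?addr0 ?add0r; try (by apply: lin);
  try by rewrite !mulr0 ?addr0 if_same.
by rewrite !IH; case: ifP => _; ring.
Qed.

Lemma coefw_sorted a0 b0 c0 a b c :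
  coefw (nseq a0 0%N ++ nseq b0 1%N ++ nseq c0 2) a b c
  = ((a == a0) && (b == b0) && (c == c0))%N%:R.
Proof.
have two c' : forall i j k, coefw (nseq c' 2) i j k
    = ((i == 0) && (j == 0) && (k == c'))%N%:R.
  elim: c' => [|c' IH] i j k //=; case: k => [|k]; case: j => [|[|j]];
    rewrite ?IH ?add0r ?addr0 ?expr0 ?mul1r ?mulr0 ?andbF ?addr0 ?mulr0 //=;
    by rewrite ?mulr0 ?addr0 ?andbF ?andbT.
have one b' : forall i j k, coefw (nseq b' 1%N ++ nseq c0 2) i j k
    = ((i == 0) && (j == b') && (k == c0))%N%:R.
  elim: b' => [|b' IH] i j k; first exact: two.
  case: j => [|j] /=; first by rewrite andbF.
  by rewrite IH eqSS; case: i => [|i]; rewrite ?expr0 ?mul1r ?mulr0.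
elim: a0 a => [|a0 IH] a; first exact: one.
by case: a => [|a] //=; rewrite IH eqSS.
Qed.

End PBW.

Section SortedWords.
Variables (K : fieldType) (p : K) (l n : nat).
Hypothesis l2 : (l <= 2)%N.
Local Notation d := l.+1.
Local Notation vT := 'cV[K]_(d ^ n).

Definition wval (x : vT) (w : seq nat) : K := ext (fun i => x i 0) (wnum d w).

Definition straightened (x : vT) : Prop :=
  forall u v a b, all (fun c => c < d)%N (u ++ [:: b, a & v]) ->
  size (u ++ [:: b, a & v]) = n -> (a < b)%N ->
  wval x (u ++ [:: b, a & v]) = straight p (wval x) u v b a.

(** Straightening a descent replaces a word by words of smaller [wnum], so the values on sorted
    words determine all others. *)
Lemma straightened_eq0 x : straightened x ->
  (forall w, all (fun c => c < d)%N w -> size w = n -> sorted leq w -> wval x w = 0) ->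
  x = 0.
Proof.
move=> sx x0.
have H k : forall w, (wnum d w < k)%N -> all (fun c => c < d)%N w -> size w = n -> wval x w = 0.
  elim: k => // k IH w; rewrite ltnS => wk wd sw.
  have [sow|] := boolP (sorted leq w); first exact: x0.
  move/unsorted_descent => [u [a [b [v [wE ab]]]]].
  move: wk wd sw; rewrite wE => wk wd sw; rewrite sx // /straight.
  have [bd [ad [ud vd]]] : (b < d)%N /\ (a < d)%N /\ all (fun c => c < d)%N u /\ all (fun c => c < d)%N v.
    by move: wd; rewrite all_cat /= => /and4P[-> -> -> ->].
  have less a' b' : (a' * d + b' < b * d + a)%N -> (a' < d)%N -> (b' < d)%N ->
      wval x (u ++ [:: a', b' & v]) = 0.
    move=> lt_ab a'd b'd; apply: IH.
    - by apply: leq_trans wk; rewrite !wnum_mid // ltn_add2r ltn_add2l ltn_mul2r expn_gt0.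
    - by rewrite all_cat ud /= a'd b'd vd.
    - by move: sw; rewrite !size_cat.
  case: ifP => [/andP[/eqP b2 /eqP a0]|_].
    by rewrite !less ?mulr0 ?addr0 ?b2 ?a0 //; lia.
  by rewrite less ?mulr0 //; nia.
apply/colP => k; rewrite mxE.
have d0 : (0 < d)%N by [].
have := H (wnum d (word d n k)).+1 (word d n k) (ltnSn _) (all_word d0 n k) (size_word d n k).
by rewrite /wval wnumK // ext_ord.
Qed.

(** The values on sorted words are coordinates: they determine [x] by [straightened_eq0], and
    [coefw] allows them to be prescribed. *)
Lemma dim_straightened (U : {vspace vT}) :
  (forall x, x \in U <-> straightened x) -> \dim U = 'C(l + n, n).
Proof.
move=> US; pose S := [set t : n.-tuple 'I_d | sorted leq [seq val i | i <- t]].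
have cS : #|S| = 'C(l + n, n) by rewrite card_sorted_tuples addnC.
pose tw (t : n.-tuple 'I_d) := [seq val i | i <- t].
have tw_d t : all (fun c => c < d)%N (tw t) by apply/allP => c /mapP[i _ ->]; exact: ltn_ord.
have tw_s t : size (tw t) = n by rewrite size_map size_tuple.
have tw_inj : injective tw by move=> t t' /inj_map - /(_ val_inj) /val_inj.
pose f (x : vT) : 'cV[K]_#|S| := \col_i wval x (tw (enum_val i)).
rewrite -cS; apply: (dim_by_coords (f := f)) => [a u v|x /US sx fx|y].
- by apply/colP => i; rewrite !mxE /wval -extZ -extD; apply: eq_ext => j; rewrite !mxE.
- apply: straightened_eq0 sx _ => w wd sw sow.
  have tP : size (map inord w : seq 'I_d) == n by rewrite size_map sw.
  pose t := Tuple tP.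
  have twt : tw t = w.
    rewrite /tw /= -map_comp map_id_in // => c /(allP wd) cd /=; exact: inordK.
  have tS : t \in S by rewrite inE -/(tw t) twt.
  have := congr1 (fun z : 'cV_#|S| => z (enum_rank_in tS t) 0) fx.
  by rewrite !mxE enum_rankK_in // twt.
pose ct (w : seq nat) i := count_mem i w.
(* The extension of the prescribed values [y]: a word takes the value of its sorted normal form. *)
pose X w := \sum_t y t 0 * coefw p w (ct (tw (enum_val t)) 0%N) (ct (tw (enum_val t)) 1%N) (ct (tw (enum_val t)) 2).
pose x : vT := \col_k X (word d n k).
have xX w : all (fun c => c < d)%N w -> size w = n -> wval x w = X w.
  move=> wd sw; have wn : (wnum d w < d ^ n)%N by rewrite -sw wnum_lt.
  by rewrite /wval (extE _ wn) mxE /= -{1}sw wordK.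
exists x.
  apply/US => u v a b wd sw ab.
  have [bd [ad [ud vd]]] : (b < d)%N /\ (a < d)%N /\ all (fun c => c < d)%N u /\ all (fun c => c < d)%N v.
    by move: wd; rewrite all_cat /= => /and4P[-> -> -> ->].
  have inr a' b' : (a' < d)%N -> (b' < d)%N -> wval x (u ++ [:: a', b' & v]) = X (u ++ [:: a', b' & v]).
    move=> a'd b'd; apply: xX; first by rewrite all_cat ud /= a'd b'd vd.
    by move: sw; rewrite !size_cat.
  rewrite inr // /straight.
  have XE : X (u ++ [:: b, a & v]) = straight p X u v b a.
    rewrite /X; under eq_bigr => t _ do rewrite coefw_straight ?ab /= ?(leq_trans bd) //.
    rewrite /straight; case: ifP => _.
      by rewrite mulr_sumr -big_split; apply: eq_bigr => t _ /=; ring.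
    by rewrite mulr_sumr; apply: eq_bigr => t _; ring.
  rewrite XE /straight; case: ifP => [/andP[/eqP b2 /eqP a0]|_]; last by rewrite inr.
  by rewrite !inr //; lia.
apply/colP => i; rewrite mxE xX // /X (bigD1 i) //= big1 ?addr0 => [|j ji].
  have sowi : sorted leq (tw (enum_val i)) by have := enum_valP i; rewrite inE.
  have wd3 : all (fun c => c < 3)%N (tw (enum_val i)).
    by apply: sub_all (tw_d _) => c cd; exact: leq_trans cd _.
  by rewrite {1}(sorted_012 sowi wd3) coefw_sorted !eqxx mulr1.
have srt (k : 'I_#|S|) : tw (enum_val k) = nseq (ct (tw (enum_val k)) 0%N) 0%N
   ++ nseq (ct (tw (enum_val k)) 1%N) 1%N ++ nseq (ct (tw (enum_val k)) 2) 2.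
  apply: sorted_012; first by have := enum_valP k; rewrite inE.
  by apply: sub_all (tw_d _) => c cd; exact: leq_trans cd _.
rewrite {1}(srt i) coefw_sorted; case: eqP => e0; rewrite ?mulr0 //=.
case: eqP => e1; rewrite ?mulr0 //=; case: eqP => e2; rewrite ?mulr0 //=.
by case/eqP: ji; apply/enum_val_inj/tw_inj; rewrite srt [RHS]srt e0 e1 e2.
Qed.

End SortedWords.

(** * The symmetric square for [l <= 2] as a space of quadratic relations *)

Section SmallSquares.
Variables (K F : fieldType) (q : K) (res : K -> F -> Prop).
Hypothesis rP : residue q res.

Let q0 : q != 0 := q_unit rP.

Definition quadratic (l : nat) (x : 'cV[K]_(l.+1 * l.+1)) : Prop :=
  forall a b, (a < b <= l)%N -> get2 x b a
    = if (b == 2) && (a == 0)%N then get2 x 0 2 + (q ^- l - 1) * get2 x 1 1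
      else q ^- l * get2 x a b.

Section Relations.
Variables (l : nat) (P : 'M[K]_(l.+1 * l.+1)).
Hypothesis bP : braid_op rP P.

Lemma sgn_ev0 x : x \in sgn_span q P true -> get2 x 0 0 = 0.
Proof.
move=> xS; have := sgn_ev bP (leq0n l) (s := true) isT xS.
rewrite big_ord_recl big_ord0 addr0 /eco /rho big_ord0 !mul0r addr0 expr0z.
by rewrite !mul1r.
Qed.

Lemma sgn_ev1 x : (0 < l)%N -> x \in sgn_span q P false ->
  get2 x 1 0 = q ^- l * get2 x 0 1.
Proof.
move=> l0 xS; have := sgn_ev bP l0 (s := false) isT xS.
rewrite !big_ord_recl big_ord0 addr0 /eco /rho !big_ord_recl !big_ord0 /=.
rewrite !mul0r addr0 expr0z !mul1r !mulr1 /bump /= !subn0 subn1.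
rewrite [(l.-1 + 1)%N]addn1 prednK // mulrC (_ : gint q 1 * _ / _ = 1); last first.
  by rewrite divff // mulf_neq0 // (gint_neq0 rP).
rewrite addn0 subnn (_ : l%:Z - 1 - 1 + 1 + 1 = l%:Z); last by lia.
move=> /eqP; rewrite mulr1 expr1 mulN1r mulrN subr_eq0 => /eqP ->.
by rewrite -exprnP mulrC mulfK // expf_neq0.
Qed.

End Relations.

(** The functional eta_1 kills [x], [E x] and [E^2 x]; for [l = 2] these three equations are the
    three relations. *)
Lemma quadratic_sgn l (P : 'M[K]_(l.+1 * l.+1)) (bP : braid_op rP P) x :
  (l <= 2)%N -> x \in sgn_span q P false -> quadratic x.
Proof.
case: l P bP x => [|[|[|l]]] // P bP x _ xS a b.
- by lia.
- move=> ab; have [-> ->] : a = 0%N /\ b = 1%N by lia.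
  by rewrite (sgn_ev1 bP).
move=> ab.
have e1 := sgn_ev1 bP isT xS.
have xE := sgn_E bP xS; have := sgn_ev1 bP isT xE.
have xE2 := sgn_E bP xE; have := sgn_ev1 bP isT xE2.
rewrite !get2_E // !(get2_outl _ _ (isT : (3 <= 3)%N)) !(get2_outr _ _ (isT : (3 <= 3)%N)).
rewrite -[q ^ (2%:Z - 0%:Z - 0%:Z)]/(q ^+ 2) -[q ^ (2%:Z - 1%:Z - 1%:Z)]/(q ^+ 0).
rewrite -[q ^ (2%:Z - 2%:Z - 2%:Z)]/(q ^- 2) expr0 => e3 e2.
have [[-> ->]|[[-> ->]|[-> ->]]] : (a = 0 /\ b = 1 \/ a = 0 /\ b = 2 \/ a = 1 /\ b = 2)%N by lia.
- exact: e1.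
- rewrite /=; have -> : get2 x 2 0 = (get2 x 2 0 + 1 * get2 x 1 1) - get2 x 1 1 by ring.
  by rewrite e2; field.
rewrite /=; have -> : get2 x 2 1 = 0 + q ^- 2 * get2 x 2 1 + 1 * (get2 x 2 1 + 1 * get2 x 1 2)
   - (q ^- 2 * get2 x 2 1 + get2 x 1 2) by ring.
by rewrite e3; field.
Qed.

Lemma q4_neqN1 : 1 + q ^+ 4 != 0.
Proof.
rewrite addrC addr_eq0; have := qz_neqN rP 4 0; by rewrite expr0z.
Qed.

(** On the alternating side eta_0 kills every [E^k x], and eta_2 kills [x] when [l = 2]. With the
    quadratic relations this is a linear system whose pivots are products of sums such as
    [1 + q^2 + q^4], nonzero as [q] is generic. *)
Lemma quadratic_alt_eq0 l (P : 'M[K]_(l.+1 * l.+1)) (bP : braid_op rP P) x :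
  (l <= 2)%N -> x \in sgn_span q P true -> quadratic x -> x = 0.
Proof.
case: l P bP x => [|[|[|l]]] // P bP x _ xS qx; apply: (@get2_inj _ _) => a b ad bd; rewrite get20.
- by move: ad bd; case: a b => [|a] [|b] // _ _; rewrite (sgn_ev0 bP).
- have e0 := sgn_ev0 bP xS.
  have xE := sgn_E bP xS; have e1 := sgn_ev0 bP xE.
  have xE2 := sgn_E bP xE; have := sgn_ev0 bP xE2; move: e1.
  rewrite !get2_E // !(get2_outl _ _ (isT : (2 <= 2)%N)) !(get2_outr _ _ (isT : (2 <= 2)%N)).
  rewrite -[q ^ (1%:Z - 0%:Z - 0%:Z)]/(q ^+ 1) -[q ^ (1%:Z - 1%:Z - 1%:Z)]/(q ^- 1) => e1 e2.
  have r1 := qx 0%N 1%N isT; rewrite /= in r1.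
  have q2 : 1 + q ^+ 2 != 0 by rewrite addrC addr_eq0; have := qz_neqN rP 2 0; rewrite expr0z.
  have y0 : get2 x 0 1 = 0.
    apply: (mulfI q2); rewrite mulr0 -[RHS](mulr0 q) -e1 r1; by field.
  have y2 : get2 x 1 1 = 0.
    apply: (mulfI q2); rewrite mulr0 -[RHS](mulr0 q) -e2; by field.
  by move: ad bd; case: a b => [|[|a]] [|[|b]] // _ _; rewrite r1 y0 mulr0.
have e0 := sgn_ev0 bP xS.
have xE := sgn_E bP xS; have e1 := sgn_ev0 bP xE.
have xE2 := sgn_E bP xE; have e2 := sgn_ev0 bP xE2.
have xE3 := sgn_E bP xE2; have e3 := sgn_ev0 bP xE3.
have xE4 := sgn_E bP xE3; have := sgn_ev0 bP xE4; move: e3 e2 e1.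
rewrite !(get2_outl _ _ (isT : (3 <= 3)%N), get2_outr _ _ (isT : (3 <= 3)%N), get2_E) //.
rewrite -[q ^ (2%:Z - 0%:Z - 0%:Z)]/(q ^+ 2) -[q ^ (2%:Z - 1%:Z - 1%:Z)]/(q ^+ 0).
rewrite -[q ^ (2%:Z - 2%:Z - 2%:Z)]/(q ^- 2) expr0.
have := sgn_ev bP (leqnn 2) (s := true) isT xS.
rewrite !big_ord_recl big_ord0 addr0 /= /bump /= !subn0 subnn subSS subn0.
rewrite {3}/eco (rho_diag rP) // {1 2}/eco /rho !big_ord_recl !big_ord0 !mul0r addr0 expr0z !mul1r.
set r := (gint q _ * _ / _); have -> : r = 1.
  by rewrite /r [X in X / _]mulrC divff // mulf_neq0 // (gint_neq0 rP).
rewrite -[q ^ _]/(q ^+ 2) -[(-1) ^+ (1 + 0)]/((-1) ^+ 1) -[(-1) ^+ (1 + (1 + 0))]/((-1) ^+ 2).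
rewrite -[(1 + (1 + 0))%N]/2%N addn0 expr1 expr2 !mulN1r opprK !mulr1 !mul1r => f2 e3 e2 e1 e4.
have r1 := qx 0%N 1%N isT; have r2 := qx 0%N 2 isT; have r3 := qx 1%N 2 isT.
rewrite /= in r1 r2 r3.
have g3 : 1 + q ^+ 2 + q ^+ 4 != 0.
  by have := gint_neq0 rP (isT : (0 < 3)%N); rewrite /gint !big_ord_recl big_ord0 addr0 addrA expr0.
have g4 := q4_neqN1.
have y1 : get2 x 0 1 = 0.
  by apply: (mulfI g4); rewrite mulr0 -[RHS](mulr0 (q ^+ 2)) -e1 r1; field.
have y02' : get2 x 0 2 = - (q ^- 2 * get2 x 1 1).
  apply: (mulfI g4); rewrite -[LHS]subr0 -e2 r2; by field.
have y2 : get2 x 1 1 = 0.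
  apply: (mulfI g3); rewrite mulr0 -[RHS](mulr0 (- q ^+ 2)) -f2 r2 y02'; by field.
have y3 : get2 x 1 2 = 0.
  apply: (mulfI (mulf_neq0 g3 g4)); rewrite mulr0 -[RHS](mulr0 (q ^+ 4)) -e3 r3; by field.
have y4 : get2 x 2 2 = 0.
  apply: (mulfI (mulf_neq0 g3 g4)); rewrite mulr0 -[RHS](mulr0 (q ^+ 4)) -e4; by field.
have y02 : get2 x 0 2 = 0 by rewrite y02' y2 mulr0 oppr0.
by move: ad bd; case: a b => [|[|[|a]]] [|[|[|b]]] // _ _; rewrite ?(r1, r2, r3) ?(y1, y2, y3, y02) !(mulr0, addr0).
Qed.

(** For the converse, the alternating component of [x] is the difference of two solutions of the
    relations, hence a solution, hence 0. *)
Lemma sgn_quadraticP l (P : 'M[K]_(l.+1 * l.+1)) (bP : braid_op rP P) x :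
  (l <= 2)%N -> x \in sgn_span q P false <-> quadratic x.
Proof.
move=> l2; split=> [|qx]; first exact: (quadratic_sgn bP l2).
have [u [uS xE]] := sgn_decomp bP x.
have qf := quadratic_sgn bP l2 (uS false).
suff u0 : u true = 0 by rewrite xE u0 addr0.
apply: (quadratic_alt_eq0 bP l2 (uS true)) => a b ab.
have -> : u true = x + (-1) *: u false by rewrite xE scaleN1r addrAC subrr add0r.
rewrite !(get2D, get2Z) (qx a b ab) (qf a b ab).
by case: ifP => _; ring.
Qed.

End SmallSquares.

(** * Simple modules and the R-matrix in standard form *)

(* The operator A - c maps the span onto itself, hence is injective on it. *)
Lemma eigen_vspan_eq0 (K : fieldType) n (A : 'M[K]_n) (S : set 'cV[K]_n) (c : K) x :
  (forall v, S v -> exists2 e : K, e != c & A *m v = e *: v) ->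
  A *m x = c *: x -> x \in vspan S -> x = 0.
Proof.
move=> AS Ax xS; pose f : 'End('cV[K]_n) := linfun (mulmx (A - c%:M)).
have fE y : f y = A *m y - c *: y by rewrite lfunE /= mulmxBl mul_scalar_mx.
have fim : (vspan S <= f @: vspan S)%VS.
  apply/vspanP => v Sv; have [e ec Av] := AS v Sv.
  have -> : v = (e - c)^-1 *: f v.
    by rewrite fE Av -scalerBl scalerA mulVf ?scale1r // subr_eq0.
  by rewrite memvZ // memv_img // mem_vspan.
have dE := limg_ker_dim f (vspan S).
have d0 : \dim (vspan S :&: lker f) = 0%N by have := dimvS fim; lia.
apply/eqP; rewrite -memv0; move/eqP: d0; rewrite dimv_eq0 => /eqP <-.
by rewrite memv_cap xS memv_ker fE Ax subrr eqxx.
Qed.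

Section SimpleModule.
Variables (K F : fieldType) (q : K) (res : K -> F -> Prop).
Hypothesis rP : residue q res.

Let q0 : q != 0 := q_unit rP.

Section Orbit.
Variables (V : uqmod q) (mu : weight) (u : 'cV[K]_(udim V)).
Hypotheses (uK : forall la, actK V la *m u = q ^ wprod la mu *: u)
           (uE : actE V *m u = 0).

Definition Forbit i : 'cV[K]_(udim V) := iter i (mulmx (actF V)) u.

Lemma actK_orbit la i : actK V la *m Forbit i
  = q ^ wprod la (mu.1 - i%:Z, mu.2 + i%:Z) *: Forbit i.
Proof.
elim: i => [|i IH]; first by rewrite subr0 addr0; case: (mu) uK => a b; apply.
rewrite /= mulmxA actK_F -scalemxAl -mulmxA IH -scalemxAr scalerA -expfzDr //.
by congr (q ^ _ *: _); rewrite /wprod /alpha /= intS; ring.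
Qed.

Lemma actEF_orbit i : actE V *m Forbit i.+1 = actF V *m (actE V *m Forbit i)
  + ((q - q^-1)^-1 * (q ^ (mu.1 - mu.2 - i%:Z - i%:Z) - q ^ (i%:Z + i%:Z - (mu.1 - mu.2))))
    *: Forbit i.
Proof.
apply/eqP; rewrite addrC -subr_eq /= !mulmxA -mulmxBl actEF -scalemxAl mulmxBl.
rewrite !actK_orbit -scalerBl scalerA; apply/eqP; congr (_ * (q ^ _ - q ^ _) *: _).
  by rewrite /wprod /=; lia.
by rewrite /wprod /=; lia.
Qed.

Lemma actE_orbit i : exists c : K, actE V *m Forbit i = c *: Forbit i.-1.
Proof.
elim: i => [|i [c IH]]; first by exists 0; rewrite scale0r.
rewrite actEF_orbit; case: i IH => [|i] IH.
  by rewrite /= uE mulmx0 add0r; eexists.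
by rewrite IH -scalemxAr -scalerDl; eexists.
Qed.

Definition orbit_span : {vspace 'cV[K]_(udim V)} := vspan [set x | exists i, x = Forbit i].

Lemma mem_orbit_span i : Forbit i \in orbit_span.
Proof. by apply: mem_vspan; exists i. Qed.

Lemma orbit_submodule : submodule orbit_span.
Proof.
have stab (A : 'M[K]_(udim V)) : (forall i, A *m Forbit i \in orbit_span) ->
    forall x, x \in orbit_span -> A *m x \in orbit_span.
  move=> AF x xS; suff : linfun (mulmx A) x \in orbit_span by rewrite lfunE.
  rewrite memv_preim; move: x xS; apply/subvP/vspanP => _ [i ->].
  by rewrite -memv_preim lfunE; exact: AF.
move=> x xS; split=> [||la]; move: x xS; apply: stab => i.
- by have [c ->] := actE_orbit i; rewrite memvZ ?mem_orbit_span.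
- exact: (mem_orbit_span i.+1).
- by rewrite actK_orbit memvZ ?mem_orbit_span.
Qed.

Lemma orbit_span_full : simple_mod V -> u != 0 -> orbit_span = fullv.
Proof.
move=> [_ sV] u0; case: (sV _ orbit_submodule) => // S0.
by have := mem_orbit_span 0; rewrite S0 memv0 /= (negPf u0).
Qed.

End Orbit.

Section HighestWeight.
Variables (l : nat) (V : uqmod q) (v : 'cV[K]_(udim V)).
Hypotheses (vK : forall la, actK V la *m v = q ^ wprod la (l%:Z, 0) *: v)
           (vE : actE V *m v = 0) (v0 : v != 0) (sV : simple_mod V).
Local Notation w := (Forbit v).
Local Notation phi := (phi q l).

Lemma actE_hw_orbit i : (i <= l.+1)%N -> actE V *m w i = phi i *: w i.-1.
Proof.
elim: i => [|i IH] il; first by rewrite phi0 scale0r.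
rewrite (actEF_orbit vK) IH 1?ltnW // -scalemxAr.
have -> : phi i *: (actF V *m w i.-1) = phi i *: w i.
  by case: (i) => // ; rewrite phi0 !scale0r.
rewrite -scalerDl; congr (_ *: _).
have := phi_diff rP (il : (i <= l)%N) => /(canRL (subrK _)) ->.
by rewrite addrC /= subr0; congr (_ * (q ^ _ - q ^ _) + _); lia.
Qed.

(** This vector is again killed by [E]. Were it nonzero, its orbit would span the simple module, and
    [v] would be a combination of vectors of strictly lower weight. *)
Lemma hw_orbit_end : w l.+1 = 0.
Proof.
apply/eqP; case: eqVneq => // u0; exfalso.
have uK la := actK_orbit vK la l.+1.
have uE : actE V *m w l.+1 = 0.
  by rewrite actE_hw_orbit // /phi subnn gint0 mulr0 scale0r.
have vS : v \in orbit_span (w l.+1) by rewrite (orbit_span_full uK uE) ?memvf.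
suff : v = 0 by apply/eqP.
apply: (eigen_vspan_eq0 _ (vK (0, 1)) vS) => _ [i ->].
exists (q ^ (l.+1 + i)%N%:Z); last by rewrite (actK_orbit uK); congr (q ^ _ *: _); rewrite /wprod /=; lia.
by apply/eqP => /(qz_inj rP); rewrite /wprod /=; lia.
Qed.

Lemma hw_orbit_neq0 i : (i <= l)%N -> w i != 0.
Proof.
elim: i => [|i IH] il; first exact: v0.
apply: contraNneq (IH (ltnW il)) => w0.
have := actE_hw_orbit (leqW il); rewrite w0 mulmx0 => /esym/eqP.
by rewrite scaler_eq0 (negPf (phi_neq0 rP _)).
Qed.

Lemma hw_orbit_out i : (l < i)%N -> w i = 0.
Proof.
move=> li; rewrite -(subnK li); elim: (i - _)%N => [|k IH]; first exact: hw_orbit_end.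
by rewrite addSn /= IH mulmx0.
Qed.

(** Dividing [F^j v] by this product makes [E] a plain shift, as in [Emx]. *)
Let bco_ i := \prod_(1 <= k < i.+1) phi k.

Let B : 'M[K]_(udim V, l.+1) := \matrix_(i, j) ((bco_ j)^-1 * w j i 0).

Let colB j : col j B = (bco_ j)^-1 *: w j.
Proof. by apply/colP => i; rewrite !mxE. Qed.

Let bco_neq0 i : (i <= l)%N -> bco_ i != 0.
Proof.
move=> il; rewrite /bco_ big_nat_cond prodf_seq_neq0; apply/allP => k _.
by apply/implyP => /andP[/andP[k1 ki] _]; apply: (phi_neq0 rP); lia.
Qed.

Let bcoS i : bco_ i.+1 = bco_ i * phi i.+1.
Proof. by rewrite /bco_ big_nat_recr. Qed.

Lemma hw_std_form : exists (B : 'M[K]_(udim V, l.+1)) (B' : 'M[K]_(l.+1, udim V)),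
  [/\ B *m B' = 1%:M, B' *m B = 1%:M & [/\ actE V *m B = B *m Emx K l,
   actF V *m B = B *m Fmx q l, forall la, actK V la *m B = B *m Kmx q l la
   & forall j : 'I_l.+1, col j B \in wtspace V (l%:Z - j%:Z, j%:Z)]].
Proof.
have col_mul m n p (A : 'M[K]_(m, n)) (C : 'M_(n, p)) j : col j (A *m C) = A *m col j C.
  by rewrite colE -mulmxA -colE.
have eq_col m n (A A' : 'M[K]_(m, n)) : (forall j, col j A = col j A') -> A = A'.
  by move=> AA; apply/matrixP => i j; have := congr1 (fun x : 'cV_m => x i 0) (AA j); rewrite !mxE.
have BE : actE V *m B = B *m Emx K l.
  apply: eq_col => j; rewrite !col_mul colB -scalemxAr actE_hw_orbit 1?ltnW // scalerA.
  have -> : B *m col j (Emx K l) = if nat_of_ord j is j'.+1 then (bco_ j')^-1 *: w j' else 0.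
    apply/colP => i; rewrite mxE; under eq_bigr => k _ do rewrite [col j _ _ _]mxE mulrC.
    rewrite Emx_col; case: j => [[|j] jl] /=; first by rewrite mxE.
    by rewrite (extE _ (ltnW jl)) !mxE.
  case: j => [[|j] jl] /=; first by rewrite phi0 mulr0 scale0r.
  by rewrite bcoS invfM mulfVK // (phi_neq0 rP).
have BF : actF V *m B = B *m Fmx q l.
  apply: eq_col => j; rewrite !col_mul colB -scalemxAr -/(w j.+1).
  have -> : B *m col j (Fmx q l) = phi j.+1 *: ((bco_ j.+1)^-1 *: w j.+1).
    apply/colP => i; rewrite mxE; under eq_bigr => k _ do rewrite [col j _ _ _]mxE mulrC.
    rewrite Fmx_col [RHS]mxE; congr (_ * _).
    have [jl|jl] := ltnP j.+1 l.+1; first by rewrite (extE _ jl) mxE [RHS]mxE.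
    by rewrite ext_out // hw_orbit_out // scaler0 mxE.
  have [jl|jl] := ltnP j l; last first.
    have w0 : w j.+1 = 0 by exact: hw_orbit_out.
    by rewrite w0 -[_ *m _]/(w j.+1) w0 !scaler0.
  by rewrite bcoS scalerA invfM mulrCA divff ?mulr1 ?(phi_neq0 rP) //=.
have BK la : actK V la *m B = B *m Kmx q l la.
  apply: eq_col => j; rewrite col_mul colB -scalemxAr (actK_orbit vK).
  apply/colP => i; rewrite [RHS]mxE mul_mx_diag [RHS]mxE !mxE mulrCA mulrC.
  by congr (_ * q ^ _); rewrite /= add0r.
have BW (j : 'I_l.+1) : col j B \in wtspace V (l%:Z - j%:Z, j%:Z).
  apply/mem_wtspace => la; rewrite colB -scalemxAr (actK_orbit vK) !scalerA mulrC.
  by congr (q ^ _ * _ *: _); rewrite /= add0r.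
(* The columns are independent, being nonzero eigenvectors of [K_(0,1)] with distinct
   eigenvalues. *)
have Bfull : row_full B.
  rewrite /row_full -mxrank_tr -/(row_free B^T); apply: inj_row_free => y By.
  apply/rowP => j; rewrite mxE; apply/eqP; case: eqVneq => // yj; exfalso.
  suff : w j = 0 by apply/eqP/hw_orbit_neq0; rewrite -ltnS.
  pose S := [set x | exists2 k : 'I_l.+1, k != j & x = w k]%classic.
  have ck := actK_orbit vK (0, 1).
  apply: (eigen_vspan_eq0 (S := S) _ (ck j)) => [_ [k kj ->]|].
    exists (q ^ k%:Z); last by rewrite ck; congr (q ^ _ *: _); rewrite /wprod /=; lia.
    apply: contra_neq kj => /(qz_inj rP) kj; apply: val_inj => /=.
    by move: kj; rewrite /wprod /=; lia.
  have colT k : row k B^T = (bco_ k)^-1 *: (w k)^T by rewrite -tr_col colB linearZ.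
  move: By; rewrite mulmx_sum_row (bigD1 j) //= => /eqP; rewrite addr_eq0 => /eqP By.
  have -> : w j = (y 0 j * (bco_ j)^-1)^-1 *: - (\sum_(i < l.+1 | i != j) (y 0 i * (bco_ i)^-1) *: w i).
    apply: trmx_inj; rewrite linearZ /= linearN /= linear_sum /=.
    under eq_bigr => k _ do rewrite linearZ /= -scalerA -colT.
    by rewrite -By colT scalerA scalerA -mulrA mulVf ?scale1r // mulf_neq0 ?invr_eq0 ?bco_neq0 -1?ltnS.
  by rewrite memvZ // memvN memv_suml // => k kj; rewrite memvZ //; apply: mem_vspan; exists k.
(* The columns span: a row vector killing them kills the whole [F]-orbit of [v], which is everything
   by simplicity. *)
have Bfree : row_free B.
  apply: inj_row_free => y By; pose f := linfun (mulmx y : 'cV[K]_(udim V) -> 'cV_1).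
  have f0 : (orbit_span v <= lker f)%VS.
    apply/vspanP => _ [i ->]; rewrite memv_ker lfunE /=.
    have [il|/hw_orbit_out->] := ltnP i l.+1; last by rewrite mulmx0.
    have := congr1 (col (Ordinal il)) By; rewrite col_mul colB /= -scalemxAr => /eqP.
    rewrite linear0 scaler_eq0 invr_eq0 (negPf (bco_neq0 _)) //.
  move: f0; rewrite (orbit_span_full vK vE sV v0) => /subvP f0.
  apply/rowP => i; have := f0 (delta_mx i 0) (memvf _).
  by rewrite memv_ker lfunE /= -colE => /eqP/colP/(_ 0); rewrite !mxE.
have [B1 BB1] := row_freeP Bfree; have [B2 B2B] := row_fullP Bfull.
have eB : B1 = B2 by rewrite -[B1]mul1mx -B2B -mulmxA BB1 mulmx1.
by exists B, B1; split=> //; rewrite eB.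
Qed.

End HighestWeight.

Lemma simple_std_form l (V : uqmod q) : is_simple_obj (l%:Z, 0) V ->
  exists (B : 'M[K]_(udim V, l.+1)) (B' : 'M[K]_(l.+1, udim V)),
  [/\ B *m B' = 1%:M, B' *m B = 1%:M & [/\ actE V *m B = B *m Emx K l,
   actF V *m B = B *m Fmx q l, forall la, actK V la *m B = B *m Kmx q l la
   & forall j : 'I_l.+1, col j B \in wtspace V (l%:Z - j%:Z, j%:Z)]].
Proof.
by move=> [_ sV [v [v0 /mem_wtspace vK vE]]]; exact: (hw_std_form vK vE v0 sV).
Qed.

End SimpleModule.

Lemma delta_tens (K : fieldType) m n i :
  (delta_mx i 0 : 'cV[K]_(m * n))
  = (delta_mx (mxtens_unindex i).1 0 : 'cV_m) *t (delta_mx (mxtens_unindex i).2 0 : 'cV_n).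
Proof.
apply/colP => k; rewrite !mxE !ord1 !andbT -(inj_eq (can_inj (@mxtens_unindexK m n))).
by case: (mxtens_unindex i) (mxtens_unindex k) => a b [c e]; rewrite xpair_eqE -natrM mulnb.
Qed.

Lemma eq_tens (K : fieldType) m n p (A A' : 'M[K]_(p, m * n)) :
  (forall (u : 'cV_m) (v : 'cV_n), A *m (u *t v) = A' *m (u *t v)) -> A = A'.
Proof.
move=> AA; apply/matrixP => i j.
have := congr1 (fun x : 'cV_p => x i 0) (AA (delta_mx (mxtens_unindex j).1 0) (delta_mx (mxtens_unindex j).2 0)).
by rewrite -!delta_tens -!colE !mxE.
Qed.

Lemma tens_mul_cV (K : fieldType) m n m' n' (A : 'M[K]_(m, m')) (B : 'M[K]_(n, n'))
    (u : 'cV_m') (v : 'cV_n') :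
  (A *t B) *m (u *t v : 'cV_(m' * n')) = ((A *m u) *t (B *m v) : 'cV_(m * n)).
Proof. exact: (tensmx_mul A B u v). Qed.

Lemma tau_tens (K : fieldType) m n m' n' (A : 'M[K]_(m, m')) (B : 'M[K]_(n, n')) :
  tau K m n *m (A *t B) = (B *t A) *m tau K m' n'.
Proof.
apply: eq_tens => u v; rewrite -!mulmxA tauE !tensmx_mul.
exact: tauE.
Qed.

Lemma conj_comm (K : fieldType) m p (C : 'M[K]_(m, p)) (C' : 'M[K]_(p, m)) (P X : 'M[K]_m) X0 :
  C *m C' = 1%:M -> C' *m C = 1%:M -> X *m C = C *m X0 -> P *m X = X *m P ->
  (C' *m P *m C) *m X0 = X0 *m (C' *m P *m C).
Proof.
move=> CC' C'C XC PX.
have C'X : C' *m X = X0 *m C'.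
  by rewrite -[C' *m X]mulmx1 -CC' mulmxA -(mulmxA C') XC !mulmxA C'C mul1mx.
by rewrite -mulmxA -XC mulmxA -(mulmxA _ P) PX !mulmxA C'X.
Qed.

(** * The braiding in the standard basis *)

Section StandardBraiding.
Variables (K : fieldType) (q : K).
Variable l : nat.
Local Notation d := l.+1.

Definition stdD : 'M[K]_(d * d) := diag_mx (\row_k
  q ^ wprod (l%:Z - (mxtens_unindex k).1%:Z, (mxtens_unindex k).1%:Z)
            (l%:Z - (mxtens_unindex k).2%:Z, (mxtens_unindex k).2%:Z)).

Definition stdP (c : nat -> K) (N : nat) : 'M[K]_(d * d) :=
  tau K d d *m (stdD *m \sum_(k < N.+1) c k *: (Fmx q l ^+ k *t Emx K l ^+ k)).

Lemma get2_tau (x : 'cV[K]_(d * d)) a b : (a < d)%N -> (b < d)%N ->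
  get2 (tau K d d *m x) a b = get2 x b a.
Proof.
move=> ad bd; have := get2_ord (tau K d d *m x) (Ordinal ad) (Ordinal bd); rewrite /= => ->.
have := get2_ord x (Ordinal bd) (Ordinal ad); rewrite /= => ->.
rewrite mxE (bigD1 (mxtens_index (Ordinal bd, Ordinal ad))) //= big1 ?addr0 => [|k kN].
  by rewrite mxE !mxtens_indexK !eqxx mul1r.
rewrite mxE mxtens_indexK /=; case: andP => [[/eqP e1 /eqP e2]|_]; last by rewrite mul0r.
by move: kN; rewrite e1 e2 -[mxtens_index _]/(mxtens_index (mxtens_unindex k)) mxtens_unindexK eqxx.
Qed.

Lemma Fmx_row0 k j : (Fmx q l ^+ k.+1) ord0 j = 0.
Proof. by rewrite exprS mxE big1 // => i _; rewrite mxE /= mul0r mul0r. Qed.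

Lemma Emx_col0 k : col ord0 (Emx K l ^+ k.+1) = 0.
Proof. by apply/colP => i; rewrite exprSr !mxE big1 // => j _; rewrite [Emx _ _ _ _]mxE mulr0. Qed.

Lemma Fmx_coll k : col ord_max (Fmx q l ^+ k.+1) = 0.
Proof.
apply/colP => i; rewrite exprSr !mxE big1 // => j _.
by rewrite [Fmx _ _ _ _]mxE /= ltn_eqF ?mul0r ?mulr0.
Qed.

Variables (c : nat -> K) (N : nat).
Hypothesis c0 : c 0%N = 1.

(** Row 0 of [F^k] is zero for [k > 0], so only the identity term of [R_1] contributes. *)
Lemma stdP_row (x : 'cV_(d * d)) b : (b <= l)%N ->
  get2 (stdP c N *m x) b 0 = q ^ (l%:Z * (l%:Z - b%:Z)) * get2 x 0 b.
Proof.
move=> bl; rewrite /stdP -mulmxA get2_tau // -mulmxA.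
have := get2_ord (stdD *m ((\sum_(k < N.+1) c k *: (Fmx q l ^+ k *t Emx K l ^+ k)) *m x)) ord0 (inord b).
rewrite inordK //= => ->; rewrite mul_diag_mx mxE [in X in X * _]mxE mxtens_indexK /= inordK //.
have -> : wprod (l%:Z - 0, 0) (l%:Z - b%:Z, b%:Z) = l%:Z * (l%:Z - b%:Z).
  by rewrite /wprod /=; ring.
congr (_ * _); rewrite mulmx_suml summxE big_ord_recl big1 ?addr0 => [|k _]; last first.
  rewrite -scalemxAl mxE tens_mulmxE big1 ?mulr0 // => i _.
  by rewrite Fmx_row0 mul0r.
rewrite -scalemxAl mxE tens_mulmxE c0 mul1r !expr0 sum_1_mx sum_1_mx -get2_ord.
by rewrite inordK.
Qed.

(** [E] kills the first basis vector and [F] the last one, so [R_1] fixes these tensors. *)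
Lemma stdP_tens (a b : 'I_d) : b = ord0 \/ a = ord_max ->
  stdP c N *m (delta_mx (mxtens_index (a, b)) 0 : 'cV_(d * d))
  = q ^ wprod (l%:Z - a%:Z, a%:Z) (l%:Z - b%:Z, b%:Z) *: delta_mx (mxtens_index (b, a)) 0.
Proof.
move=> ab; rewrite /stdP -!mulmxA.
have -> : (\sum_(k < N.+1) c k *: (Fmx q l ^+ k *t Emx K l ^+ k)) *m
    (delta_mx (mxtens_index (a, b)) 0 : 'cV_(d * d)) = delta_mx (mxtens_index (a, b)) 0.
  rewrite mulmx_suml big_ord_recl big1 ?addr0 => [|k _]; last first.
    rewrite -scalemxAl delta_tens mxtens_indexK tens_mul_cV -!colE.
    by case: ab => ->; rewrite ?Emx_col0 ?Fmx_coll ?tensmx0 ?tens0mx scaler0.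
  by rewrite c0 scale1r !expr0 tens11 mul1mx.
have -> : stdD *m (delta_mx (mxtens_index (a, b)) 0 : 'cV_(d * d))
   = q ^ wprod (l%:Z - a%:Z, a%:Z) (l%:Z - b%:Z, b%:Z) *: delta_mx (mxtens_index (a, b)) 0.
  apply/colP => k; rewrite mul_diag_mx !mxE.
  by case: eqP => [->|_]; rewrite ?mxtens_indexK // !mulr0.
rewrite -scalemxAr; congr (_ *: _).
rewrite !delta_tens !mxtens_indexK; exact: tauE.
Qed.

Lemma stdP_col (x : 'cV_(d * d)) (a b : 'I_d) : b = ord0 \/ a = ord_max ->
  get2 ((stdP c N)^T *m x) a b
  = q ^ wprod (l%:Z - a%:Z, a%:Z) (l%:Z - b%:Z, b%:Z) * get2 x b a.
Proof.
move=> ab; rewrite !get2_ord.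
have -> : ((stdP c N)^T *m x) (mxtens_index (a, b)) 0
    = ((stdP c N *m (delta_mx (mxtens_index (a, b)) 0 : 'cV_(d * d)))^T *m x) 0 0.
  by rewrite !mxE; apply: eq_bigr => i _; rewrite -colE !mxE.
rewrite stdP_tens // linearZ /= -scalemxAl mxE trmx_delta -rowE.
by rewrite mxE.
Qed.

Section Conjugate.
Variables (V : uqmod q) (B : 'M[K]_(udim V, d)) (B' : 'M[K]_(d, udim V)).
Hypotheses (BB' : B *m B' = 1%:M) (B'B : B' *m B = 1%:M).
Hypotheses (BE : actE V *m B = B *m Emx K l) (BF : actF V *m B = B *m Fmx q l)
  (BW : forall j : 'I_d, col j B \in wtspace V (l%:Z - j%:Z, j%:Z)).

Lemma tensBB' : (B *t B) *m (B' *t B') = 1%:M.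
Proof. by rewrite tensmx_mul BB' tens11. Qed.

Lemma tensB'B : (B' *t B') *m (B *t B) = 1%:M.
Proof. by rewrite tensmx_mul B'B tens11. Qed.

Lemma expr_std (A : 'M_(udim V)) (A0 : 'M_d) k : A *m B = B *m A0 ->
  (A ^+ k) *m B = B *m (A0 ^+ k).
Proof.
move=> AB; elim: k => [|k IH]; first by rewrite !expr0 mulmx1; exact: mul1mx.
by rewrite !exprS -!mulmxE -mulmxA IH !mulmxA AB.
Qed.

Lemma R0_std (R0 : 'M[K]_(udim V * udim V)) : is_R0 R0 ->
  R0 *m (B *t B) = (B *t B) *m stdD.
Proof.
move=> R0P; apply/matrixP => i j.
have := R0P _ _ _ _ (BW (mxtens_unindex j).1) (BW (mxtens_unindex j).2).
rewrite !colE -tens_mul_cV -delta_tens mulmxA -!colE => /colP/(_ i).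
by rewrite mul_mx_diag mxE => ->; rewrite !mxE mulrC.
Qed.

Lemma R1_std : R1_act c V V *m (B *t B)
  = (B *t B) *m (\sum_(k < (udim V).+1) c k *: (Fmx q l ^+ k *t Emx K l ^+ k)).
Proof.
rewrite /R1_act mulmx_suml mulmx_sumr; apply: eq_bigr => k _.
rewrite -scalemxAl -scalemxAr; congr (_ *: _).
by rewrite !tensmx_mul !(expr_std _ BE) !(expr_std _ BF).
Qed.

Section Universal.
Variables (R : forall U V : uqmod q, 'M[K]_(udim U * udim V)) (R0 : 'M[K]_(udim V * udim V)).
Hypotheses (R0P : is_R0 R0) (RE : R V V = R0 *m R1_act c V V).

Lemma braiding_std : (B' *t B') *m braiding R V V *m (B *t B) = stdP c (udim V).
Proof.
rewrite /braiding RE -!mulmxA R1_std (mulmxA R0) R0_std // !mulmxA.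
by rewrite -[_ *m _ *m (B *t B)]mulmxA tau_tens !mulmxA tensB'B mul1mx /stdP mulmxA.
Qed.

Lemma braid_intertwines (X Xop : 'M[K]_(udim V * udim V)) (X0 : 'M[K]_(d * d)) :
  R V V *m X = Xop *m R V V -> tau K _ _ *m Xop = X *m tau K _ _ ->
  X *m (B *t B) = (B *t B) *m X0 -> stdP c (udim V) *m X0 = X0 *m stdP c (udim V).
Proof.
move=> RX tX XB; rewrite -braiding_std; apply: (conj_comm tensBB' tensB'B XB).
by rewrite /braiding -mulmxA RX !mulmxA tX.
Qed.

End Universal.
End Conjugate.
End StandardBraiding.

Section UniversalBraiding.
Variables (K F : fieldType) (q : K) (res : K -> F -> Prop).
Hypothesis rP : residue q res.

Lemma universal_braid_op (R : forall U V : uqmod q, 'M[K]_(udim U * udim V))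
    (HR : universal_R R) l (V : uqmod q) (B : 'M[K]_(udim V, l.+1)) (B' : 'M[K]_(l.+1, udim V)) :
  in_Of V -> B *m B' = 1%:M -> B' *m B = 1%:M ->
  actE V *m B = B *m Emx K l -> actF V *m B = B *m Fmx q l ->
  (forall la, actK V la *m B = B *m Kmx q l la) ->
  (forall j : 'I_l.+1, col j B \in wtspace V (l%:Z - j%:Z, j%:Z)) ->
  braid_op rP ((B' *t B') *m braiding R V V *m (B *t B)).
Proof.
move=> VO BB' B'B BE BF BK BW; have [c [c0 Hc]] := HR.
have [[R0 [R0P RE]] [RcE RcF RcK]] := Hc V V VO VO.
have bE := braiding_std B'B BE BF BW R0P RE; rewrite bE.
have comm := braid_intertwines BB' B'B BE BF BW R0P RE.
(* The flip carries the opposite coproduct to the coproduct; thus [R Delta = Delta^op R] makes the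
   braiding an endomorphism. *)
have tD (A C A' C' : 'M[K]_(udim V)) : tau K _ _ *m (A *t C + A' *t C') = (C *t A + C' *t A') *m tau K _ _.
  by rewrite mulmxDr mulmxDl !tau_tens.
have DB (A C : 'M[K]_(udim V)) (A0 C0 : 'M[K]_l.+1) : A *m B = B *m A0 -> C *m B = B *m C0 ->
    (A *t C) *m (B *t B) = (B *t B) *m (A0 *t C0).
  by move=> AB CB; rewrite !tensmx_mul AB CB.
have DB2 (A C A' C' : 'M[K]_(udim V)) (A0 C0 A0' C0' : 'M[K]_l.+1) :
    A *m B = B *m A0 -> C *m B = B *m C0 -> A' *m B = B *m A0' -> C' *m B = B *m C0' ->
    (A *t C + A' *t C') *m (B *t B) = (B *t B) *m (A0 *t C0 + A0' *t C0').
  by move=> *; rewrite mulmxDl mulmxDr; congr (_ + _); apply: DB.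
have B1 : 1%:M *m B = B *m 1%:M by rewrite mul1mx mulmx1.
split.
- by apply: (comm _ _ _ RcE); [exact: tD|exact: DB2].
- by apply: (comm _ _ _ RcF); [exact: tD|exact: DB2].
- by move=> la; apply: (comm _ _ _ (RcK la)); [exact: tau_tens|exact: DB].
- by move=> x b; exact: stdP_row.
- move=> x a al; have := stdP_col q (udim V) c0 x (a := inord a) (b := ord0) (or_introl erefl).
  rewrite inordK //= => ->; congr (q ^ _ * _); rewrite /wprod /=; ring.
- move=> x b bl; have := stdP_col q (udim V) c0 x (a := ord_max) (b := inord b) (or_intror erefl).
  rewrite inordK //= => ->; congr (q ^ _ * _); rewrite /wprod /=; ring.
Qed.

End UniversalBraiding.

(** * Tensor powers and change of basis *)

Lemma mul_castmx (K : fieldType) m n p m' n' p' (em : m = m') (en : n = n') (ep : p = p')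
    (A : 'M[K]_(m, n)) (B : 'M[K]_(n, p)) :
  castmx (em, en) A *m castmx (en, ep) B = castmx (em, ep) (A *m B).
Proof. by case: _ / em; case: _ / en; case: _ / ep; rewrite !castmx_id. Qed.

Lemma castmx1 (K : fieldType) m m' (e : m = m') :
  castmx (e, e) (1%:M : 'M[K]_m) = 1%:M.
Proof. by case: _ / e; rewrite castmx_id. Qed.

Lemma castmx_ord (K : fieldType) m n m' n' (em : m = m') (en : n = n') (A : 'M[K]_(m, n)) i j :
  castmx (em, en) A (cast_ord em i) (cast_ord en j) = A i j.
Proof. by rewrite castmxE !cast_ordK. Qed.

Lemma cast_ord_ex m n (e : m = n) (k : 'I_n) : exists i, k = cast_ord e i.
Proof. by exists (cast_ord (esym e) k); rewrite cast_ordKV. Qed.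

Section TensorPower.
Variable K : fieldType.

Definition entry m n (A : 'M[K]_(m, n)) (a b : nat) : K :=
  ext (fun i => ext (fun j => A i j) b) a.

Lemma entry_ord m n (A : 'M[K]_(m, n)) (i : 'I_m) (j : 'I_n) : entry A i j = A i j.
Proof. by rewrite /entry !ext_ord. Qed.

Definition wentry m n (A : 'M[K]_(m, n)) (w w' : seq nat) : K :=
  \prod_(t <- zip w w') entry A t.1 t.2.

Lemma wentry_cat m n (A : 'M[K]_(m, n)) u v u' v' : size u = size u' ->
  wentry A (u ++ v) (u' ++ v') = wentry A u u' * wentry A v v'.
Proof. by move=> uu; rewrite /wentry zip_cat // big_cat. Qed.

Lemma wentry_cons m n (A : 'M[K]_(m, n)) a w a' w' :
  wentry A (a :: w) (a' :: w') = entry A a a' * wentry A w w'.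
Proof. by rewrite /wentry /= big_cons. Qed.

(* The n-th tensor power of A, with rows and columns indexed by words. *)
Definition tensp n d m (A : 'M[K]_(d, m)) : 'M[K]_(d ^ n, m ^ n) :=
  \matrix_(k, k') wentry A (word d n k) (word m n k').

Lemma word_eq d n (w : seq nat) k : (0 < d)%N -> all (fun a => a < d)%N w ->
  size w = n -> wnum d w = k -> word d n k = w.
Proof. by move=> d0 wd <- <-; exact: wordK. Qed.

Lemma word_ordS d n (a : 'I_d) (k : 'I_(d ^ n)) :
  word d n.+1 (cast_ord (esym (expnS d n)) (mxtens_index (a, k))) = val a :: word d n k.
Proof.
have d0 : (0 < d)%N by case: a => a; exact: leq_ltn_trans.
apply: word_eq => //=; first by rewrite ltn_ord all_word.
  by rewrite size_word.
by rewrite -cat1s wnum_cat // size_word wnumK // /wnum /= mul0n add0n.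
Qed.

Lemma tenspS n d m (A : 'M[K]_(d, m)) :
  tensp n.+1 A = castmx (esym (expnS d n), esym (expnS m n)) (A *t tensp n A).
Proof.
apply/matrixP => k k'; have [i ->] := cast_ord_ex (esym (expnS d n)) k.
have [i' ->] := cast_ord_ex (esym (expnS m n)) k'; rewrite castmx_ord.
case: (mxtens_indexP i) => a j; case: (mxtens_indexP i') => a' j'.
by rewrite tensmxE !mxE !word_ordS wentry_cons entry_ord.
Qed.

Lemma tensp_inv n d m (A : 'M[K]_(d, m)) (A' : 'M[K]_(m, d)) :
  A *m A' = 1%:M -> tensp n A *m tensp n A' = 1%:M.
Proof.
move=> AA'; elim: n => [|n IH].
  by apply/matrixP => i j; rewrite mxE big_ord1 !mxE !ord1 /wentry /= !big_nil mulr1.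
by rewrite !tenspS mul_castmx tensmx_mul AA' IH tens11 castmx1.
Qed.

Lemma word_mid d n (i : 'I_n.-1) (p : 'I_(d ^ i)) (a b : 'I_d) (s : 'I_(d ^ (n - 2 - i))) :
  word d n (cast_ord (tpow_dim d i) (mxtens_index (mxtens_index (p, mxtens_index (a, b)), s)))
  = word d i p ++ [:: val a, val b & word d (n - 2 - i) s].
Proof.
have d0 : (0 < d)%N by case: a => a; exact: leq_ltn_trans.
apply: word_eq => //=.
- by rewrite all_cat /= !ltn_ord !all_word.
- by rewrite size_cat /= !size_word; have := ltn_ord i; lia.
rewrite wnum_mid // !wnumK // !size_word /= -mulnn; lia.
Qed.

Lemma tensp_mid n d m (A : 'M[K]_(d, m)) (i : 'I_n.-1) :
  tensp n A = castmx (tpow_dim d i, tpow_dim m i)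
    (tensp i A *t (A *t A) *t tensp (n - 2 - i) A).
Proof.
apply/matrixP => k k'; have [j ->] := cast_ord_ex (tpow_dim d i) k.
have [j' ->] := cast_ord_ex (tpow_dim m i) k'; rewrite castmx_ord.
case: (mxtens_indexP j) => {}j s; case: (mxtens_indexP j) => p t; case: (mxtens_indexP t) => a b.
case: (mxtens_indexP j') => {}j' s'; case: (mxtens_indexP j') => p' t'; case: (mxtens_indexP t') => a' b'.
rewrite !tensmxE [LHS]mxE !word_mid wentry_cat ?size_word //.
by rewrite !wentry_cons !entry_ord !mxE !mulrA.
Qed.

End TensorPower.

Lemma vspan_mulmx (K : fieldType) m n (A : 'M[K]_(m, n)) (S : set 'cV[K]_n) (U : {vspace 'cV[K]_m}) :
  (forall x, S x -> A *m x \in U) -> forall x, x \in vspan S -> A *m x \in U.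
Proof.
move=> SU x xS; suff : linfun (mulmx A) x \in U by rewrite lfunE.
rewrite memv_preim; move: x xS; apply/subvP/vspanP => x Sx.
by rewrite -memv_preim lfunE; exact: SU.
Qed.

Lemma dim_mulmx_le (K : fieldType) m n (A : 'M[K]_(m, n)) (A' : 'M[K]_(n, m))
    (U : {vspace 'cV[K]_n}) (W : {vspace 'cV[K]_m}) :
  A' *m A = 1%:M -> (forall x, x \in U -> A *m x \in W) -> (\dim U <= \dim W)%N.
Proof.
move=> A'A UW; pose f := linfun (mulmx A : 'cV_n -> 'cV_m).
rewrite -(@limg_dim_eq _ _ _ f U).
  by apply/dimvS/subvP => _ /memv_imgP[x xU ->]; rewrite lfunE; exact: UW.
apply/eqP; rewrite -subv0; apply/subvP => x; rewrite memv_cap memv_ker lfunE /=.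
by move=> /andP[_ /eqP Ax]; rewrite memv0 -[x]mul1mx -A'A -mulmxA Ax mulmx0.
Qed.

Lemma mem_bigcapv (K : fieldType) (vT : vectType K) (I : finType) (U : I -> {vspace vT}) x :
  x \in (\bigcap_i U i)%VS <-> forall i, x \in U i.
Proof.
split=> [xU i|xU].
  by apply: (subvP _ _ xU); rewrite (bigD1 i) //= capvSl.
by elim/big_ind: _ => [|A B xA xB|i _]; rewrite ?memvf ?memv_cap ?xA.
Qed.

Lemma tpow_at_transport (K : fieldType) (n d m : nat) (A : 'M[K]_(d, m)) (W : {vspace 'cV[K]_(m * m)})
    (W' : {vspace 'cV[K]_(d * d)}) (i : 'I_n.-1) :
  (forall w, w \in W -> (A *t A) *m w \in W') ->
  forall x, x \in tpow_at W i -> tensp n A *m x \in tpow_at W' i.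
Proof.
move=> WW'; apply: vspan_mulmx => _ [a [w [b [wW ->]]]]; apply: mem_vspan.
exists (tensp i A *m a), ((A *t A) *m w), (tensp (n - 2 - i) A *m b); split; first exact: WW'.
by rewrite (tensp_mid _ i) mul_castmx !tensmx_mul.
Qed.

Lemma dim_tpow_transport (K : fieldType) n d m (B : 'M[K]_(m, d)) (B' : 'M[K]_(d, m))
    (W : {vspace 'cV[K]_(m * m)}) (W' : {vspace 'cV[K]_(d * d)}) :
  B *m B' = 1%:M -> B' *m B = 1%:M ->
  (forall w, w \in W -> (B' *t B') *m w \in W') ->
  (forall w, w \in W' -> (B *t B) *m w \in W) ->
  \dim (\bigcap_(i < n.-1) tpow_at W i)%VS = \dim (\bigcap_(i < n.-1) tpow_at W' i)%VS.
Proof.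
move=> BB' B'B WW' W'W; apply/eqP; rewrite eqn_leq; apply/andP; split.
  apply: (dim_mulmx_le (tensp_inv n BB')) => x /mem_bigcapv xW; apply/mem_bigcapv => i.
  by apply: (tpow_at_transport WW'); exact: xW.
apply: (dim_mulmx_le (tensp_inv n B'B)) => x /mem_bigcapv xW; apply/mem_bigcapv => i.
by apply: (tpow_at_transport W'W); exact: xW.
Qed.

Section Slices.
Variables (K : fieldType) (l n : nat).
Local Notation d := l.+1.
Implicit Types (x : 'cV[K]_(d ^ n)) (W : {vspace 'cV[K]_(d * d)}).

Definition slice x (u v : seq nat) : 'cV[K]_(d * d) :=
  mk2 d (fun a b => wval x (u ++ [:: a, b & v])).

Definition letters := all (fun a => a < d)%N.

Lemma wval_word x (k : 'I_(d ^ n)) : wval x (word d n k) = x k 0.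
Proof. by rewrite /wval wnumK // ext_ord. Qed.

Lemma letters_word u : letters u -> exists k : 'I_(d ^ size u), u = word d (size u) k.
Proof. by move=> ud; exists (Ordinal (wnum_lt (ltn0Sn l) ud)); rewrite /= wordK. Qed.

(** Fixing the letters outside positions [i + 1], [i + 2] is a linear map that sends each generating
    tensor to a multiple of its [w]; conversely [x] is the sum of its slices tensored with basis
    vectors. *)
Lemma tpow_atP W (i : 'I_n.-1) x : x \in tpow_at W i <->
  forall u v, letters u -> letters v -> size u = i -> size v = (n - 2 - i)%N ->
    slice x u v \in W.
Proof.
split=> [xW u v ud vd su sv|xW].
  have [p uE] := letters_word ud; have [s vE] := letters_word vd.
  move: p s uE vE; rewrite su sv => p s -> ->.
  pose Tk t := cast_ord (tpow_dim d i) (mxtens_index (mxtens_index (p, t), s)).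
  pose A : 'M[K]_(d * d, d ^ n) := \matrix_(t, k) (k == Tk t)%:R.
  have AE y : A *m y = \col_t y (Tk t) 0.
    apply/colP => t; rewrite !mxE (bigD1 (Tk t)) //= mxE eqxx mul1r big1 ?addr0 // => k kt.
    by rewrite mxE (negPf kt) mul0r.
  have -> : slice x (word d i p) (word d (n - 2 - i) s) = A *m x.
    rewrite AE; apply/colP => t; case: (mxtens_indexP t) => a b.
    by rewrite !mxE mxtens_indexK /= -word_mid wval_word.
  move: x xW; apply: vspan_mulmx => _ [a [w [b [wW ->]]]]; rewrite AE.
  suff -> : \col_t castmx (tpow_dim d i, erefl) (a *t w *t b) (Tk t) 0 = (a p 0 * b s 0) *: w.
    by rewrite memvZ.
  apply/colP => t; rewrite !mxE castmxE /= cast_ordK !mxE !mxtens_indexK /=.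
  by rewrite !ord1 mulrAC.
have -> : x = \sum_(p < d ^ i) \sum_(s < d ^ (n - 2 - i))
    castmx (tpow_dim d i, erefl) ((delta_mx p 0 : 'cV_(d ^ i))
      *t slice x (word d i p) (word d (n - 2 - i) s) *t (delta_mx s 0 : 'cV_(d ^ (n - 2 - i)))).
  apply/colP => k; have [j ->] := cast_ord_ex (tpow_dim d i) k.
  case: (mxtens_indexP j) => {}j s; case: (mxtens_indexP j) => p t.
  case: (mxtens_indexP t) => a b.
  have gen (p' : 'I_(d ^ i)) (s' : 'I_(d ^ (n - 2 - i))) : (castmx (tpow_dim d i, erefl) ((delta_mx p' 0 : 'cV_(d ^ i))
      *t slice x (word d i p') (word d (n - 2 - i) s') *t (delta_mx s' 0 : 'cV_(d ^ (n - 2 - i)))))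
      (cast_ord (tpow_dim d i) (mxtens_index (mxtens_index (p, mxtens_index (a, b)), s))) 0
      = (p == p')%:R * x (cast_ord (tpow_dim d i) (mxtens_index (mxtens_index (p', mxtens_index (a, b)), s'))) 0
        * (s == s')%:R.
    rewrite -wval_word word_mid castmxE cast_ordK mxE mxtens_indexK mxE mxtens_indexK.
    by rewrite mxE [in X in _ * X]mxE mxE mxtens_indexK !ord1 !andbT.
  rewrite summxE (bigD1 p) //= summxE (bigD1 s) //= gen !eqxx mul1r mulr1 !big1 ?addr0 //.
    by move=> p' p'p; rewrite summxE big1 // => s' _; rewrite gen eq_sym (negPf p'p) !mul0r.
  by move=> s' s's; rewrite gen [s == _]eq_sym (negPf s's) mulr0.
apply: memv_suml => p _; apply: memv_suml => s _; apply: mem_vspan.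
exists (delta_mx p 0), (slice x (word d i p) (word d (n - 2 - i) s)), (delta_mx s 0).
by split=> //; apply: xW; rewrite ?size_word // /letters all_word.
Qed.

End Slices.

(** * Dimensions *)

Lemma castmx1_mul (K : fieldType) m m' n (e : m = m') (A : 'M[K]_(m, n)) :
  castmx (e, erefl) 1%:M *m A = castmx (e, erefl) A.
Proof. by case: _ / e; rewrite !castmx_id mul1mx. Qed.

Section Standard.
Variables (K F : fieldType) (q : K) (res : K -> F -> Prop).
Hypothesis rP : residue q res.
Variable l : nat.
Local Notation d := l.+1.
Variable P : 'M[K]_(d * d).
Hypothesis bP : braid_op rP P.

Lemma cubeE : (d ^ 3 = d * d * d)%N.
Proof. by rewrite -mulnA. Qed.

(** The identification of the two index types, as an invertible matrix so that [dim_mulmx_le]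
    applies. *)
Definition cube_mx : 'M[K]_(d * d * d, d ^ 3) := castmx (cubeE, erefl) 1%:M.
Definition cube_mxV : 'M[K]_(d ^ 3, d * d * d) := castmx (esym cubeE, erefl) 1%:M.

Lemma cube_mxVE (x : 'cV_(d * d * d)) : cube_mxV *m x = castmx (esym cubeE, erefl) x.
Proof. exact: castmx1_mul. Qed.

Lemma cube_mxVK : cube_mxV *m cube_mx = 1%:M.
Proof. by rewrite castmx1_mul castmx_comp castmx_id. Qed.

Lemma cube_mxK : cube_mx *m cube_mxV = 1%:M.
Proof. by rewrite castmx1_mul castmx_comp castmx_id. Qed.

Lemma wval_cube (x : 'cV_(d * d * d)) a b c : (a < d)%N -> (b < d)%N -> (c < d)%N ->
  wval (cube_mxV *m x) [:: a; b; c] = get3 x a b c.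
Proof.
move=> ad bd cd; rewrite -[a]/(val (Ordinal ad)) -[b]/(val (Ordinal bd)) -[c]/(val (Ordinal cd)).
rewrite get3_ord; set k := mxtens_index _.
have kE : wnum d [:: a; b; c] = cast_ord (esym cubeE) k by rewrite /k /wnum /= mul0n add0n.
by rewrite /wval [wnum _ _]kE ext_ord cube_mxVE castmxE cast_ordK /= cast_ord_id.
Qed.

Lemma dim_cube (s : bool) :
  \dim (\bigcap_(i < 2) tpow_at (n := 3) (sgn_span q P s) i)%VS
  = (\sum_(i < ((l + l + l)./2).+1) hw_mult l s i * (l + l + l - 2 * i).+1)%N.
Proof.
set U := (\bigcap_(i < 2) _)%VS.
pose M := (linfun (mulmx cube_mx : 'cV_(d ^ 3) -> 'cV_(d * d * d)) @: U)%VS.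
have MU x : x \in M <-> cube_mxV *m x \in U.
  split=> [/memv_imgP[y yU ->]|xU]; first by rewrite lfunE /= mulmxA cube_mxVK mul1mx.
  by apply/memv_imgP; exists (cube_mxV *m x); rewrite // lfunE /= mulmxA cube_mxK mul1mx.
have -> : \dim U = \dim M.
  apply/eqP; rewrite eqn_leq; apply/andP; split.
    apply: (dim_mulmx_le cube_mxVK) => x xU; apply/MU.
    by rewrite mulmxA cube_mxVK mul1mx.
  by apply: (dim_mulmx_le cube_mxK) => x /MU.
apply: (dim_M bP) => x.
have s12 c : (c < d)%N -> slice (cube_mxV *m x) [::] [:: c] = sl12 x c.
  move=> cd; apply: get2_inj => a b ad bd; rewrite get2_mk2 //=.
  exact: wval_cube.
have s23 a : (a < d)%N -> slice (cube_mxV *m x) [:: a] [::] = sl23 x a.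
  move=> ad; apply: get2_inj => b c bd cd; rewrite get2_mk2 // get2_sl23 /=.
  exact: wval_cube.
rewrite MU /U; split.
  move/mem_bigcapv => xU; split=> c; have [cd|dc] := ltnP c d.
  - by rewrite -s12 //; apply: (proj1 (tpow_atP _ _ _) (xU 0)); rewrite //= cd.
  - by rewrite sl12_out ?mem0v.
  by rewrite -s23 //; apply: (proj1 (tpow_atP _ _ _) (xU ord_max)); rewrite //= cd.
  - by rewrite sl23_out ?mem0v.
move=> [x12 x23]; apply/mem_bigcapv => i; apply/tpow_atP => u v ud vd.
case: i => [[|[|i]] i2] //=.
  case: u ud => // _ _; case: v vd => [|c [|? ?]] //= /andP[cd _] _.
  by rewrite s12.
case: u ud => [|a [|? ?]] //= /andP[ad _] _; case: v vd => // _ _.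
by rewrite s23.
Qed.

Lemma dim_small n : (l <= 2)%N ->
  \dim (\bigcap_(i < n.-1) tpow_at (sgn_span q P false) i)%VS = 'C(l + n, n).
Proof.
move=> l2; apply: (dim_straightened (p := q ^- l)) => // x; split.
  move/mem_bigcapv => xU u v a b wd sw ab.
  have /and4P[ud bd ad vd] : [&& letters l u, (b < d)%N, (a < d)%N & letters l v].
    by rewrite all_cat in wd.
  have un : (size u < n.-1)%N by rewrite -sw size_cat /=; lia.
  have sv : size v = (n - 2 - size u)%N by rewrite -sw size_cat /=; lia.
  have sS : slice x u v \in sgn_span q P false.
    exact: (proj1 (tpow_atP _ (Ordinal un) _) (xU _)).
  have abl : (a < b <= l)%N by rewrite ab.
  have /(_ a b abl) := proj1 (sgn_quadraticP bP _ l2) sS.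
  rewrite /straight; case: ifP => [/andP[/eqP b2 /eqP a0]|_].
    by subst b a; rewrite !get2_mk2 //; lia.
  by rewrite !get2_mk2.
move=> sx; apply/mem_bigcapv => i; apply/tpow_atP => u v ud vd su sv.
apply/(sgn_quadraticP bP _ l2) => a b /andP[ab bl].
have bd : (b < d)%N by []. have ad : (a < d)%N by exact: ltn_trans bd.
rewrite get2_mk2 // (sx u v a b) //.
- rewrite /straight; case: ifP => [/andP[/eqP b2 /eqP a0]|_].
    by subst b a; rewrite !get2_mk2 //; lia.
  by rewrite !get2_mk2.
- by rewrite all_cat /= bd ad; apply/andP.
- by rewrite size_cat /= su sv; have := ltn_ord i; lia.
Qed.

End Standard.

Lemma eq_vspan (K : fieldType) (vT : vectType K) (A B : set vT) :
  (forall v, A v <-> B v) -> vspan A = vspan B.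
Proof.
move=> AB; apply/eqP; rewrite eqEsubv; apply/andP.
by split; apply/vspanP => v /AB vP; exact: mem_vspan.
Qed.

Lemma sgn_span_conj (K : fieldType) (q : K) m n (Q : 'M[K]_m) (C : 'M[K]_(m, n))
    (C' : 'M[K]_(n, m)) s v : C *m C' = 1%:M ->
  v \in sgn_span q Q s -> C' *m v \in sgn_span q (C' *m Q *m C) s.
Proof.
move=> CC'; apply: vspan_mulmx => {}v [k Qv]; apply: mem_vspan; exists k.
by rewrite -!mulmxA (mulmxA C) CC' mul1mx Qv -scalemxAr.
Qed.

Section Simple.
Variables (K F : fieldType) (q : K) (res : K -> F -> Prop).
Hypothesis rP : residue q res.
Variable R : forall U V : uqmod q, 'M[K]_(udim U * udim V).
Hypothesis HR : universal_R R.
Variables (l : nat) (V : uqmod q).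
Hypothesis HV : is_simple_obj (l%:Z, 0) V.

Lemma simple_udim : udim V = l.+1.
Proof.
have [B [B' [BB' B'B _]]] := simple_std_form rP HV.
by apply/eqP; rewrite eqn_leq (mulmx1_min BB') (mulmx1_min B'B).
Qed.

Lemma S2_sgn : S2 R V = sgn_span q (braiding R V V) false.
Proof. by apply: eq_vspan => v; split=> -[k]; exists k; rewrite ?expr0 ?mul1r // -[q ^ k]mul1r. Qed.

Lemma L2_sgn : L2 R V = sgn_span q (braiding R V V) true.
Proof. by apply: eq_vspan => v; split=> -[k]; exists k; rewrite ?expr1 ?mulN1r // -mulN1r. Qed.

Lemma simple_std_braiding : exists2 P : 'M[K]_(l.+1 * l.+1), braid_op rP P &
  forall n s, \dim (\bigcap_(i < n.-1) tpow_at (sgn_span q (braiding R V V) s) i)%VS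
    = \dim (\bigcap_(i < n.-1) tpow_at (sgn_span q P s) i)%VS.
Proof.
have [B [B' [BB' B'B [BE BF BK BW]]]] := simple_std_form rP HV.
have [VO _ _] := HV.
exists ((B' *t B') *m braiding R V V *m (B *t B)); first exact: (universal_braid_op rP HR).
have CC' := tensBB' BB'; have C'C := tensB'B B'B.
move=> n s; apply: (dim_tpow_transport _ BB' B'B) => w wS.
  exact: sgn_span_conj.
have -> : braiding R V V = (B *t B) *m ((B' *t B') *m braiding R V V *m (B *t B)) *m (B' *t B').
  by rewrite -!mulmxA CC' mulmx1 mulmxA CC' mul1mx.
exact: sgn_span_conj.
Qed.

Lemma dim_Lsigma3 : \dim (Lsigma R 3 V) = (delta l * 'C(l./2 + 1, 2))%N.
Proof.
have [P bP dP] := simple_std_braiding.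
by rewrite /Lsigma L2_sgn (dP 3) (dim_cube bP) hw_mult_alternating.
Qed.

Lemma dim_Ssigma3 : \dim (Ssigma R 3 V) = ((l + 1) ^ 2 + delta l * 'C(l./2 + 1, 2))%N.
Proof.
have [P bP dP] := simple_std_braiding.
by rewrite /Ssigma S2_sgn (dP 3) (dim_cube bP) hw_mult_symmetric.
Qed.

Lemma dim_Ssigma_small n : (l <= 2)%N -> \dim (Ssigma R n V) = 'C(l + n, n).
Proof.
have [P bP dP] := simple_std_braiding.
by move=> l2; rewrite /Ssigma S2_sgn dP (dim_small bP).
Qed.

Lemma flatP : flat R V <-> (l <= 2)%N.
Proof.
split=> [fV|l2 n]; last by rewrite dim_Ssigma_small // simple_udim; congr 'C(_, _); lia.
rewrite leqNgt; apply/negP => l3; have := symmetric_cube_not_flat l3.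
by rewrite -dim_Ssigma3 (fV 3) simple_udim ltnn.
Qed.

End Simple.

Theorem corollary2p36 (R : realType)
    (Rmat : forall U V : uqmod (qvar R), 'M[Cq R]_(udim U * udim V))
    (HR : universal_R Rmat)
    (l : nat) (V : uqmod (qvar R))
    (HV : is_simple_obj (l%:Z, 0) V) :
  [/\ \dim (Lsigma Rmat 3 V) = (delta l * 'C(l./2 + 1, 2))%N,
      \dim (Ssigma Rmat 3 V) = ((l + 1) ^ 2 + delta l * 'C(l./2 + 1, 2))%N
    & flat Rmat V <-> l \in [:: 0; 1; 2]%N].
Proof.
have two : (1 + 1 : R[i]) != 0 by rewrite -(natrD _ 1 1) Num.Theory.pnatr_eq0.
(* The valuation is that of rational functions at q = 0, with residue field the complex numbers. *)
have rP : residue (qvar R) (@frac_res R[i]) by exact: frac_residue two.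
split; [exact: (dim_Lsigma3 rP HR HV)|exact: (dim_Ssigma3 rP HR HV)|].
by rewrite (flatP rP HR HV) !inE; split; lia.
Qed.
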